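(* Let $\Sigma$ be a compact $(n-1)$-manifold (without boundary), $n\ge3$, with a fixed Riemannian metric $\gamma$ and Laplacian $\Delta=\Delta_\gamma$. Let $f$ be a $C^\infty$ function on $[\tau_0,\infty)\times\Sigma$, bounded and satisfying $f\ge0$ and $\partial_\tau f\ge 0$. Then any solution $v$ of $$\frac{\partial v}{\partial\tau}=v^2\Delta v+fv^3-\tfrac12 v$$ on $[\tau_0,\infty)\times\Sigma$ satisfying $v\ge\mu$ for some positive constant $\mu$ in addition satisfies $v\le M$ on $[\tau_0,\infty)\times\Sigma$ for some constant $M<\infty$.
   Context: Solutions $v$ are $C^\infty$ on $[\tau_0,\infty)\times\Sigma$. *)

(* Defs.v *)
(* MathComp-Analysis; the reals are an arbitrary [R : realType]. *)
From HB Require Import structures.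
From mathcomp Require Export all_boot all_order all_algebra.
From mathcomp Require Export all_classical all_reals all_analysis.
Export numFieldNormedType.Exports.

Set Implicit Arguments.
Unset Strict Implicit.
Unset Printing Implicit Defensive.

Import Order.TTheory GRing.Theory Num.Theory.

Global Open Scope classical_set_scope.
Global Open Scope ring_scope.

Notation pbasis a := (delta_mx (0 : 'I_1) a) (only parsing).

(* Meant for open [U]: all partial derivatives of order at most [k] exist and
   are continuous on [U]; the values of [f] outside [U] play no role. *)
Fixpoint Ck_on (R : realType) (m : nat) (U : set 'rV[R]_m) (k : nat)
    (f : 'rV[R]_m -> R) : Prop :=
  {within U, continuous f} /\
  match k with
  | 0%N => True
  | k'.+1 => forall a : 'I_m,
      (forall x, U x -> derivable f x (pbasis a)) /\
      Ck_on U k' ('D_(pbasis a) f)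
  end.

Definition smooth_on (R : realType) (m : nat) (U : set 'rV[R]_m)
    (f : 'rV[R]_m -> R) : Prop :=
  forall k, Ck_on U k f.

(* An atlas of dimension [m] without boundary: chart images are open in all of
   R^m. Separation and compactness are imposed on [S] separately (for compact
   [S], second countability is then automatic). [chart_inv i] is the inverse
   of [chart i] and is only meaningful on the image of [chart i]. *)
Record smooth_atlas (R : realType) (m : nat) (S : topologicalType) := SmoothAtlas {
  chart_idx : Type ;
  chart_dom : chart_idx -> set S ;
  chart : chart_idx -> S -> 'rV[R]_m ;
  chart_inv : chart_idx -> 'rV[R]_m -> S ;
  chart_at : S -> chart_idx ;
  chart_dom_at : forall p, chart_dom (chart_at p) p ;
  chart_dom_open : forall i, open (chart_dom i) ;
  chart_img_open : forall i, open (chart i @` chart_dom i) ;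
  chartK : forall i p, chart_dom i p -> chart_inv i (chart i p) = p ;
  chart_continuous : forall i, {within chart_dom i, continuous (chart i)} ;
  chart_inv_continuous : forall i,
    {within chart i @` chart_dom i, continuous (chart_inv i)} ;
  chart_transition_smooth : forall i j (a : 'I_m),
    smooth_on (chart i @` (chart_dom i `&` chart_dom j))
              (fun y => chart j (chart_inv i y) 0 a)
}.

Definition chart_img (R : realType) (m : nat) (S : topologicalType)
    (A : smooth_atlas R m S) (i : chart_idx A) : set 'rV[R]_m :=
  chart i @` chart_dom i.

(* A metric is given by its matrices [g_ab] in the charts. With row vectors,
   ['J f y] has entries [d_a f_b] and a tangent vector [w] is pushed forward to
   [w *m 'J f y]; this dictates the shape of the tensor transformation law. *)
Record riemannian_metric (R : realType) (m : nat) (S : topologicalType)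
    (A : smooth_atlas R m S) := RiemannianMetric {
  metric_mx : chart_idx A -> 'rV[R]_m -> 'M[R]_m ;
  metric_smooth : forall i (a b : 'I_m),
    smooth_on (chart_img i) (fun y => metric_mx i y a b) ;
  metric_sym : forall i y, chart_img i y -> (metric_mx i y)^T = metric_mx i y ;
  metric_pos : forall i y (w : 'rV[R]_m), chart_img i y -> w != 0 ->
    0 < (w *m metric_mx i y *m w^T) 0 0 ;
  metric_change : forall i j p, chart_dom i p -> chart_dom j p ->
    let J := 'J (fun y => chart j (chart_inv i y)) (chart i p) in
    metric_mx i (chart i p) = J *m metric_mx j (chart j p) *m J^T
}.

Section Laplacian.
Context (R : realType) (m : nat) (S : topologicalType).
Context (A : smooth_atlas R m S) (g : riemannian_metric A).

Definition vol_density (i : chart_idx A) (y : 'rV[R]_m) : R :=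
  Num.sqrt (\det (metric_mx g i y)).

(* (det g)^(-1/2) d_a ((det g)^(1/2) g^{ab} d_b w) *)
Definition laplacian_coord (i : chart_idx A) (w : 'rV[R]_m -> R)
    (y : 'rV[R]_m) : R :=
  (vol_density i y)^-1 *
  \sum_(a < m) 'D_(pbasis a) (fun z => vol_density i z *
    \sum_(b < m) invmx (metric_mx g i z) a b * 'D_(pbasis b) w z) y.

(* The Laplace-Beltrami operator, computed in the preferred chart at [p]; for
   smooth [u] the value does not depend on the chart used. *)
Definition laplacian (u : S -> R) (p : S) : R :=
  laplacian_coord (chart_at A p) (u \o chart_inv (chart_at A p))
                  (chart (chart_at A p) p).

End Laplacian.

Section TimeDependent.
Context (R : realType) (tau0 : R).

(* Difference quotients only use times in [tau0, +oo[, so the time derivative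
   is one-sided at [tau0] and the ordinary one at later times. *)
Definition time_filter (t : R) : set_system R :=
  within [set h | tau0 <= t + h] (0 : R)^'.

Definition time_quotient (u : R -> R) (t h : R) : R :=
  h^-1 * (u (t + h) - u t).

Definition time_derivable (u : R -> R) (t : R) : Prop :=
  cvg (time_quotient u t @ time_filter t).

Definition time_derive (u : R -> R) (t : R) : R :=
  lim (time_quotient u t @ time_filter t).

(* [Ck_on] for functions of (t, x) in [tau0, +oo[ x U, with [U] open: all mixed
   partial derivatives of order at most [k] exist and are continuous up to and
   including t = tau0. *)
Fixpoint Ck_cylinder (m : nat) (U : set 'rV[R]_m) (k : nat)
    (F : R -> 'rV[R]_m -> R) : Prop :=
  {within [set z : R * 'rV[R]_m | tau0 <= z.1 /\ U z.2],
    continuous (fun z : R * 'rV[R]_m => F z.1 z.2)} /\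
  match k with
  | 0%N => True
  | k'.+1 =>
    [/\ forall t x, tau0 <= t -> U x -> time_derivable (F ^~ x) t,
        Ck_cylinder U k' (fun t x => time_derive (F ^~ x) t) &
        forall a : 'I_m,
          (forall t x, tau0 <= t -> U x -> derivable (F t) x (pbasis a)) /\
          Ck_cylinder U k' (fun t => 'D_(pbasis a) (F t))]
  end.

Definition smooth_cylinder (m : nat) (S : topologicalType)
    (A : smooth_atlas R m S) (u : R -> S -> R) : Prop :=
  forall (i : chart_idx A) (k : nat),
    Ck_cylinder (chart_img i) k (fun t y => u t (chart_inv i y)).

End TimeDependent.

(* Main.v *)
(* Only maximum principles are used. Since [f] is nondecreasing, a rescaling of time turns [v]
   into a supersolution, and comparison yields [c * v t <= v t'] for [t <= t' <= t + 1]. Dividing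
   the equation by [v^2] and averaging over [t, t + 1] gives a function [V] on the manifold with
   [|Delta V + average (f v)| <= C], because [v_t / v^2 = - (1/v)_t] and [1/v <= 1/mu].
   If [v] were unbounded, such averages [V_k] at times tending to infinity would have maxima
   [N_k] tending to infinity. The functions [W_k = V_k / N_k] take values in [0, 1], reach [1],
   and have bounded Laplacians whose positive parts tend to [0]. They are equicontinuous (doubling
   of variables), hence bounded below near a limit [p] of the maximum points, and barriers
   propagate a positive lower bound to the whole component [C] of [p]. If [f] vanishes on [C], the
   maximum principle bounds [v] on [C], which is absurd. Otherwise [f] stays above a positive
   constant on some open part of [C] from some time on, where [Delta W_k] is then below a negative
   constant; barriers again make [W_k - min_C W_k] positive on all of [C] in the limit, which is
   absurd at a limit of the minimum points. *)
From HB Require Import structures.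
Require Import Defs.
From mathcomp Require Import perm ring lra.
Set Implicit Arguments.
Unset Strict Implicit.
Unset Printing Implicit Defensive.
Import Order.TTheory GRing.Theory Num.Theory.

(** * Partial derivatives and second differences *)

Section Calculus.
Context {R : realType} {m : nat}.
Implicit Types (f : 'rV[R]_m -> R) (x v w : 'rV[R]_m) (U : set 'rV[R]_m).

(** The obstacle is the diffusion coefficient [v^2]: it is unbounded as long as [v] is, so parabolic
    estimates for [v] would depend on the very bound sought. The comparison in time only relates
    values at one and the same point; it is what prevents a short spike of [v] from being lost in an
    average. Averaging then leaves the fixed operator [Delta], whose constants depend on the metric
    alone. For the averages only the size of the Laplacian is controlled, not its regularity; hence
    a modulus of continuity obtained from a concave penalty instead of derivative estimates. No
    limit function is constructed: limits run along an ultrafilter on the indices, and positivity of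
    a limit at a point means a lower bound, uniform in the index, on a fixed neighbourhood. Averages
    are finite sums, so no integral has to be differentiated. Components enter because the manifold
    may be disconnected. *)

Lemma is_derive_line f x v (t : R) : derivable f (x + t *: v) v ->
  is_derive t 1 (fun s : R => f (x + s *: v)) ('D_v f (x + t *: v)).
Proof.
have E : (fun h : R => h^-1 *: ((fun s : R => f (x + s *: v)) (h *: 1 + t) -
    f (x + t *: v))) =
  (fun h => h^-1 *: (f (h *: v + (x + t *: v)) - f (x + t *: v))).
  apply/funext => h /=; congr (_ *: (f _ - _)).
  by rewrite [_%:A]mulr1 scalerDl addrCA.
by move=> df; apply: DeriveDef; rewrite /derivable /derive /= E.
Qed.

Lemma mean_value_line f x v (t : R) :
  (forall s : R, 0 <= s <= 1 -> derivable f (x + (s * t) *: v) v) ->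
  exists2 s : R, 0 <= s <= 1 & f (x + t *: v) - f x = t * 'D_v f (x + (s * t) *: v).
Proof.
move=> df.
have dg (s : R) : 0 <= s <= 1 ->
    is_derive s 1 (fun s : R => f (x + (s * t) *: v)) ('D_v f (x + (s * t) *: v) * t).
  move=> s01.
  have h1 := @is_derive_line f x v (s * t) (df _ s01).
  have h2 : is_derive s 1 (fun s : R => s * t) t.
    have := @is_deriveM R R id (cst t) s 1 1 0 (is_derive_id _ _) (is_derive_cst _ _ _).
    by rewrite scaler0 add0r [_%:A]mulr1.
  exact: (@is_derive1_comp _ (fun s : R => f (x + s *: v)) (fun s : R => s * t)).
have [|||c cI E] := @MVT_segment R (fun s : R => f (x + (s * t) *: v))
  (fun s => 'D_v f (x + (s * t) *: v) * t) 0 1.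
- exact: ler01.
- by move=> s; rewrite in_itv/= => /andP[a b]; apply: dg; rewrite !ltW.
- apply: derivable_within_continuous => s; rewrite in_itv/= => s01.
  by have [] := dg _ s01.
by exists c; [by move: cI; rewrite in_itv|move: E; rewrite mul1r mul0r scale0r addr0 subr0 mulr1 mulrC].
Qed.

Lemma cvg_bigsum (T I : Type) (F : set_system T) {FF : Filter F} (r : seq I)
    (P : pred I) (g : I -> T -> R) (l : I -> R) :
  (forall i, P i -> g i x @[x --> F] --> l i) ->
  \sum_(i <- r | P i) g i x @[x --> F] --> \sum_(i <- r | P i) l i.
Proof. by move=> gl; apply: cvg_big => //; exact: add_continuous. Qed.

(** The norm of a row vector is its largest coordinate in absolute value, so balls are boxes. The
    Euclidean square length is [bil 1%:M w w]; passing between the two costs factors [m%:R]. *)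
Lemma coord_le_norm (w : 'rV[R]_m) a : `|w 0 a| <= `|w|.
Proof.
rewrite [in leRHS]/Num.norm/= mx_normrE.
by apply: (le_trans _ (@le_bigmax _ _ _ 0 (fun ij => `|w ij.1 ij.2|) (0, a))).
Qed.

Lemma norm_le_coord (w : 'rV[R]_m) (c : R) :
  0 <= c -> (forall a, `|w 0 a| <= c) -> `|w| <= c.
Proof.
move=> c0 wc; rewrite /Num.norm/= mx_normrE; apply/bigmax_leP; split=> // -[i j] _ /=.
by rewrite (ord1 i).
Qed.

(** The candidate differential, made a linear map so that [diff_unique] can identify it with the
    differential of [f]. *)
Definition grad_form (c : 'I_m -> R) (h : 'rV[R]_m) : R := \sum_a h 0 a * c a.

Lemma grad_form_is_linear c : linear (grad_form c).
Proof.
move=> k u v; rewrite /grad_form scaler_sumr -big_split/=; apply: eq_bigr => a _.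
by rewrite !mxE mulrDl; congr (_ + _); rewrite -mulrA.
Qed.

HB.instance Definition _ c := GRing.isLinear.Build R 'rV[R]_m R _ (grad_form c)
  (grad_form_is_linear c).

Lemma grad_form_continuous c : continuous (grad_form c).
Proof.
move=> x; apply: (@cvg_bigsum _ _ (nbhs x)) => a _.
by apply: cvgM; [exact: coord_continuous|exact: cvg_cst].
Qed.

(* Moves from [x] to [h + x] by one coordinate direction at a time. *)
Lemma partials_differentiable f U x : open U -> U x ->
  (forall (a : 'I_m) y, U y -> derivable f y (pbasis a)) ->
  (forall a : 'I_m, {for x, continuous ('D_(pbasis a) f)}) ->
  differentiable f x /\
  'd f x = grad_form (fun a : 'I_m => 'D_(pbasis a) f x) :> ('rV[R]_m -> R).
Proof.
move=> oU Ux dU cx.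
pose c (a : 'I_m) : R := 'D_(pbasis a) f x.
have D0 := @diff_unique R 'rV[R]_m R f (grad_form c) x (@grad_form_continuous c).
match type of D0 with ?P -> _ => suff E : P end.
  have D := D0 E.
  by split => //; apply/diff_locallyP; rewrite D; split=> //; exact: grad_form_continuous.
suff main (e : R) : 0 < e ->
    \forall h \near (0 : 'rV[R]_m), `|f (h + x) - (f x + grad_form c h)| <= e * `|h|.
  by apply/eqaddoP => e e0; exact: main.
move=> e0.
have m0 : 0 < m%:R + 1 :> R by rewrite ltr_wpDl.
have e'0 : 0 < e / (m%:R + 1) by rewrite divr_gt0.
have : \forall y \near x, U y /\ forall a, `|c a - 'D_(pbasis a) f y| <= e / (m%:R + 1).
  near=> y; split; first by near: y; exact: open_nbhs_nbhs.
  near: y; apply: filter_forall => a.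
  by have /cvgrPdist_le := cx a; exact.
move=> /nbhs_ballP[d /= d0 Hd].
have hd0 : \forall h \near (0 : 'rV[R]_m), `|h| < d by exact: nbhs0_lt.
apply: (filterS _ hd0) => /= h hd.
pose tr (k : nat) : 'rV[R]_m := \row_a (if (a < k)%N then h 0 a else 0).
have tr0 : tr 0%N = 0 by apply/rowP => a; rewrite !mxE.
have trm : tr m = h by apply/rowP => a; rewrite !mxE ltn_ord.
have trS (a : 'I_m) : tr a.+1 = tr a + h 0 a *: pbasis a.
  apply/rowP => b; rewrite !mxE eqxx /= ltnS leq_eqVlt.
  rewrite (inj_eq val_inj).
  by have [->|ba] := eqVneq b a; rewrite /= ?ltnn ?mulr1 ?add0r ?mulr0 ?addr0.
have step (a : 'I_m) : `|f (x + tr a.+1) - f (x + tr a) - h 0 a * c a| <=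
    e / (m%:R + 1) * `|h|.
  have B (s : R) : 0 <= s <= 1 -> ball x d (x + tr a + (s * h 0 a) *: pbasis a).
    move=> /andP[s0 s1]; rewrite -ball_normE /= opprD addrA -addrA opprD !addrA subrr.
    rewrite sub0r -opprD normrN (le_lt_trans _ hd)//; apply: norm_le_coord => // b.
    rewrite !mxE eqxx/=; have [->|ba] := eqVneq b a.
      rewrite ltnn add0r mulr1 normrM (ger0_norm s0).
      by rewrite (le_trans _ (coord_le_norm h a))// ler_piMl.
    by rewrite mulr0 addr0; case: ifP => _; rewrite ?normr0 ?coord_le_norm.
  rewrite trS addrA.
  have [|s s01 ->] := @mean_value_line f (x + tr a) (pbasis a) (h 0 a).
    by move=> s s01; apply: dU; have [] := Hd _ (B s s01).
  rewrite -mulrBr normrM mulrC ler_pM ?coord_le_norm// distrC.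
  by have [_] := Hd _ (B s s01); apply.
have -> : f (h + x) - (f x + grad_form c h) =
    \sum_(a < m) (f (x + tr a.+1) - f (x + tr a) - h 0 a * c a).
  rewrite sumrB -(big_mkord xpredT (fun k => f (x + tr k.+1) - f (x + tr k))).
  rewrite telescope_sumr// tr0 trm addr0.
  by rewrite opprD addrA [x + h]addrC.
apply: (le_trans (ler_norm_sum _ _ _)).
apply: (le_trans (ler_sum _ (fun a _ => step a))).
rewrite sumr_const card_ord -[leLHS]mulr_natr mulrAC ler_wpM2r//.
by rewrite -mulrA ger_pMr// mulrC ler_pdivrMr// mul1r lerDl.
Unshelve. all: by end_near. Qed.

Lemma partials_derive f U x v : open U -> U x ->
  (forall (a : 'I_m) y, U y -> derivable f y (pbasis a)) ->
  (forall a : 'I_m, {for x, continuous ('D_(pbasis a) f)}) ->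
  'D_v f x = \sum_a v 0 a * 'D_(pbasis a) f x.
Proof.
move=> oU Ux dU cx; have [dfx E] := partials_differentiable oU Ux dU cx.
by rewrite deriveE// E.
Qed.

Definition C1 U f := (forall (a : 'I_m) y, U y -> derivable f y (pbasis a)) /\
  (forall (a : 'I_m) y, U y -> {for y, continuous ('D_(pbasis a) f)}).

Definition C2 U f := C1 U f /\ forall a : 'I_m, C1 U ('D_(pbasis a) f).

Lemma Ck_on_continuous U k f x : open U -> Ck_on U k f -> U x ->
  {for x, continuous f}.
Proof.
move=> oU h Ux; have : {within U, continuous f} by case: k h => [|k] [].
by rewrite continuous_open_subspace// => /(_ x); apply; rewrite inE.
Qed.

Lemma Ck_on_C1 U k f : open U -> Ck_on U k.+1 f -> C1 U f.
Proof.
move=> oU [_ h]; split=> [a y|a y Uy]; first by case: (h a) => + _; apply.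
by case: (h a) => _ /Ck_on_continuous; apply.
Qed.

Lemma Ck_on_C2 U k f : open U -> Ck_on U k.+2 f -> C2 U f.
Proof.
move=> oU h; split; first exact: Ck_on_C1 h.
by move=> a; case: h => _ /(_ a)[_ h]; exact: Ck_on_C1 h.
Qed.

Lemma C1_differentiable U f x : open U -> C1 U f -> U x -> differentiable f x.
Proof.
by move=> oU [h1 h2] Ux; have [] := @partials_differentiable f U x oU Ux h1 (h2^~ x ^~ Ux).
Qed.

Lemma C1_derivable U f x v : open U -> C1 U f -> U x -> derivable f x v.
Proof. by move=> oU f1 Ux; apply: diff_derivable; exact: C1_differentiable f1 Ux. Qed.

Lemma C1_derive U f x v : open U -> C1 U f -> U x ->
  'D_v f x = \sum_a v 0 a * 'D_(pbasis a) f x.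
Proof.
by move=> oU [h1 h2] Ux; exact: (@partials_derive f U x v oU Ux h1 (h2^~ x ^~ Ux)).
Qed.

Lemma C1_continuous U f x : open U -> C1 U f -> U x -> {for x, continuous f}.
Proof.
by move=> oU f1 Ux; apply: differentiable_continuous; exact: C1_differentiable f1 Ux.
Qed.

Definition hess f x v : R := \sum_a v 0 a * 'D_v ('D_(pbasis a) f) x.

Lemma hessE U f x v : open U -> C2 U f -> U x ->
  hess f x v =
  \sum_a \sum_b v 0 a * v 0 b * 'D_(pbasis b) ('D_(pbasis a) f) x.
Proof.
move=> oU [_ f2] Ux; apply: eq_bigr => a _.
rewrite (C1_derive v oU (f2 a) Ux) mulr_sumr.
by apply: eq_bigr => b _; rewrite mulrA.
Qed.

Lemma near_line U x v : open U -> U x -> \forall t \near (0 : R), U (x + t *: v).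
Proof.
move=> oU Ux.
have cl : (fun t : R => x + t *: v) t @[t --> (0 : R)] --> x + (0 : R) *: v.
  by apply: cvgD; [exact: cvg_cst|apply: cvgZr_tmp; exact: cvg_id].
rewrite scale0r addr0 in cl.
by apply: cl; exact: open_nbhs_nbhs.
Qed.

Lemma derive_quotient_near f x v (e : R) : derivable f x v -> 0 < e ->
  \forall t \near (0 : R), `|f (x + t *: v) - f x - t * 'D_v f x| <= e * `|t|.
Proof.
move=> df e0; move/cvgrPdist_le: (df) => /(_ _ e0).
rewrite near_withinE; apply: filterS => t /= h.
have [->|t0] := eqVneq t 0.
  by rewrite scale0r addr0 subrr mul0r subrr normr0 mulr0.
have {h} := h t0; rewrite -[lim _]/('D_v f x).
rewrite [t *: v + x]addrC => h.
have -> : f (x + t *: v) - f x - t * 'D_v f x =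
    - t * ('D_v f x - t^-1 *: (f (x + t *: v) - f x)).
  by rewrite /GRing.scale/=; field.
by rewrite normrM normrN mulrC ler_wpM2r.
Qed.

(** The mean value theorem expresses the error by its derivative at some [c < t]. That derivative
    compares the directional derivative [g] at [x + c *: v] and [x - c *: v], so a first-order
    expansion of [g] at [x] suffices. *)
Lemma second_difference_near U f x v (e : R) : open U -> C2 U f -> U x -> 0 < e ->
  \forall t \near 0^'+,
  `|f (x + t *: v) + f (x - t *: v) - 2 * f x - hess f x v * t ^+ 2| <= e * t ^+ 2.
Proof.
move=> oU [f1 f2] Ux e0.
pose g y := \sum_a v 0 a * 'D_(pbasis a) f y.
have dg : is_derive x v g (hess f x v).
  have : is_derive x v (\sum_(a < m) (v 0 a \*: 'D_(pbasis a) f)) (hess f x v).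
    apply: is_derive_sum => a; apply: is_deriveZ.
    by apply: derivableP; apply: diff_derivable; exact: C1_differentiable (f2 a) Ux.
  by congr is_derive; apply/funext => y; rewrite fct_sumE.
have e20 : 0 < e / 2 by rewrite divr_gt0.
have [dgx gE] := dg.
have := derive_quotient_near dgx e20; rewrite gE => gn.
have := near_line v oU Ux => /(filterI gn) {gn}.
move=> /nbhs_normP[d /= d0 Hd].
have Ht (t : R) : `|t| < d -> `|g (x + t *: v) - g x - t * hess f x v| <= e / 2 * `|t|
    /\ U (x + t *: v).
  by move=> td; apply: Hd; rewrite /= sub0r normrN.
near=> t.
have t0 : 0 < t by near: t; exact: nbhs_right_gt.
have td : t < d by near: t; exact: nbhs_right_lt.
pose S (s : R) := f (x + s *: v) + f (x + s *: (- v)) - 2 * f x - hess f x v * s ^+ 2.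
have DfE (y : 'rV[R]_m) : U y -> 'D_v f y = g y by move=> Uy; exact: (C1_derive v oU f1 Uy).
have dS (s : R) : `|s| < d ->
    is_derive s 1 S (g (x + s *: v) - g (x + (- s) *: v) - 2 * s * hess f x v).
  move=> sd; have [_ Us] := Ht _ sd.
  have [_ UNs] := Ht (- s) ltac:(by rewrite normrN).
  have d1 := @is_derive_line f x v s (C1_derivable oU f1 Us).
  rewrite (DfE _ Us) in d1.
  have UNs' : U (x + s *: - v) by rewrite scalerN -scaleNr.
  have d2 := @is_derive_line f x (- v) s (C1_derivable oU f1 UNs').
  have E2 : 'D_(- v) f (x + s *: - v) = - g (x + (- s) *: v).
    rewrite (C1_derive _ oU f1 UNs') scalerN -scaleNr -sumrN; apply: eq_bigr => a _.
    by rewrite mxE mulNr.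
  rewrite E2 in d2.
  have d3 : is_derive s 1 (fun s : R => hess f x v * s ^+ 2) (2 * s * hess f x v).
    have h := @is_deriveZ R R R _ (hess f x v) s 1 _ (@is_deriveX R R id 2 s 1 1 (is_derive_id _ _)).
    by apply: (is_derive_eq h); rewrite [_%:A]mulr1 expr1; exact: mulrC.
  have := is_deriveB (is_deriveB (is_deriveD d1 d2) (is_derive_cst (2 * f x) s 1)) d3.
  by rewrite subr0.
have [|||c cI E] := @MVT R S
  (fun s => g (x + s *: v) - g (x + (- s) *: v) - 2 * s * hess f x v) 0 t.
- exact: t0.
- move=> s; rewrite in_itv/= => /andP[s0 st]; apply: dS.
  by rewrite ger0_norm ?(lt_trans st)// ltW.
- apply: derivable_within_continuous => s; rewrite in_itv/= => /andP[s0 st].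
  by have [] := dS s; first by rewrite ger0_norm ?(le_lt_trans st).
have {cI}[c0 ct] : 0 < c /\ c < t by move: cI; rewrite in_itv/= => /andP.
have S0 : S 0 = 0 by rewrite /S !scale0r !addr0 expr0n/= mulr0 subr0; ring.
have -> : f (x + t *: v) + f (x - t *: v) - 2 * f x - hess f x v * t ^+ 2 = S t.
  by rewrite /S scalerN.
move: E; rewrite S0 !subr0 => ->.
rewrite normrM (gtr0_norm t0) expr2 mulrA ler_wpM2r ?(ltW t0)//.
have cd : `|c| < d by rewrite ger0_norm ?(lt_trans ct)// ltW.
have [h1 _] := Ht _ cd.
have [h2 _] := Ht (- c) ltac:(by rewrite normrN).
rewrite normrN in h2; rewrite (gtr0_norm c0) in h1 h2.
have -> : g (x + c *: v) - g (x + (- c) *: v) - 2 * c * hess f x v =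
  (g (x + c *: v) - g x - c * hess f x v) -
  (g (x + (- c) *: v) - g x - (- c) * hess f x v) by ring.
apply: (le_trans (ler_normB _ _)).
apply: (le_trans (lerD h1 h2)).
by rewrite -mulrDl -splitr ler_wpM2l ?(ltW e0) ?(ltW ct).
Unshelve. all: by end_near. Qed.

Lemma mixed_difference_near U f x (a b : 'I_m) (e : R) :
  open U -> C2 U f -> U x -> 0 < e ->
  \forall t \near 0^'+,
  `|f (x + t *: pbasis b + t *: pbasis a) - f (x + t *: pbasis a)
    - f (x + t *: pbasis b) + f x
    - t ^+ 2 * 'D_(pbasis b) ('D_(pbasis a) f) x| <= e * t ^+ 2.
Proof.
move=> oU [f1 f2] Ux e0.
have : \forall y \near x, U y /\
    `|'D_(pbasis b) ('D_(pbasis a) f) x - 'D_(pbasis b) ('D_(pbasis a) f) y| <= e.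
  near=> y; split; first by near: y; exact: open_nbhs_nbhs.
  near: y; have [_ cab] := f2 a.
  by have /cvgrPdist_le := cab b x Ux; exact.
move=> /nbhs_ballP[d /= d0 Hd].
have d20 : 0 < d / 2 by rewrite divr_gt0.
near=> t.
have t0 : 0 < t by near: t; exact: nbhs_right_gt.
have td : t < d / 2 by near: t; exact: nbhs_right_lt.
have B (s r : R) : 0 <= s <= t -> 0 <= r <= t ->
    ball x d (x + r *: pbasis b + s *: pbasis a).
  move=> /andP[s0 st] /andP[r0 rt].
  rewrite -ball_normE /= opprD addrA opprD addrA subrr sub0r -opprD normrN.
  apply: (@le_lt_trans _ _ (t + t)); last by rewrite [ltRHS](splitr d) ltrD.
  apply: norm_le_coord => [|c]; first by rewrite addr_ge0// ltW.
  rewrite !mxE eqxx /= (le_trans (ler_normD _ _))// lerD//.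
    rewrite normrM (ger0_norm r0); case: eqP => _; rewrite ?normr1 ?normr0 ?mulr1// mulr0.
    exact: ltW.
  rewrite normrM (ger0_norm s0); case: eqP => _; rewrite ?normr1 ?normr0 ?mulr1// mulr0.
  exact: ltW.
have t0t : 0 <= t <= t by rewrite lexx ltW.
have z0t : 0 <= (0 : R) <= t by rewrite lexx ltW.
pose G (s : R) := f (x + t *: pbasis b + s *: pbasis a) - f (x + s *: pbasis a).
have dG (s : R) : 0 <= s <= t -> is_derive s 1 G
    ('D_(pbasis a) f (x + t *: pbasis b + s *: pbasis a) -
     'D_(pbasis a) f (x + s *: pbasis a)).
  move=> st; apply: is_deriveB; apply: is_derive_line; apply: f1.1.
    by case: (Hd _ (B _ _ st t0t)).
  by have := Hd _ (B _ _ st z0t); rewrite scale0r addr0 => -[].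
have [||s sI E] := @MVT R G (fun s =>
    'D_(pbasis a) f (x + t *: pbasis b + s *: pbasis a) -
     'D_(pbasis a) f (x + s *: pbasis a)) 0 t t0.
- by move=> s; rewrite in_itv/= => /andP[s0 st]; apply: dG; rewrite !ltW.
- apply: derivable_within_continuous => s; rewrite in_itv/= => st.
  by case: (dG s st).
have {sI} st : 0 <= s <= t by move: sI; rewrite in_itv/= => /andP[? ?]; rewrite !ltW.
have B2 (r : R) : 0 <= r <= 1 -> ball x d (x + s *: pbasis a + (r * t) *: pbasis b).
  move=> /andP[r0 r1]; rewrite addrAC; apply: B => //.
  by rewrite mulr_ge0//= ?ler_piMl// ltW.
have [|r r01 E2] := @mean_value_line ('D_(pbasis a) f) (x + s *: pbasis a) (pbasis b) t.
  by move=> r r01; apply: (f2 a).1; case: (Hd _ (B2 _ r01)).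
have -> : f (x + t *: pbasis b + t *: pbasis a) - f (x + t *: pbasis a)
    - f (x + t *: pbasis b) + f x = G t - G 0.
  by rewrite /G !scale0r !addr0; ring.
rewrite E subr0 addrAC E2 mulrAC -expr2 -mulrBr normrM ger0_norm ?exprn_ge0 ?(ltW t0)//.
rewrite mulrC ler_wpM2r ?exprn_ge0 ?(ltW t0)// distrC.
by case: (Hd _ (B2 _ r01)).
Unshelve. all: by end_near. Qed.

(** The mixed difference of step [t] is symmetric in [a] and [b], and its quotient by [t ^+ 2] is
    close to either mixed derivative. *)
Lemma second_partials_commute U f x (a b : 'I_m) : open U -> C2 U f -> U x ->
  'D_(pbasis b) ('D_(pbasis a) f) x = 'D_(pbasis a) ('D_(pbasis b) f) x.
Proof.
move=> oU f2 Ux; apply/eqP; rewrite -subr_eq0 -normr_le0; apply/ler_addgt0Pr => e e0.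
rewrite add0r.
have e20 : 0 < e / 2 by rewrite divr_gt0.
have h1 := mixed_difference_near a b oU f2 Ux e20.
have h2 := mixed_difference_near b a oU f2 Ux e20.
have [t [[h3 h4] t0]] := @filter_ex _ (0 : R)^'+ _ _ (filterI (filterI h1 h2) (nbhs_right_gt (0 : R))).
rewrite (addrAC x) in h4.
set p := 'D_(pbasis b) _ x in h3 *; set q := 'D_(pbasis a) _ x in h4 *.
have t20 : 0 < t ^+ 2 by rewrite exprn_gt0.
rewrite -(ler_pM2r t20) -[X in _ * X <= _](gtr0_norm t20) -normrM.
move: h3 h4.
set A := f (_ + _ + _); set B := f _; set C := f _; set D := f _ => h3 h4.
have -> : (p - q) * t ^+ 2 =
  (A - C - B + D - t ^+ 2 * q) - (A - B - C + D - t ^+ 2 * p) by ring.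
by rewrite (le_trans (ler_normB _ _))// (le_trans (lerD h4 h3))// -mulrDl -splitr.
Qed.
End Calculus.

(** * Positive definite forms *)

Section QuadraticForms.
Context {R : realType} {m : nat}.
Implicit Types (P Q : 'M[R]_m) (u v w : 'rV[R]_m).

Definition bil Q u v : R := (u *m Q *m v^T) 0 0.

Definition psd Q := Q^T = Q /\ forall w, 0 <= bil Q w w.

Lemma bilE Q u v : bil Q u v = \sum_a \sum_b u 0 a * v 0 b * Q a b.
Proof.
rewrite /bil mxE exchange_big/=; apply: eq_bigr => b _.
rewrite !mxE mulr_suml; apply: eq_bigr => a _.
by rewrite mulrAC.
Qed.

Lemma bilDl Q u v w : bil Q (u + v) w = bil Q u w + bil Q v w.
Proof. by rewrite /bil !mulmxDl mxE. Qed.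

Lemma bilZl Q k u w : bil Q (k *: u) w = k * bil Q u w.
Proof. by rewrite /bil -!scalemxAl mxE. Qed.

Lemma bilC Q u v : Q^T = Q -> bil Q u v = bil Q v u.
Proof.
move=> QT; rewrite /bil -[in LHS](trmxK (u *m Q *m v^T)) mxE trmx_mul trmxK.
by rewrite trmx_mul QT mulmxA.
Qed.

Lemma bilDr Q u v w : bil Q w (u + v) = bil Q w u + bil Q w v.
Proof. by rewrite /bil linearD mulmxDr mxE. Qed.

Lemma bilZr Q k u w : bil Q w (k *: u) = k * bil Q w u.
Proof. by rewrite /bil linearZ -scalemxAr mxE. Qed.

Lemma bilN Q u : bil Q (- u) (- u) = bil Q u u.
Proof. by rewrite -scaleN1r bilZl bilZr !mulN1r opprK. Qed.

Lemma bilDM P Q u v : bil (P + Q) u v = bil P u v + bil Q u v.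
Proof. by rewrite /bil mulmxDr mulmxDl mxE. Qed.

Lemma bilZM k Q u v : bil (k *: Q) u v = k * bil Q u v.
Proof. by rewrite /bil -scalemxAr -scalemxAl mxE. Qed.

Lemma bilBM P Q u v : bil (P - Q) u v = bil P u v - bil Q u v.
Proof. by rewrite bilDM -scaleN1r bilZM mulN1r. Qed.

Lemma bil_delta Q a b : bil Q (pbasis a) (pbasis b) = Q a b.
Proof. by rewrite /bil trmx_delta -rowE -colE !mxE. Qed.

Lemma bil_deltal Q a v : bil Q (pbasis a) v = \sum_b Q a b * v 0 b.
Proof. by rewrite /bil -rowE mxE; apply: eq_bigr => b _; rewrite !mxE. Qed.

Lemma bil_outer w u v : bil (w^T *m w) u v = (u *m w^T) 0 0 * (v *m w^T) 0 0.
Proof.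
rewrite /bil mulmxA -mulmxA mxE big_ord1; congr (_ * _).
by rewrite -[in LHS](trmxK (w *m v^T)) mxE trmx_mul trmxK.
Qed.

Lemma bil_sqr_shift Q u v (t : R) : Q^T = Q ->
  bil Q (u + t *: v) (u + t *: v) = bil Q u u + 2 * t * bil Q u v + t ^+ 2 * bil Q v v.
Proof. by move=> QT; rewrite !(bilDl, bilDr, bilZl, bilZr) (bilC v u QT); ring. Qed.

(** Along [pbasis b + t *: pbasis a] the form is affine in [t] when [Q a a = 0]; a nonzero slope
    would let it reach [-1]. *)
Lemma psd_row_eq0 Q a b : psd Q -> Q a a = 0 -> Q a b = 0.
Proof.
move=> [QT Q0] Qaa.
have h t : 0 <= Q b b + 2 * t * Q b a.
  have := Q0 (pbasis b + t *: pbasis a).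
  by rewrite bil_sqr_shift// !bil_delta Qaa mulr0 addr0.
have -> : Q a b = Q b a by rewrite -{1}QT mxE.
apply/eqP; apply: contraT => Qba.
have := h (- (Q b b + 1) / (2 * Q b a)).
have -> : Q b b + 2 * (- (Q b b + 1) / (2 * Q b a)) * Q b a = -1 by field.
by rewrite ler0N1.
Qed.

Lemma psd_elim Q a : psd Q -> exists w, psd (Q - w^T *m w) /\
  (forall b, (Q - w^T *m w) a b = 0) /\
  (forall c, (forall b, Q c b = 0) -> forall b, (Q - w^T *m w) c b = 0).
Proof.
move=> pQ; have [QT Q0] := pQ.
have Qaa : 0 <= Q a a by rewrite -bil_delta.
have [Qaa0|Qaan0] := eqVneq (Q a a) 0.
  exists 0; rewrite mulmx0 subr0; split=> //; split=> // b; exact: psd_row_eq0.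
have {Qaa Qaan0} Qaa : 0 < Q a a by rewrite lt_neqAle eq_sym Qaan0.
have s0 : Num.sqrt (Q a a) != 0 by rewrite sqrtr_eq0 -ltNge.
have ss : Num.sqrt (Q a a) ^+ 2 = Q a a by rewrite sqr_sqrtr// ltW.
pose w : 'rV[R]_m := (Num.sqrt (Q a a))^-1 *: row a Q.
have wE b c : (w^T *m w) b c = Q a b * Q a c / Q a a.
  rewrite mxE big_ord1 !mxE; move: s0 ss; set s := Num.sqrt _ => s0 ss.
  by rewrite -[in RHS]ss; field.
have symQ b c : Q b c = Q c b by rewrite -{1}QT mxE.
exists w; split; [split|split].
- by apply/matrixP => b c; rewrite linearB/= trmx_mul trmxK QT.
- move=> v; pose r := (v *m w^T) 0 0.
  have rE : bil Q v (pbasis a) = Num.sqrt (Q a a) * r.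
    rewrite bilC// bil_deltal /r mxE mulr_sumr; apply: eq_bigr => b _.
    have -> : w^T b 0 = (Num.sqrt (Q a a))^-1 * Q a b by rewrite !mxE.
    by move: s0; set s := Num.sqrt _ => s0; field.
  have := Q0 (v + (- r / Num.sqrt (Q a a)) *: pbasis a).
  rewrite bil_sqr_shift// bil_delta bilBM bil_outer -/r rE.
  move: s0 ss; set s := Num.sqrt _ => s0 ss; rewrite -[Q a a]ss.
  suff -> : bil Q v v + 2 * (- r / s) * (s * r) + (- r / s) ^+ 2 * s ^+ 2 =
    bil Q v v - r * r by [].
  by field.
- move=> b; rewrite !(mxE, wE) [X in _ - X](_ : _ = Q a b) ?subrr//.
  by have := wE a b; rewrite !mxE => ->; field; rewrite gt_eqF.
- move=> c Qc b; have := wE c b; rewrite !mxE => ->.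
  by rewrite (symQ a c) !Qc !mul0r subrr.
Qed.

(** Replaces the spectral theorem: a trace against [Q] becomes a sum of values of a quadratic form
    at the rows of [W]. *)
Lemma psd_factor Q : psd Q -> exists W : 'M[R]_m, Q = W^T *m W.
Proof.
move=> pQ.
have H (k : nat) : (k <= m)%N -> exists w : 'I_m -> 'rV[R]_m,
  let Q' := Q - \sum_(i < m | (i < k)%N) (w i)^T *m w i in
  psd Q' /\ forall a b : 'I_m, (a < k)%N -> Q' a b = 0.
  elim: k => [_|k IH km].
    exists (fun=> 0); rewrite /= big_pred0// subr0; split=> //.
  have [w [pQ' Q'0]] := IH (ltnW km).
  have [v [pv [va vb]]] := psd_elim (Ordinal km) pQ'.
  exists (fun i => if i == Ordinal km then v else w i) => /=.
  have -> : \sum_(i < m | (i < k.+1)%N)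
      (if i == Ordinal km then v else w i)^T *m (if i == Ordinal km then v else w i)
    = v^T *m v + \sum_(i < m | (i < k)%N) (w i)^T *m w i.
    rewrite (bigD1 (Ordinal km))//= eqxx; congr (_ + _).
    apply: eq_big => [i|i /andP[_ /negPf ->]//].
    by rewrite ltnS -(inj_eq val_inj)/= [RHS]ltn_neqAle andbC.
  rewrite opprD addrA addrAC; split=> // a b.
  rewrite ltnS leq_eqVlt => /predU1P[ak|ak]; last by apply: vb => c; exact: Q'0.
  by have -> : a = Ordinal km by exact: val_inj.
have [w [_ h]] := H m (leqnn m).
exists (\matrix_i w i); apply/matrixP => a b.
have /eqP := h a b (ltn_ord a); rewrite mxE [X in _ + X]mxE subr_eq0 => /eqP ->; rewrite summxE mxE.
by apply: eq_big => [i|i _]; rewrite ?ltn_ord// !mxE big_ord1 !mxE.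
Qed.

Lemma psd_det_ge0 Q : psd Q -> 0 <= \det Q.
Proof. by move=> /psd_factor[W ->]; rewrite det_mulmx det_tr -expr2 sqr_ge0. Qed.

Definition pdef Q := Q^T = Q /\ forall w, w != 0 -> 0 < bil Q w w.

Lemma pdef_psd Q : pdef Q -> psd Q.
Proof.
move=> [QT Q0]; split=> // w; have [->|/Q0/ltW//] := eqVneq w 0.
by rewrite /bil !mul0mx mxE.
Qed.

Lemma pdef_det_gt0 Q : pdef Q -> 0 < \det Q.
Proof.
move=> pQ; rewrite lt_neqAle psd_det_ge0 ?andbT; last exact: pdef_psd.
rewrite eq_sym; apply/negP => /det0P[v v0 vQ].
by have := pQ.2 _ v0; rewrite /bil vQ mul0mx mxE ltxx.
Qed.

Lemma pdef_unit Q : pdef Q -> Q \in unitmx.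
Proof. by move=> pQ; rewrite unitmxE unitfE gt_eqF// pdef_det_gt0. Qed.

Lemma bil_invmx Q w : pdef Q ->
  bil (invmx Q) w w = bil Q (w *m invmx Q) (w *m invmx Q).
Proof.
move=> pQ; have uQ := pdef_unit pQ.
by rewrite /bil mulmxKV// trmx_mul trmx_inv pQ.1 mulmxA.
Qed.

Lemma pdef_inv Q : pdef Q -> pdef (invmx Q).
Proof.
move=> pQ; have uQ := pdef_unit pQ; split; first by rewrite trmx_inv pQ.1.
move=> w w0; rewrite bil_invmx//; apply: pQ.2.
by apply: contra_neq w0 => h; rewrite -(mulmxKV uQ w) h mul0mx.
Qed.

(** Cauchy-Schwarz, read off from [invmx Q] at [v - r *: (w *m Q)]. It splits a single unit
    direction off the inverse metric and leaves a nonnegative rest, as [trace_estimate] needs. *)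
Lemma pdef_inv_sub_outer Q w : pdef Q -> bil Q w w = 1 -> psd (invmx Q - w^T *m w).
Proof.
move=> pQ w1; have uQ := pdef_unit pQ; have [iT i0] := pdef_psd (pdef_inv pQ).
split; first by rewrite linearB/= iT trmx_mul trmxK.
move=> v; pose r := (v *m w^T) 0 0.
have := i0 (v + (- r) *: (w *m Q)).
have E1 : bil (invmx Q) v (w *m Q) = r.
  by rewrite /bil trmx_mul pQ.1 mulmxA mulmxKV.
have E2 : bil (invmx Q) (w *m Q) (w *m Q) = 1.
  by rewrite bil_invmx// mulmxK.
rewrite bil_sqr_shift// E1 E2 bilBM bil_outer -/r.
suff -> : bil (invmx Q) v v + 2 * - r * r + (- r) ^+ 2 * 1 = bil (invmx Q) v v - r * r by [].
by ring.
Qed.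

End QuadraticForms.

Section QuadraticBounds.
Context {R : realType} {m : nat}.
Implicit Types (P Q : 'M[R]_m) (u v w z : 'rV[R]_m).

Lemma bil_bound Q u v (c : R) : (forall a b, `|Q a b| <= c) ->
  `|bil Q u v| <= m%:R ^+ 2 * c * (`|u| * `|v|).
Proof.
move=> Qc; rewrite bilE.
apply: (le_trans (ler_norm_sum _ _ _)).
have -> : m%:R ^+ 2 * c * (`|u| * `|v|) = \sum_(a < m) \sum_(b < m) c * (`|u| * `|v|).
  by rewrite sumr_const card_ord sumr_const card_ord -mulrnA -[RHS]mulr_natl natrM; ring.
apply: ler_sum => a _; apply: (le_trans (ler_norm_sum _ _ _)); apply: ler_sum => b _.
by rewrite normrM mulrC ler_pM// normrM ler_pM// coord_le_norm.
Qed.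

Lemma bil1E u v : bil 1%:M u v = \sum_a u 0 a * v 0 a.
Proof. by rewrite /bil mulmx1 mxE; apply: eq_bigr => a _; rewrite !mxE. Qed.

Lemma bil1_ge u : `|u| ^+ 2 <= bil 1%:M u u.
Proof.
rewrite bil1E; have s0 : 0 <= \sum_a u 0 a * u 0 a.
  by apply: sumr_ge0 => a _; rewrite -expr2 sqr_ge0.
rewrite -(@ler_sqrt R)// sqrtr_sqr normr_id; apply: norm_le_coord => [|a].
  exact: sqrtr_ge0.
rewrite -sqrtr_sqr ler_sqrt// (bigD1 a)//= -expr2 lerDl.
by apply: sumr_ge0 => b _; rewrite -expr2 sqr_ge0.
Qed.

Lemma bil1_le u v : `|bil 1%:M u v| <= m%:R * (`|u| * `|v|).
Proof.
rewrite bil1E; apply: (le_trans (ler_norm_sum _ _ _)).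
have -> : m%:R * (`|u| * `|v|) = \sum_(a < m) (`|u| * `|v|).
  by rewrite sumr_const card_ord -[RHS]mulr_natl.
by apply: ler_sum => a _; rewrite normrM ler_pM// coord_le_norm.
Qed.

Lemma bil1_ge0 u : 0 <= bil 1%:M u u.
Proof. by apply: le_trans (bil1_ge u); exact: sqr_ge0. Qed.

Lemma continuous_bil Q (T : topologicalType) (f g : T -> 'rV[R]_m) (x : T) :
  {for x, continuous f} -> {for x, continuous g} ->
  {for x, continuous (fun y => bil Q (f y) (g y))}.
Proof.
move=> cf cg; rewrite /prop_for/continuous_at bilE.
have -> : (fun y => bil Q (f y) (g y)) =
  (fun y => \sum_a \sum_b f y 0 a * g y 0 b * Q a b) by apply/funext => y; rewrite bilE.
apply: (@cvg_bigsum _ _ _ (nbhs x)) => a _; apply: (@cvg_bigsum _ _ _ (nbhs x)) => b _.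
apply: cvgM; last exact: cvg_cst.
apply: cvgM; [move: cf|move: cg] => c.
  by apply: (@cvg_comp _ _ _ f (fun M : 'rV[R]_m => M 0 a) _ (nbhs (f x)) _ c);
    exact: coord_continuous.
by apply: (@cvg_comp _ _ _ g (fun M : 'rV[R]_m => M 0 b) _ (nbhs (g x)) _ c);
    exact: coord_continuous.
Qed.

Lemma pdef_lower Q : pdef Q ->
  exists2 c : R, 0 < c & forall w, c * `|w| ^+ 2 <= bil Q w w.
Proof.
move=> [QT Q0].
pose S := [set w : 'rV[R]_m | `|w| = 1].
have cS : compact S.
  apply: bounded_closed_compact.
    by exists 1; split=> // y y1 w /= ->; exact: ltW.
  have -> : S = (@Num.norm R 'rV[R]_m) @^-1` [set 1] by [].
  apply: preimage_closed; last exact: closed_eq.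
  by move=> w _; exact: norm_continuous.
have cb : {within S, continuous (fun w => bil Q w w)}.
  by apply: continuous_subspaceT => w; apply: continuous_bil; exact: cvg_id.
have sc w : w != 0 -> S (`|w|^-1 *: w).
  by move=> w0; rewrite /S/= normrZ normrV ?unitfE ?normr_eq0// normr_id mulVf ?normr_eq0.
(* The unit sphere is empty only if every [w] vanishes, as for [m = 0]; then any [c] works. *)
have [[w0 Sw0]|S0] := pselect (S !=set0); last first.
  exists 1 => // w; have [->|w0] := eqVneq w 0.
    by rewrite normr0 expr0n mulr0 /bil !mul0mx mxE.
  by exfalso; apply: S0; eexists; exact: sc w0.
have [|c cSS cmin] := @EVT_min_rV R m (fun w => bil Q w w) S _ cS cb; first by exists w0.
have c0 : c != 0.
  by apply/eqP => c0; move: cSS; rewrite inE /S/= c0 normr0 => /esym/eqP; rewrite oner_eq0.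
exists (bil Q c c); first exact: Q0.
move=> w; have [->|wn0] := eqVneq w 0.
  by rewrite normr0 expr0n mulr0 /bil !mul0mx mxE.
have := cmin _ (mem_set (sc _ wn0)); rewrite bilZl bilZr mulrA -expr2 exprVn.
by rewrite ler_pdivlMl ?exprn_gt0 ?normr_gt0// mulrC.
Qed.

End QuadraticBounds.

(** * Closure properties of continuously differentiable functions and matrices *)

Section C1Algebra.
Context {R : realType} {m : nat} (U : set 'rV[R]_m) (oU : open U).
Implicit Types (f g : 'rV[R]_m -> R) (x v : 'rV[R]_m).

Lemma near_open (P : 'rV[R]_m -> Prop) x : U x -> (forall y, U y -> P y) ->
  \forall y \near x, P y.
Proof. by move=> Ux h; apply: filterS (open_nbhs_nbhs (conj oU Ux)) => y; exact: h. Qed.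

Lemma near_eq_continuous f g x : (\forall y \near x, g y = f y) ->
  {for x, continuous f} -> {for x, continuous g}.
Proof.
move=> h cf; rewrite /prop_for /continuous_at (nbhs_singleton h).
have h' : {near nbhs x, f =1 g} by apply: (filterS _ h) => y ->.
exact: (cvg_trans (near_eq_cvg h') cf).
Qed.

Lemma C1_of_derive f (df : 'I_m -> 'rV[R]_m -> R) :
  (forall a y, U y -> is_derive y (pbasis a) f (df a y)) ->
  (forall a y, U y -> {for y, continuous (df a)}) -> C1 U f.
Proof.
move=> h1 h2; split=> a y Uy; first by case: (h1 a y Uy).
apply: near_eq_continuous (h2 a y Uy).
by apply: near_open => // z /(h1 a) [].
Qed.

Lemma C1_is_derive f a y : C1 U f -> U y ->
  is_derive y (pbasis a) f ('D_(pbasis a) f y).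
Proof. by move=> f1 Uy; apply: derivableP; exact: f1.1. Qed.

Lemma C1_ext f g : (forall y, U y -> g y = f y) -> C1 U f -> C1 U g.
Proof.
move=> fg f1; apply: (C1_of_derive (df := fun a => 'D_(pbasis a) f)) => a y Uy.
  apply: (near_eq_is_derive _ (C1_is_derive a f1 Uy)).
  by apply: near_open => // z Uz; rewrite fg.
exact: f1.2.
Qed.

Lemma C1_cst (k : R) : C1 U (cst k).
Proof.
by apply: (C1_of_derive (df := fun _ => cst 0)) => a y _; exact: cst_continuous.
Qed.

Lemma C1D f g : C1 U f -> C1 U g -> C1 U (fun y => f y + g y).
Proof.
move=> f1 g1.
apply: (C1_of_derive (df := fun a y => 'D_(pbasis a) f y + 'D_(pbasis a) g y)) => a y Uy.
  by apply: is_deriveD; exact: C1_is_derive.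
exact: (@continuousD _ _ _ ('D_(pbasis a) f) ('D_(pbasis a) g) y (f1.2 a y Uy) (g1.2 a y Uy)).
Qed.

Lemma C1M f g : C1 U f -> C1 U g -> C1 U (fun y => f y * g y).
Proof.
move=> f1 g1.
apply: (C1_of_derive
  (df := fun a y => f y * 'D_(pbasis a) g y + g y * 'D_(pbasis a) f y)) => a y Uy.
  by apply: is_deriveM; exact: C1_is_derive.
have cf := C1_continuous oU f1 Uy; have cg := C1_continuous oU g1 Uy.
exact: (@continuousD _ _ _ (fun y => f y * 'D_(pbasis a) g y)
  (fun y => g y * 'D_(pbasis a) f y) y
  (continuousM cf (g1.2 a y Uy)) (continuousM cg (f1.2 a y Uy))).
Qed.

Lemma C1_sum (I : Type) (r : seq I) (P : pred I) (F : I -> 'rV[R]_m -> R) :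
  (forall i, P i -> C1 U (F i)) -> C1 U (fun y => \sum_(i <- r | P i) F i y).
Proof.
move=> F1; elim: r => [|i r IH].
  by apply: C1_ext (C1_cst 0) => y _; rewrite big_nil.
have [Pi|Pi] := boolP (P i).
  by apply: C1_ext (C1D (F1 i Pi) IH) => y _; rewrite big_cons Pi.
by apply: C1_ext IH => y _; rewrite big_cons (negbTE Pi).
Qed.

Lemma C1_prod (I : Type) (r : seq I) (P : pred I) (F : I -> 'rV[R]_m -> R) :
  (forall i, P i -> C1 U (F i)) -> C1 U (fun y => \prod_(i <- r | P i) F i y).
Proof.
move=> F1; elim: r => [|i r IH].
  by apply: C1_ext (C1_cst 1) => y _; rewrite big_nil.
have [Pi|Pi] := boolP (P i).
  by apply: C1_ext (C1M (F1 i Pi) IH) => y _; rewrite big_cons Pi.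
by apply: C1_ext IH => y _; rewrite big_cons (negbTE Pi).
Qed.

Lemma is_derive_comp1 (p : R -> R) (dp df : R) f x v :
  is_derive (f x) 1 p dp -> is_derive x v f df ->
  is_derive x v (fun y => p (f y)) (dp * df).
Proof.
move=> hp [df1 df2].
have x0E : x + 0 *: v = x by rewrite scale0r addr0.
have l : is_derive (0 : R) 1 (fun s : R => f (x + s *: v)) df.
  by have := @is_derive_line _ _ f x v 0; rewrite x0E df2; apply.
have hp' : is_derive (f (x + 0 *: v)) 1 p dp by rewrite x0E.
have [d e] := @is_derive1_comp _ p _ 0 _ _ hp' l.
have E : (fun h : R => h^-1 *: ((p \o (fun s : R => f (x + s *: v))) (h *: 1 + 0) -
    (p \o (fun s : R => f (x + s *: v))) 0)) =
  (fun h => h^-1 *: (p (f (h *: v + x)) - p (f x))).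
  apply/funext => s /=; rewrite addr0 [_%:A]mulr1 x0E.
  by rewrite [x + _]addrC.
by apply: DeriveDef; rewrite ?/derivable ?/derive -E.
Qed.

Lemma C1_comp1 (p dp : R -> R) f :
  (forall y, U y -> is_derive (f y) 1 p (dp (f y))) ->
  (forall y, U y -> {for f y, continuous dp}) ->
  C1 U f -> C1 U (fun y => p (f y)).
Proof.
move=> hp hdp f1.
apply: (C1_of_derive (df := fun a y => dp (f y) * 'D_(pbasis a) f y)) => a y Uy.
  exact: is_derive_comp1 (hp y Uy) (C1_is_derive a f1 Uy).
have cf := C1_continuous oU f1 Uy.
exact: (continuousM (continuous_comp cf (hdp _ Uy)) (f1.2 a y Uy)).
Qed.

Lemma C1V f : (forall y, U y -> f y != 0) -> C1 U f -> C1 U (fun y => (f y)^-1).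
Proof.
move=> f0; apply: (@C1_comp1 _ (fun r : R => - r ^- 2)) => y Uy.
  have h := @is_deriveV R (@id R) (f y) 1 1 (f0 y Uy) (is_derive_id _ _).
  by apply: (is_derive_eq h); rewrite /= [LHS]mulr1.
apply: cvgN; apply: cvgV; first by rewrite expf_neq0// f0.
exact: exprn_continuous.
Qed.

Lemma C1_sqrt f : (forall y, U y -> 0 < f y) -> C1 U f ->
  C1 U (fun y => Num.sqrt (f y)).
Proof.
move=> f0; apply: (@C1_comp1 _ (fun r : R => (2 * Num.sqrt r)^-1)) => y Uy.
  exact: (is_derive1_sqrt (f0 y Uy)).
apply: cvgV; first by rewrite mulf_neq0// gt_eqF// sqrtr_gt0 f0.
by apply: cvgM; [exact: cvg_cst|exact: sqrt_continuous].
Qed.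

Lemma C1_det n (M : 'rV[R]_m -> 'M[R]_n) :
  (forall i j, C1 U (fun y => M y i j)) -> C1 U (fun y => \det (M y)).
Proof.
move=> h; rewrite /determinant; apply: C1_sum => s _; apply: C1M; first exact: C1_cst.
exact: C1_prod.
Qed.

Lemma C1_adj n (M : 'rV[R]_m -> 'M[R]_n) i j :
  (forall i j, C1 U (fun y => M y i j)) -> C1 U (fun y => (\adj (M y)) i j).
Proof.
move=> h; have : C1 U (fun y => (-1) ^+ (j + i) * \det (row' j (col' i (M y)))).
  apply: C1M; first exact: C1_cst.
  apply: C1_det => a b.
  by apply: C1_ext (h (lift j a) (lift i b)) => y _; rewrite !mxE.
by apply: C1_ext => y _; rewrite mxE.
Qed.

Lemma C1_invmx n (M : 'rV[R]_m -> 'M[R]_n) i j :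
  (forall y, U y -> M y \in unitmx) ->
  (forall i j, C1 U (fun y => M y i j)) -> C1 U (fun y => invmx (M y) i j).
Proof.
move=> uM h; have : C1 U (fun y => (\det (M y))^-1 * (\adj (M y)) i j).
  apply: C1M; last exact: C1_adj.
  apply: C1V; last exact: C1_det.
  by move=> y Uy; rewrite -unitfE -unitmxE uM.
by apply: C1_ext => y Uy; rewrite /invmx uM// mxE.
Qed.

End C1Algebra.

(** * The Laplacian in coordinates *)

Section Jacobi.
Context {R : realType} {m : nat}.
Implicit Types (x v : 'rV[R]_m).

Lemma is_derive_bigsum (I : Type) (r : seq I) (P : pred I) (F : I -> 'rV[R]_m -> R)
    (dF : I -> R) x v : (forall i, P i -> is_derive x v (F i) (dF i)) ->
  is_derive x v (fun y => \sum_(i <- r | P i) F i y) (\sum_(i <- r | P i) dF i).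
Proof.
move=> h; elim: r => [|i r IH].
  rewrite big_nil; have -> : (fun y => \sum_(i <- [::] | P i) F i y) = cst 0.
    by apply/funext => y; rewrite big_nil.
  exact: is_derive_cst.
rewrite big_cons; have [Pi|Pi] := boolP (P i).
  have -> : (fun y => \sum_(i <- i :: r | P i) F i y) =
      F i + (fun y => \sum_(i <- r | P i) F i y).
    by apply/funext => y; rewrite big_cons Pi.
  exact: is_deriveD (h i Pi) IH.
have -> // : (fun y => \sum_(i <- i :: r | P i) F i y) =
    (fun y => \sum_(i <- r | P i) F i y).
by apply/funext => y; rewrite big_cons (negbTE Pi).
Qed.

Lemma is_derive_prod_seq (I : eqType) (r : seq I) (F : I -> 'rV[R]_m -> R)
    (dF : I -> R) x v : uniq r -> (forall i, is_derive x v (F i) (dF i)) ->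
  is_derive x v (fun y => \prod_(i <- r) F i y)
    (\sum_(i <- r) dF i * \prod_(j <- r | j != i) F j x).
Proof.
move=> + h; elim: r => [_|i r IH /= /andP[ir ur]].
  rewrite big_nil; have -> : (fun y => \prod_(i <- [::]) F i y) = cst 1.
    by apply/funext => y; rewrite big_nil.
  exact: is_derive_cst.
have -> : (fun y => \prod_(i <- i :: r) F i y) = F i * (fun y => \prod_(i <- r) F i y).
  by apply/funext => y; rewrite big_cons.
apply: (is_derive_eq (is_deriveM (h i) (IH ur))).
rewrite big_cons big_cons eqxx /= addrC /GRing.scale/= mulrC; congr (_ + _).
  congr (_ * _); rewrite big_seq [RHS]big_seq_cond; apply: eq_bigl => j.
  by have [jr|//] := boolP (j \in r); apply/esym; apply: contraNneq ir => <-.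
rewrite mulr_sumr; apply: eq_big_seq => j jr.
have ij : i != j by apply: contraNneq ir => ->.
by rewrite big_cons ij mulrCA.
Qed.

(** Jacobi's formula. In the Leibniz expansion, the terms that differentiate row [i] form the
    determinant with this row replaced by its derivative; Laplace expansion along the row produces
    the cofactors. *)
Lemma is_derive_det n (M : 'rV[R]_m -> 'M[R]_n) (dM : 'M[R]_n) x v :
  (forall i j, is_derive x v (fun y => M y i j) (dM i j)) ->
  is_derive x v (fun y => \det (M y)) (\sum_i \sum_j dM i j * cofactor (M x) i j).
Proof.
move=> h.
have -> : \sum_i \sum_j dM i j * cofactor (M x) i j =
    \sum_(s : 'S_n) (-1) ^+ s * \sum_i (dM i (s i) * \prod_(j | j != i) M x j (s j)).
  under [RHS]eq_bigr do rewrite mulr_sumr.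
  rewrite [RHS]exchange_big/=; apply: eq_bigr => i _.
  pose M' := \matrix_(k, j) (if k == i then dM k j else M x k j).
  have -> : \sum_j dM i j * cofactor (M x) i j = \det M'.
    rewrite (expand_det_row M' i); apply: eq_bigr => j _.
    rewrite mxE eqxx; congr (_ * _); rewrite /cofactor; congr (_ * \det _).
    by apply/matrixP => a b; rewrite !mxE eq_sym (negbTE (neq_lift _ _)).
  rewrite /determinant; apply: eq_bigr => s _; congr (_ * _).
  rewrite (bigD1 i)//= mxE eqxx; congr (_ * _).
  by apply: eq_bigr => j /negbTE ji; rewrite mxE ji.
rewrite /determinant; apply: is_derive_bigsum => s _.
have := @is_derive_prod_seq _ (index_enum 'I_n) (fun i y => M y i (s i))
  (fun i => dM i (s i)) x v (index_enum_uniq _) (fun i => h i (s i)).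
move=> /(@is_deriveZ _ _ _ _ ((-1) ^+ s)) D.
exact: (is_derive_eq D).
Qed.

Lemma differentiable_row n (phi : 'rV[R]_m -> 'rV[R]_n) x :
  (forall c, differentiable (fun y => phi y 0 c) x) -> differentiable phi x.
Proof.
move=> h.
have -> : phi = \sum_(c < n) (fun y => phi y 0 c *: pbasis c).
  apply/funext => y; rewrite fct_sumE; exact: row_sum_delta.
by apply: differentiable_sum => c; exact: differentiableZl.
Qed.

Lemma derive_row n (phi : 'rV[R]_m -> 'rV[R]_n) x v c : differentiable phi x ->
  ('D_v phi x) 0 c = 'D_v (fun y => phi y 0 c) x.
Proof. by move=> d; rewrite derive_mx ?mxE//; exact: diff_derivable. Qed.

Lemma derive_chain n (W : set 'rV[R]_n) (f : 'rV[R]_n -> R)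
    (phi : 'rV[R]_m -> 'rV[R]_n) x v : open W -> C1 W f -> W (phi x) ->
  differentiable phi x ->
  is_derive x v (fun y => f (phi y))
    (\sum_c 'D_v (fun y => phi y 0 c) x * 'D_(pbasis c) f (phi x)).
Proof.
move=> oW f1 Wx dphi.
have df := C1_differentiable oW f1 Wx.
have dc : differentiable (f \o phi) x by exact: differentiable_comp.
apply: DeriveDef; first exact: (@diff_derivable _ _ _ (f \o phi)).
rewrite (@deriveE _ _ _ (f \o phi))// diff_comp//= -(deriveE v dphi).
rewrite -(deriveE _ df) (C1_derive _ oW f1 Wx).
by apply: eq_bigr => c _; rewrite derive_row.
Qed.

End Jacobi.

Lemma is_derive_val (R : numFieldType) (V W : normedModType R) (f : V -> W)
    (x v : V) (df : W) : is_derive x v f df -> 'D_v f x = df.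
Proof. by case. Qed.

Section CoordinateLaplacian.
Context {R : realType} {m : nat}.
Implicit Types (G : 'rV[R]_m -> 'M[R]_m) (w : 'rV[R]_m -> R) (x y : 'rV[R]_m)
  (U : set 'rV[R]_m).

Definition vol_dens G y : R := Num.sqrt (\det (G y)).

(** The expression of [laplacian_coord] for an arbitrary matrix field [G], so that the coordinate
    estimates need no atlas. *)
Definition lap_coord G w y : R :=
  (vol_dens G y)^-1 *
  \sum_(a < m) 'D_(pbasis a) (fun z => vol_dens G z *
    \sum_(b < m) invmx (G z) a b * 'D_(pbasis b) w z) y.

(** The first-order coefficient of the Laplacian; in terms of Christoffel symbols,
    $-g^{cd}\Gamma^b_{cd}$. *)
Definition drift G (b : 'I_m) y : R :=
  (vol_dens G y)^-1 *
  \sum_(a < m) 'D_(pbasis a) (fun z => vol_dens G z * invmx (G z) a b) y.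

Definition C1_metric U G := (forall y, U y -> pdef (G y)) /\
  forall a b, C1 U (fun y => G y a b).

Lemma vol_dens_gt0 U G y : C1_metric U G -> U y -> 0 < vol_dens G y.
Proof. by move=> [pG _] Uy; rewrite sqrtr_gt0 pdef_det_gt0//; exact: pG. Qed.

Lemma C1_vol_dens U G : open U -> C1_metric U G -> C1 U (vol_dens G).
Proof.
move=> oU [pG cG]; apply: C1_sqrt => //; last exact: C1_det.
by move=> y Uy; rewrite pdef_det_gt0//; exact: pG.
Qed.

Lemma C1_inv_metric U G a b : open U -> C1_metric U G ->
  C1 U (fun y => invmx (G y) a b).
Proof. by move=> oU [pG cG]; apply: C1_invmx => // y Uy; rewrite pdef_unit//; exact: pG. Qed.

Lemma C1_densitized_inv U G a b : open U -> C1_metric U G ->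
  C1 U (fun y => vol_dens G y * invmx (G y) a b).
Proof. by move=> oU cG; apply: C1M => //; [exact: C1_vol_dens|exact: C1_inv_metric]. Qed.

Lemma drift_continuous U G b x : open U -> C1_metric U G -> U x ->
  {for x, continuous (drift G b)}.
Proof.
move=> oU cG Ux; apply: continuousM.
  apply: continuousV; first by rewrite gt_eqF// (vol_dens_gt0 cG).
  exact: C1_continuous (C1_vol_dens oU cG) Ux.
apply: (@cvg_bigsum _ _ _ (nbhs x)) => a _.
exact: ((C1_densitized_inv a b oU cG).2 a x Ux).
Qed.

(** Nondivergence form: maximum principles treat the Hessian and the gradient separately. *)
Lemma lap_coordE U G w x : open U -> C1_metric U G -> C2 U w -> U x ->
  lap_coord G w x =
  \sum_a \sum_b invmx (G x) a b * 'D_(pbasis a) ('D_(pbasis b) w) x +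
  \sum_b drift G b x * 'D_(pbasis b) w x.
Proof.
move=> oU cG [_ w2] Ux; have v0 := vol_dens_gt0 cG Ux.
have D a : 'D_(pbasis a) (fun z => vol_dens G z *
    \sum_(b < m) invmx (G z) a b * 'D_(pbasis b) w z) x =
  \sum_b (vol_dens G x * invmx (G x) a b * 'D_(pbasis a) ('D_(pbasis b) w) x +
    'D_(pbasis b) w x * 'D_(pbasis a) (fun z => vol_dens G z * invmx (G z) a b) x).
  have -> : (fun z => vol_dens G z * \sum_(b < m) invmx (G z) a b * 'D_(pbasis b) w z) =
    (fun z => \sum_(b < m) (vol_dens G z * invmx (G z) a b) * 'D_(pbasis b) w z).
    apply/funext => z; rewrite mulr_sumr; apply: eq_bigr => b _; exact: mulrA.
  apply: is_derive_val; apply: is_derive_bigsum => b _.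
  apply: is_deriveM; first exact: C1_is_derive (C1_densitized_inv a b oU cG) Ux.
  exact: C1_is_derive (w2 b) Ux.
rewrite /lap_coord; under eq_bigr do rewrite D big_split/=.
rewrite big_split/= mulrDr; congr (_ + _).
  rewrite mulr_sumr; apply: eq_bigr => a _; rewrite mulr_sumr; apply: eq_bigr => b _.
  by rewrite mulrA mulrA mulVf ?mul1r// gt_eqF.
rewrite exchange_big mulr_sumr; apply: eq_bigr => b _.
by rewrite -mulr_sumr mulrCA mulrC.
Qed.

(* [\adj] of a Jacobian matrix has divergence-free rows (Piola's identity):
   differentiate [J *m \adj J = (\det J)%:M] and compare with Jacobi's formula. *)
Lemma piola U (phi : 'I_m -> 'rV[R]_m -> R) x (c : 'I_m) : open U ->
  (forall c, C2 U (phi c)) -> U x ->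
  let J y := \matrix_(a < m, d < m) 'D_(pbasis a) (phi d) y in
  J x \in unitmx ->
  \sum_a 'D_(pbasis a) (fun y => (\adj (J y)) c a) x = 0.
Proof.
move=> oU phi2 Ux J uJ.
have JC1 a d : C1 U (fun y => J y a d).
  by apply: C1_ext ((phi2 d).2 a) => // y _; rewrite mxE.
have aC1 d a : C1 U (fun y => (\adj (J y)) d a) by exact: C1_adj.
pose P : 'cV[R]_m := \col_d \sum_a 'D_(pbasis a) (fun y => (\adj (J y)) d a) x.
suff JP : J x *m P = 0.
  have /matrixP/(_ c 0) : P = 0 by rewrite -(mulKmx uJ P) JP mulmx0.
  by rewrite !mxE.
apply/matrixP => b j; rewrite (ord1 j) !mxE => {j}.
have E1 a : \sum_d (J x b d * 'D_(pbasis a) (fun y => (\adj (J y)) d a) x +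
     (\adj (J x)) d a * 'D_(pbasis a) (fun y => J y b d) x) =
   (b == a)%:R * 'D_(pbasis a) (fun y => \det (J y)) x.
  have d1 : is_derive x (pbasis a) (fun y => \sum_d J y b d * (\adj (J y)) d a)
    (\sum_d (J x b d * 'D_(pbasis a) (fun y => (\adj (J y)) d a) x +
     (\adj (J x)) d a * 'D_(pbasis a) (fun y => J y b d) x)).
    apply: is_derive_bigsum => d _.
    by apply: is_deriveM; [exact: C1_is_derive (JC1 b d) Ux|exact: C1_is_derive (aC1 d a) Ux].
  have d2 : is_derive x (pbasis a) (fun y => (b == a)%:R * \det (J y))
    ((b == a)%:R * 'D_(pbasis a) (fun y => \det (J y)) x).
    apply: (@is_deriveZ _ _ _ (fun y => \det (J y))).
    exact: C1_is_derive (C1_det oU JC1) Ux.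
  rewrite -(is_derive_val d1) -(is_derive_val d2).
  congr ('D_(pbasis a) _ x); apply/funext => y; have /matrixP/(_ b a) := mul_mx_adj (J y).
  by rewrite mxE => ->; rewrite mxE mulr_natl.
have E2 : 'D_(pbasis b) (fun y => \det (J y)) x =
  \sum_a \sum_d (\adj (J x)) d a * 'D_(pbasis a) (fun y => J y b d) x.
  rewrite (is_derive_val (is_derive_det
    (dM := \matrix_(i, j) 'D_(pbasis b) (fun y => J y i j) x) _)); last first.
    by move=> i j; rewrite mxE; exact: C1_is_derive (JC1 i j) Ux.
  apply: eq_bigr => a _; apply: eq_bigr => d _.
  rewrite !mxE mulrC; congr (_ * _).
  have -> : (fun y => J y a d) = 'D_(pbasis a) (phi d) by apply/funext => y; rewrite mxE.
  have -> : (fun y => J y b d) = 'D_(pbasis b) (phi d) by apply/funext => y; rewrite mxE.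
  exact: second_partials_commute oU (phi2 d) Ux.
have : \sum_a \sum_d (J x b d * 'D_(pbasis a) (fun y => (\adj (J y)) d a) x +
     (\adj (J x)) d a * 'D_(pbasis a) (fun y => J y b d) x) =
   'D_(pbasis b) (fun y => \det (J y)) x.
  rewrite (eq_bigr _ (fun a _ => E1 a)) (bigD1 b)//= eqxx mul1r big1 ?addr0// => a.
  by rewrite eq_sym => /negbTE ->; rewrite mul0r.
under eq_bigr do rewrite big_split/=.
rewrite big_split/= -E2 => /(canRL (addrK _)); rewrite subrr exchange_big/= => E3; rewrite -[RHS]E3.
by apply: eq_bigr => d _; rewrite [P _ _]mxE mulr_sumr.
Qed.

(** The flux [F] whose divergence is taken is a vector density: in the source coordinates it becomes
    the sum of [(\adj J) c a * F c] at [phi], up to the sign [s]. By [piola] the derivatives of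
    [\adj J] drop out, and what remains is the divergence of [F] times [s * \det J]. The volume
    density carries the same factor, which therefore cancels. *)
Lemma lap_coord_change U W G G' (phi : 'rV[R]_m -> 'rV[R]_m) w w' x :
  open U -> open W -> C1_metric U G -> C1_metric W G' ->
  (forall y, U y -> W (phi y)) -> (forall c, C2 U (fun y => phi y 0 c)) ->
  let J y := \matrix_(a < m, d < m) 'D_(pbasis a) (fun y => phi y 0 d) y in
  (forall y, U y -> G y = J y *m G' (phi y) *m (J y)^T) ->
  (forall y, U y -> w y = w' (phi y)) -> C2 W w' -> U x ->
  lap_coord G w x = lap_coord G' w' (phi x).
Proof.
move=> oU oW cG cG' UW phi2 J GJ ww' w'2 Ux.
have dphi y : U y -> differentiable phi y.
  by move=> Uy; apply: differentiable_row => c; exact: C1_differentiable (phi2 c).1 Uy.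
have JC1 a d : C1 U (fun y => J y a d).
  by apply: C1_ext ((phi2 d).2 a) => // y _; rewrite mxE.
have detG y : U y -> \det (G y) = \det (J y) ^+ 2 * \det (G' (phi y)).
  by move=> Uy; rewrite GJ// !det_mulmx det_tr; ring.
have detJ y : U y -> \det (J y) != 0.
  move=> Uy; have := pdef_det_gt0 (cG.1 y Uy); rewrite detG//.
  by apply: contraTneq => ->; rewrite expr0n mul0r ltxx.
have uJ y : U y -> J y \in unitmx by move=> Uy; rewrite unitmxE unitfE detJ.
pose s := Num.sg (\det (J x)).
(* The transition need not preserve orientation; by continuity the sign of its Jacobian determinant
   is constant near [x], so it can be pulled out of the derivatives. *)
have nsgn : \forall y \near x, U y /\ 0 < s * \det (J y).
  have cd : {for x, continuous (fun y => s * \det (J y))}.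
    by apply: continuousM; [exact: cst_continuous|exact: C1_continuous (C1_det oU JC1) Ux].
  have s0 : 0 < s * \det (J x) by rewrite -normrEsg normr_gt0 detJ.
  near=> y; split; near: y; first exact: open_nbhs_nbhs.
  exact: (cvgr_gt _ cd _ s0).
have volG y : U y -> 0 < s * \det (J y) ->
    vol_dens G y = s * \det (J y) * vol_dens G' (phi y).
  move=> Uy sJ; rewrite /vol_dens detG// sqrtrM ?sqr_ge0// sqrtr_sqr; congr (_ * _).
  have s2 : `|s| = 1 by rewrite normr_sg detJ.
  by rewrite -(gtr0_norm sJ) normrM s2 mul1r.
pose F c y := vol_dens G' y * \sum_d invmx (G' y) c d * 'D_(pbasis d) w' y.
have FC1 c : C1 W (F c).
  apply: C1M => //; first exact: C1_vol_dens.
  by apply: C1_sum => // d _; apply: C1M => //; [exact: C1_inv_metric|exact: w'2.2].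
have E y a : U y /\ 0 < s * \det (J y) ->
  vol_dens G y * \sum_b invmx (G y) a b * 'D_(pbasis b) w y =
  s * \sum_c (\adj (J y)) c a * F c (phi y).
  move=> [Uy sJ].
  have Dw b : 'D_(pbasis b) w y = \sum_d J y b d * 'D_(pbasis d) w' (phi y).
    have dw := derive_chain (pbasis b) oW w'2.1 (UW _ Uy) (dphi _ Uy).
    have : \forall z \near y, w z = w' (phi z) by exact: near_open Uy ww'.
    move=> /near_eq_derive ->; rewrite (is_derive_val dw).
    by apply: eq_bigr => d _; rewrite mxE.
  pose gw : 'cV[R]_m := \col_d 'D_(pbasis d) w' (phi y).
  have -> : \sum_b invmx (G y) a b * 'D_(pbasis b) w y =
     (invmx (G y) *m (J y *m gw)) a 0.
    rewrite mxE; apply: eq_bigr => b _; rewrite Dw mxE; congr (_ * _).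
    by apply: eq_bigr => d _; rewrite [gw _ _]mxE.
  have uG' := pdef_unit (cG'.1 _ (UW _ Uy)); have uJy := uJ _ Uy.
  have uJT : (J y)^T \in unitmx by rewrite unitmx_tr.
  have -> : invmx (G y) *m (J y *m gw) = invmx (J y)^T *m (invmx (G' (phi y)) *m gw).
    have uG := pdef_unit (cG.1 _ Uy).
    apply: (can_inj (mulKmx uG)); rewrite mulKVmx// {1}GJ//.
    by rewrite -!mulmxA mulKVmx// mulKVmx.
  rewrite volG// -trmx_inv [X in _ * X = _]mxE [LHS]mulr_sumr [RHS]mulr_sumr.
  apply: eq_bigr => c _.
  have -> : (invmx (G' (phi y)) *m gw) c 0 =
    \sum_d invmx (G' (phi y)) c d * 'D_(pbasis d) w' (phi y).
    by rewrite mxE; apply: eq_bigr => d _; rewrite [gw _ _]mxE.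
  rewrite /F mxE /invmx uJy mxE.
  move: (detJ _ Uy) => dJ; set S := \sum_d _.
  by field.
have D a : 'D_(pbasis a) (fun z => vol_dens G z *
    \sum_(b < m) invmx (G z) a b * 'D_(pbasis b) w z) x =
   s * (\sum_c (\adj (J x)) c a * (\sum_d J x a d * 'D_(pbasis d) (F c) (phi x)) +
     \sum_c F c (phi x) * 'D_(pbasis a) (fun y => (\adj (J y)) c a) x).
  rewrite -big_split/=.
  have : \forall z \near x, vol_dens G z *
      (\sum_(b < m) invmx (G z) a b * 'D_(pbasis b) w z) =
      s * \sum_c (\adj (J z)) c a * F c (phi z).
    by apply: filterS nsgn => z; exact: E.
  move=> /near_eq_derive ->.
  apply: is_derive_val; apply: is_deriveZ; apply: is_derive_bigsum => c _.
  have d1 := C1_is_derive a (C1_adj oU c a JC1) Ux.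
  have d2 := derive_chain (pbasis a) oW (FC1 c) (UW _ Ux) (dphi _ Ux).
  apply: (is_derive_eq (is_deriveM d1 d2)); congr (_ *: _ + _).
  by apply: eq_bigr => d _; rewrite mxE.
have -> : lap_coord G w x = (vol_dens G x)^-1 * \sum_a (s *
    (\sum_c (\adj (J x)) c a * (\sum_d J x a d * 'D_(pbasis d) (F c) (phi x)) +
     \sum_c F c (phi x) * 'D_(pbasis a) (fun y => (\adj (J y)) c a) x)).
  by congr (_ * _); apply: eq_bigr => a _; exact: D.
rewrite -mulr_sumr big_split/= [X in _ + X]exchange_big/=.
have -> : \sum_c \sum_a F c (phi x) * 'D_(pbasis a) (fun y => (\adj (J y)) c a) x = 0.
  rewrite big1// => c _; rewrite -mulr_sumr (piola (phi := fun c y => phi y 0 c) c oU)//.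
    by rewrite mulr0.
  exact: uJ.
rewrite addr0 exchange_big/=.
have -> : \sum_c \sum_a (\adj (J x)) c a * (\sum_d J x a d * 'D_(pbasis d) (F c) (phi x))
  = \det (J x) * \sum_c 'D_(pbasis c) (F c) (phi x).
  rewrite mulr_sumr; apply: eq_bigr => c _.
  under eq_bigr do rewrite mulr_sumr.
  rewrite exchange_big/= (bigD1 c)//= [X in _ + X]big1 ?addr0.
    under eq_bigr do rewrite mulrA.
    rewrite -mulr_suml; congr (_ * _).
    by have /matrixP/(_ c c) := mul_adj_mx (J x); rewrite !mxE eqxx mulr1n.
  move=> d dc; under eq_bigr do rewrite mulrA.
  rewrite -mulr_suml; have /matrixP/(_ c d) := mul_adj_mx (J x).
  by rewrite !mxE eq_sym (negbTE dc) mulr0n => ->; rewrite mul0r.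
have [_ sJ] := nbhs_singleton nsgn.
have v'0 := vol_dens_gt0 cG' (UW _ Ux); have dJ := detJ _ Ux.
have s0 : s != 0 by rewrite sgr_eq0.
rewrite /lap_coord volG//; move: (gt_eqF v'0); set v' := vol_dens _ _ => v'n0; set S := \sum_c _.
by field; rewrite v'n0 dJ s0.
Unshelve. all: by end_near. Qed.

End CoordinateLaplacian.

(** * Interior equicontinuity by doubling of variables *)

Lemma near_at_right (R : realType) (P : R -> Prop) :
  (\forall t \near (0 : R), P t) -> \forall t \near 0^'+, P t.
Proof. by rewrite near_withinE; apply: filterS. Qed.

Lemma approx_sub_le2 (R : realFieldType) (k e A B H1 H2 T : R) :
  A - B <= k * T -> `|A - H1 * T| <= e / 2 * T -> `|B - H2 * T| <= e / 2 * T ->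
  (H1 - H2) * T <= (k + e) * T.
Proof. by move=> ? /ler_normlP[? _] /ler_normlP[_ ?]; lra. Qed.

Lemma approx_sub_le3 (R : realFieldType) (k e A B C H1 H2 T : R) :
  A - B <= k * T + C -> `|A - T * H1| <= e / 3 * T -> `|B - T * H2| <= e / 3 * T ->
  C <= e / 3 * T -> (H1 - H2) * T <= (k + e) * T.
Proof. by move=> ? /ler_normlP[? _] /ler_normlP[_ ?]; lra. Qed.

(** * Trace pairing of matrices and comparison of derivatives at two points *)

Section TracePairing.
Context {R : realType} {m : nat}.
Implicit Types (P Q W : 'M[R]_m) (u v w : 'rV[R]_m).

Definition mpair P Q : R := \sum_a \sum_b P a b * Q a b.

Lemma mpairDl P P' Q : mpair (P + P') Q = mpair P Q + mpair P' Q.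
Proof.
rewrite -big_split; apply: eq_bigr => a _; rewrite -big_split; apply: eq_bigr => b _.
by rewrite mxE mulrDl.
Qed.

Lemma mpairZl k P Q : mpair (k *: P) Q = k * mpair P Q.
Proof.
rewrite mulr_sumr; apply: eq_bigr => a _; rewrite mulr_sumr; apply: eq_bigr => b _.
by rewrite mxE mulrA.
Qed.

Lemma mpairBl P P' Q : mpair (P - P') Q = mpair P Q - mpair P' Q.
Proof. by rewrite mpairDl -scaleN1r mpairZl mulN1r. Qed.

Lemma mpair_outer u Q : mpair (u^T *m u) Q = bil Q u u.
Proof.
rewrite bilE; apply: eq_bigr => a _; apply: eq_bigr => b _.
by rewrite mxE big_ord1 mxE.
Qed.

Lemma mulmx_trE W : W^T *m W = \sum_i (row i W)^T *m row i W.
Proof.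
apply/matrixP => a b; rewrite summxE mxE; apply: eq_bigr => i _.
by rewrite !mxE big_ord1 !mxE.
Qed.

Lemma mpair_factor W Q : mpair (W^T *m W) Q = \sum_i bil Q (row i W) (row i W).
Proof.
rewrite mulmx_trE.
have -> : mpair (\sum_i (row i W)^T *m row i W) Q =
    \sum_i mpair ((row i W)^T *m row i W) Q.
  apply: (big_morph (mpair^~ Q)) => [P P'|]; first exact: mpairDl.
  by rewrite /mpair big1// => a _; rewrite big1// => b _; rewrite mxE mul0r.
by apply: eq_bigr => i _; exact: mpair_outer.
Qed.

Lemma mpair_tr P Q : Q^T = Q -> mpair P Q = \tr (P *m Q).
Proof.
move=> QT; apply: eq_bigr => a _; rewrite mxE; apply: eq_bigr => b _.
by rewrite -{1}QT mxE.
Qed.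

Lemma mpair_bound P Q (c : R) : (forall a b, `|P a b| <= c) ->
  `|mpair P Q| <= c * \sum_a \sum_b `|Q a b|.
Proof.
move=> Pc; rewrite mulr_sumr (le_trans (ler_norm_sum _ _ _))//; apply: ler_sum => a _.
rewrite mulr_sumr (le_trans (ler_norm_sum _ _ _))//; apply: ler_sum => b _.
by rewrite normrM ler_wpM2r.
Qed.

Definition hess_mx (f : 'rV[R]_m -> R) x : 'M[R]_m :=
  \matrix_(a, b) 'D_(pbasis a) ('D_(pbasis b) f) x.

Lemma hess_bil U f x v : open U -> C2 U f -> U x -> hess f x v = bil (hess_mx f x) v v.
Proof.
move=> oU f2 Ux; rewrite (hessE v oU f2 Ux) bilE exchange_big.
apply: eq_bigr => a _; apply: eq_bigr => b _.
by rewrite mxE [v 0 b * _]mulrC.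
Qed.

Definition drift_row G x : 'rV[R]_m := \row_b drift G b x.

Lemma lap_coord_pair U G f x : open U -> C1_metric U G -> C2 U f -> U x ->
  lap_coord G f x = mpair (invmx (G x)) (hess_mx f x) + 'D_(drift_row G x) f x.
Proof.
move=> oU cG f2 Ux; rewrite (lap_coordE oU cG f2 Ux); congr (_ + _).
  by apply: eq_bigr => a _; apply: eq_bigr => b _; rewrite mxE.
rewrite (C1_derive _ oU f2.1 Ux); apply: eq_bigr => b _; by rewrite mxE.
Qed.

(* One comparison covers both the maximum principle at a single point ([f2 = 0])
   and the doubled one at a pair of points. *)
Lemma hess_sub_le U (f1 f2 : 'rV[R]_m -> R) x y u v (k : R) : open U -> C2 U f1 -> C2 U f2 -> U x -> U y ->
  (exists2 d : R, 0 < d & forall t : R, 0 < t < d ->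
     f1 (x + t *: u) + f1 (x - t *: u) - 2 * f1 x -
     (f2 (y + t *: v) + f2 (y - t *: v) - 2 * f2 y) <= k * t ^+ 2) ->
  hess f1 x u - hess f2 y v <= k.
Proof.
move=> oU f12 f22 Ux Uy [d d0 h]; apply/ler_addgt0Pr => e e0.
have e20 : 0 < e / 2 by rewrite divr_gt0.
have h1 := second_difference_near u oU f12 Ux e20.
have h2 := second_difference_near v oU f22 Uy e20.
have [t [[[td {}h1] {}h2] t0]] := @filter_ex _ (0 : R)^'+ _ _
  (filterI (filterI (filterI (nbhs_right_lt d0) h1) h2) (nbhs_right_gt (0 : R))).
have {}h := h t (introT andP (conj t0 td)).
have t20 : 0 < t ^+ 2 by rewrite exprn_gt0.
by rewrite -(ler_pM2r t20); exact: approx_sub_le2 h h1 h2.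
Qed.

Lemma derive_sub_le (f1 f2 : 'rV[R]_m -> R) x y u v (k : R) : derivable f1 x u -> derivable f2 y v ->
  (exists c d : R, 0 < d /\ forall t : R, 0 < t < d -> f1 (x + t *: u) - f1 x -
     (f2 (y + t *: v) - f2 y) <= k * t + c * t ^+ 2) ->
  'D_u f1 x - 'D_v f2 y <= k.
Proof.
move=> d1 d2 [c [d [d0 h]]]; apply/ler_addgt0Pr => e e0.
have e30 : 0 < e / 3 by rewrite divr_gt0.
have h1 := derive_quotient_near d1 e30.
have h2 := derive_quotient_near d2 e30.
have h3 : \forall t \near 0^'+, `|c| * t <= e / 3.
  have dc : 0 < e / 3 / (`|c| + 1) by rewrite divr_gt0// ltr_wpDl.
  near=> t; have : t < e / 3 / (`|c| + 1) by near: t; exact: nbhs_right_lt.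
  have t0 : 0 < t by near: t; exact: nbhs_right_gt.
  rewrite ltr_pdivlMr ?ltr_wpDl// => /ltW; apply: le_trans.
  by rewrite mulrC ler_pM2l// lerDl.
have [t [[[td {}h1] [{}h2 {}h3]] t0]] := @filter_ex _ (0 : R)^'+ _ _
  (filterI (filterI (filterI (nbhs_right_lt d0) (near_at_right h1))
    (filterI (near_at_right h2) h3)) (nbhs_right_gt (0 : R))).
have {}h := h t (introT andP (conj t0 td)).
rewrite (gtr0_norm t0) in h1 h2.
have h4 : c * t ^+ 2 <= e / 3 * t.
  by rewrite expr2 mulrA ler_wpM2r ?(ltW t0)// (le_trans _ h3)// ler_wpM2r ?(ltW t0)// ler_norm.
by rewrite -(ler_pM2r t0); exact: approx_sub_le3 h h1 h2 h4.
Unshelve. all: by end_near. Qed.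

End TracePairing.

(** The two roots [a], [b] satisfy $(ab)^2 = 1 - s^2$, hence $ab \le 1 - s^2/2$ and $(a+b)^2 \le 4 -
    s^2$. *)
Lemma sqrt_second_difference (R : realType) (s : R) : `|s| <= 1 ->
  Num.sqrt (1 + s) + Num.sqrt (1 - s) - 2 <= - s ^+ 2 / 4.
Proof.
move=> /ler_normlP[s1 s2].
have a2 : Num.sqrt (1 + s) ^+ 2 = 1 + s by rewrite sqr_sqrtr//; lra.
have b2 : Num.sqrt (1 - s) ^+ 2 = 1 - s by rewrite sqr_sqrtr//; lra.
move: (sqrtr_ge0 (1 + s)) (sqrtr_ge0 (1 - s)) a2 b2.
move: (Num.sqrt (1 + s)) (Num.sqrt (1 - s)) => a b a0 b0 a2 b2.
have ss : s ^+ 2 <= 1 by rewrite expr2; nra.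
have ab : a * b <= 1 - s ^+ 2 / 2.
  rewrite -(@ler_pXn2r _ 2) ?nnegrE ?mulr_ge0//; last by lra.
  by rewrite exprMn a2 b2; nra.
suff : a + b <= 2 - s ^+ 2 / 4 by lra.
have c0 : 0 <= 2 - s ^+ 2 / 4 by lra.
have d0 : 0 <= a + b by lra.
rewrite -(@ler_pXn2r _ 2)//.
have -> : (a + b) ^+ 2 = a ^+ 2 + b ^+ 2 + 2 * (a * b) by ring.
by rewrite a2 b2; nra.
Qed.

Section FourthRoot.
Context {R : realType} {m : nat} (G : 'M[R]_m) (pG : pdef G).
Implicit Types z w : 'rV[R]_m.

(** The square root of the length $|z|_G$, a Hoelder modulus of exponent 1/2. Its second derivative
    along $z$ is negative of order $|z|_G^{-3/2}$; this gain has to beat the bounded Laplacians and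
    the variation of the metric. *)
Definition qroot z : R := Num.sqrt (Num.sqrt (bil G z z)).

Lemma qroot_ge0 z : 0 <= qroot z. Proof. exact: sqrtr_ge0. Qed.

Lemma qroot_gt0 z : z != 0 -> 0 < qroot z.
Proof. by move=> z0; rewrite !sqrtr_gt0 pG.2. Qed.

Lemma qroot0 : qroot 0 = 0.
Proof. by rewrite /qroot /bil !mul0mx mxE !sqrtr0. Qed.

Lemma qroot2 z : qroot z ^+ 2 = Num.sqrt (bil G z z).
Proof. by rewrite sqr_sqrtr// sqrtr_ge0. Qed.

Lemma qroot4 z : qroot z ^+ 4 = bil G z z.
Proof. by rewrite (exprM _ 2 2) qroot2 sqr_sqrtr// (pdef_psd pG).2. Qed.

Lemma qrootZ (s : R) z : 0 <= s -> qroot (s *: z) = Num.sqrt s * qroot z.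
Proof.
move=> s0; rewrite /qroot bilZl bilZr mulrA -expr2 sqrtrM ?sqr_ge0// sqrtr_sqr.
by rewrite ger0_norm// sqrtrM.
Qed.

(* [t^{1/4}] is concave, so [qroot] lies below its tangent in the variable [bil G z z]. *)
Lemma qroot_tangent z w : z != 0 ->
  qroot w - qroot z <= (bil G w w - bil G z z) / (4 * qroot z ^+ 3).
Proof.
move=> z0; rewrite -!qroot4; move: (qroot_gt0 z0) (qroot_ge0 w).
move: (qroot z) (qroot w) => b a b0 a0.
rewrite ler_pdivlMr ?mulr_gt0 ?exprn_gt0// -subr_ge0.
have -> : a ^+ 4 - b ^+ 4 - (a - b) * (4 * b ^+ 3) =
    (a - b) ^+ 2 * ((a + b) ^+ 2 + 2 * b ^+ 2) by ring.
by rewrite mulr_ge0 ?sqr_ge0// addr_ge0 ?sqr_ge0// mulr_ge0 ?sqr_ge0.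
Qed.

Lemma qroot_radial z (s : R) : `|s| <= 1 ->
  qroot ((1 + s) *: z) + qroot ((1 - s) *: z) - 2 * qroot z <= - qroot z * s ^+ 2 / 4.
Proof.
move=> s1; have := sqrt_second_difference s1; move: s1 => /ler_normlP[s1 s2] h.
rewrite !qrootZ; [|lra|lra].
have := ler_wpM2l (qroot_ge0 z) h; lra.
Qed.

Lemma continuous_qroot z : {for z, continuous qroot}.
Proof.
apply: (continuous_comp (f := fun z => Num.sqrt (bil G z z))); last exact: sqrt_continuous.
apply: (continuous_comp (f := fun z => bil G z z)); last exact: sqrt_continuous.
by apply: continuous_bil; exact: cvg_id.
Qed.

End FourthRoot.

Lemma second_difference_tangents (R : realFieldType) (A F q1 q2 om a b d C : R) :
  0 <= A -> F <= A * (q1 + q2 - 2 * om) + C ->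
  q1 - om <= (a + b) / d -> q2 - om <= (- a + b) / d ->
  F <= A * (2 * b / d) + C.
Proof.
move=> A0 hF h1 h2; apply: (le_trans hF); rewrite lerD2r ler_wpM2l//.
have -> : 2 * b / d = (a + b) / d + (- a + b) / d by rewrite -mulrDl; congr (_ / _); ring.
by move: h1 h2; move: (_ / d) (_ / d) => x y; lra.
Qed.

(* The direction [E] along [x - y] is moved in opposite senses at [x] and [y], where the
   concavity of [qroot] gains; the rest of [invmx G0] is moved in parallel, and the
   deviations [Nx], [Ny] from [(1 - eps) * invmx G0] independently. *)
Lemma trace_estimate (R : realType) (m : nat) (G0 hx hy Nx Ny : 'M[R]_m)
    (E : 'rV[R]_m) (k B eps : R) :
  pdef G0 -> bil G0 E E = 1 -> eps <= 1 -> psd Nx -> psd Ny ->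
  (forall v w, bil hx v v - bil hy w w <=
     k * (2^-1 * bil G0 (v - w) (v - w)) + 2 * B * (bil 1%:M v v + bil 1%:M w w)) ->
  bil hx E E - bil hy E E <= - k + 4 * B * bil 1%:M E E ->
  mpair ((1 - eps) *: invmx G0 + Nx) hx - mpair ((1 - eps) *: invmx G0 + Ny) hy <=
  k * (- (1 - eps) + 2^-1 * (mpair Nx G0 + mpair Ny G0)) +
  B * (4 * (1 - eps) * mpair (invmx G0) 1%:M + 2 * mpair Nx 1%:M + 2 * mpair Ny 1%:M).
Proof.
move=> pG E1 eps1 pNx pNy hH hR.
have [W HW] := psd_factor (pdef_inv_sub_outer pG E1).
have pairW Q : mpair (invmx G0) Q = bil Q E E + \sum_i bil Q (row i W) (row i W).
  have -> : invmx G0 = E^T *m E + W^T *m W by rewrite -HW addrC subrK.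
  by rewrite mpairDl mpair_outer mpair_factor.
have bil00 Q : bil Q 0 0 = 0 :> R by rewrite /bil !mul0mx mxE.
have h0 : mpair (invmx G0) hx - mpair (invmx G0) hy <= - k + 4 * B * mpair (invmx G0) 1%:M.
  rewrite !pairW mulrDr addrA opprD addrACA; apply: (lerD hR).
  rewrite mulr_sumr -sumrB; apply: ler_sum => i _; apply: (le_trans (hH _ _)).
  rewrite subrr bil00 mulr0 mulr0 add0r.
  by rewrite le_eqVlt; apply/orP; left; apply/eqP; ring.
have hX : mpair Nx hx <= k * (2^-1 * mpair Nx G0) + 2 * B * mpair Nx 1%:M.
  have [WX ->] := psd_factor pNx.
  rewrite !mpair_factor !mulr_sumr -big_split/=; apply: ler_sum => i _.
  by have := hH (row i WX) 0; rewrite !bil00 !subr0 addr0.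
have hY : - mpair Ny hy <= k * (2^-1 * mpair Ny G0) + 2 * B * mpair Ny 1%:M.
  have [WY ->] := psd_factor pNy.
  rewrite !mpair_factor !mulr_sumr -sumrN -big_split/=; apply: ler_sum => i _.
  by have := hH 0 (row i WY); rewrite !bil00 !sub0r bilN add0r.
rewrite !mpairDl !mpairZl.
have e0 : 0 <= 1 - eps by rewrite subr_ge0.
have {h0} := ler_wpM2l e0 h0.
move: hX hY; move: (mpair _ hx) (mpair _ hy) (mpair _ hx) (mpair _ hy).
move: (mpair _ G0) (mpair _ G0) (mpair _ 1%:M) (mpair _ 1%:M) (mpair _ 1%:M).
by clear => *; nra.
Qed.

(** * Conditions on first and second derivatives at a maximum of the doubled function *)

Section Doubling.
Context {R : realType} {m : nat}.
Implicit Types (x y z v w : 'rV[R]_m) (f : 'rV[R]_m -> R).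

Lemma small_steps (v w : 'rV[R]_m) (rho : R) : 0 < rho ->
  exists2 d : R, 0 < d & forall t : R, 0 < t < d ->
    [/\ `|t *: v| < rho, `|t *: w| < rho & t < 1].
Proof.
move=> rho0; have N0 : 0 < `|v| + `|w| + 1 by rewrite ltr_wpDl// addr_ge0.
exists (Num.min 1 (rho / (`|v| + `|w| + 1))).
  by rewrite lt_min ltr01 divr_gt0.
move=> t /andP[t0]; rewrite lt_min ltr_pdivlMr// => /andP[t1 tr].
have tn p : `|p| <= `|v| + `|w| -> `|t *: p| < rho.
  move=> pl; rewrite normrZ (gtr0_norm t0) (le_lt_trans _ tr)// ler_wpM2l ?(ltW t0)//.
  by rewrite (le_trans pl)// lerDl.
by split; [apply: tn|apply: tn|]; rewrite ?lerDl ?lerDr.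
Qed.

Section MaximumPoint.
Variables (U : set 'rV[R]_m) (G : 'rV[R]_m -> 'M[R]_m) (G0 : 'M[R]_m).
Variables (f : 'rV[R]_m -> R) (x0 x y : 'rV[R]_m) (A B : R).
Hypotheses (oU : open U) (cG : C1_metric U G) (pG : pdef G0) (f2 : C2 U f).
Hypotheses (Ux : U x) (Uy : U y) (xy : x != y) (A0 : 0 <= A).
Let eu (v : 'rV[R]_m) := bil 1%:M v v.
Let z := x - y.
Let om := qroot G0 z.
Hypothesis localmax : exists2 rho : R, 0 < rho & forall v w, `|v| < rho -> `|w| < rho ->
  f (x + v) - f (y + w) - A * qroot G0 (x + v - (y + w))
    - B * (eu (x + v - x0) + eu (y + w - x0)) <=
  f x - f y - A * om - B * (eu (x - x0) + eu (y - x0)).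

Let z0 : z != 0. Proof. by rewrite subr_eq0. Qed.

Let om0 : 0 < om. Proof. exact: qroot_gt0. Qed.

Let zshift v w : x + v - (y + w) = z + (v - w).
Proof. by rewrite opprD addrACA. Qed.

Let eshift p v (t : R) : eu (p + t *: v - x0) =
  eu (p - x0) + 2 * t * bil 1%:M (p - x0) v + t ^+ 2 * eu v.
Proof. by rewrite /eu addrAC bil_sqr_shift// trmx1. Qed.

Lemma doubling_step v w : exists2 d : R, 0 < d & forall t : R, 0 < t < d ->
  f (x + t *: v) - f x - (f (y + t *: w) - f y) <=
    A * (qroot G0 (z + t *: (v - w)) - om) +
    B * (2 * t * (bil 1%:M (x - x0) v + bil 1%:M (y - x0) w) + t ^+ 2 * (eu v + eu w)).
Proof.
have [rho rho0 H] := localmax; have [d d0 hd] := small_steps v w rho0.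
exists d => // t td; have [tv tw _] := hd t td.
have := H _ _ tv tw; rewrite zshift -scalerBr !eshift.
move: (qroot _ _) (f _) (f _) (f _) (f _) => q a b c e.
move: (bil _ _ _) (bil _ _ _) => p1 p2; rewrite /eu.
by move: (bil _ _ _) (bil _ _ _) (bil _ _ _) (bil _ _ _) om (t ^+ 2) => *; lra.
Qed.

(** Adding the steps along [v], [w] and along their opposites cancels the first-order terms of the
    penalty. *)
Lemma doubling_second_difference v w :
  exists2 d : R, 0 < d & forall t : R, 0 < t < d ->
  f (x + t *: v) + f (x - t *: v) - 2 * f x -
     (f (y + t *: w) + f (y - t *: w) - 2 * f y) <=
  A * (qroot G0 (z + t *: (v - w)) + qroot G0 (z - t *: (v - w)) - 2 * om) +
  2 * B * (eu v + eu w) * t ^+ 2.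
Proof.
have [d d0 h1] := doubling_step v w; have [e e0 h2] := doubling_step (- v) (- w).
exists (Num.min d e) => [|t /andP[t0]]; rewrite lt_min ?d0// => /andP[td te].
have {}h1 := h1 t (introT andP (conj t0 td)).
have {}h2 := h2 t (introT andP (conj t0 te)).
have Ez : z + t *: (- v - - w) = z - t *: (v - w) by rewrite -scalerN; congr (_ + _ *: _); rewrite opprB opprK addrC.
have N1 p q : bil 1%:M p (- q) = - bil (1%:M : 'M[R]_m) p q.
  by rewrite -scaleN1r bilZr mulN1r.
have N2 q : eu (- q) = eu q by exact: bilN.
rewrite Ez !N1 !N2 !scalerN in h2.
move: h1 h2; move: (f _) (f _) (f _) (f _) (f _) (f _) (qroot _ _) (qroot _ _) om.
by move: (bil _ _ _) (bil _ _ _) (eu v) (eu w) (t ^+ 2) => *; lra.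
Qed.

Lemma doubling_hess v w : hess f x v - hess f y w <=
  A / (2 * om ^+ 3) * bil G0 (v - w) (v - w) + 2 * B * (eu v + eu w).
Proof.
apply: (hess_sub_le oU f2 f2 Ux Uy).
have [d d0 h] := doubling_second_difference v w; exists d => // t /h {}h.
have h1 := qroot_tangent pG (z + t *: (v - w)) z0.
have h2 := qroot_tangent pG (z + t *: - (v - w)) z0.
move: h1 h2; rewrite !(bil_sqr_shift _ _ _ pG.1) bilN -/om.
have -> : bil G0 z (- (v - w)) = - bil G0 z (v - w) by rewrite -scaleN1r bilZr mulN1r.
have cancel (a b c : R) : a + b + c - a = b + c by ring.
rewrite scalerN !cancel mulrN => h1 h2.
rewrite [leRHS]mulrDl.
have := second_difference_tangents A0 h h1 h2; move=> /le_trans; apply.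
rewrite lerD2r le_eqVlt; apply/orP; left; apply/eqP.
by field; rewrite gt_eqF.
Qed.

(** Since [om ^+ 2] is the length of [z] for [G0], [E] is the unit vector along [z]. Moving [x] by
    [t *: E] and [y] by the opposite multiplies [z] by [1 + s] with [s = 2 * t / om ^+ 2], where
    [qroot] is strictly concave. *)
Lemma doubling_hess_radial E : E = om ^- 2 *: z ->
  hess f x E - hess f y E <= - A / om ^+ 3 + 4 * B * eu E.
Proof.
move=> EE.
have -> : hess f y E = hess f y (- E).
  by rewrite (hess_bil E oU f2 Uy) (hess_bil (- E) oU f2 Uy) bilN.
apply: (hess_sub_le oU f2 f2 Ux Uy).
have [d d0 h] := doubling_second_difference E (- E).
have om2 : 0 < om ^+ 2 / 2 by rewrite divr_gt0// exprn_gt0.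
exists (Num.min d (om ^+ 2 / 2)); first by rewrite lt_min d0.
move=> t /andP[t0]; rewrite lt_min => /andP[td ts].
have {}h := h t (introT andP (conj t0 td)).
pose s := 2 * t / om ^+ 2.
have s1 : `|s| <= 1.
  rewrite ger0_norm; last by rewrite divr_ge0 ?exprn_ge0 ?mulr_ge0 ?(ltW t0) ?(ltW om0).
  by rewrite ler_pdivrMr ?exprn_gt0// mul1r; move: ts; lra.
have Es : t *: (E - - E) = s *: z.
  by rewrite opprK EE -scalerDl !scalerA; congr (_ *: _); rewrite /s; field; rewrite gt_eqF.
move: h; rewrite Es.
have -> : z + s *: z = (1 + s) *: z by rewrite scalerDl scale1r.
have -> : z - s *: z = (1 - s) *: z by rewrite scalerBl scale1r.
move=> h; apply: (le_trans h).
have := qroot_radial G0 z s1; rewrite -/om => hr.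
have N2 q : eu (- q) = eu q by exact: bilN.
rewrite N2 [leRHS]mulrDl; apply: lerD; last by rewrite le_eqVlt; apply/orP; left; apply/eqP; ring.
apply: (le_trans (ler_wpM2l A0 hr)).
by rewrite le_eqVlt; apply/orP; left; apply/eqP; rewrite /s; field; rewrite gt_eqF.
Qed.

Lemma doubling_derive v w : 'D_v f x - 'D_w f y <=
  A / (2 * om ^+ 3) * bil G0 z (v - w) +
  2 * B * (bil 1%:M (x - x0) v + bil 1%:M (y - x0) w).
Proof.
apply: derive_sub_le; [exact: C1_derivable f2.1 _|exact: C1_derivable f2.1 _|].
have [d d0 h] := doubling_step v w.
exists (A / (4 * om ^+ 3) * bil G0 (v - w) (v - w) + B * (eu v + eu w)), d.
split=> // t /h {}h; apply: (le_trans h).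
have := qroot_tangent pG (z + t *: (v - w)) z0.
have cancel (a b c : R) : a + b + c - a = b + c by ring.
rewrite (bil_sqr_shift _ _ _ pG.1) -/om cancel => hq.
rewrite -lerBrDr; apply: (le_trans (ler_wpM2l A0 hq)).
rewrite le_eqVlt; apply/orP; left; apply/eqP.
by field; rewrite gt_eqF.
Qed.

Lemma doubling_estimate (eps : R) (Nx Ny : 'M[R]_m) : eps <= 1 ->
  psd Nx -> psd Ny ->
  invmx (G x) = (1 - eps) *: invmx G0 + Nx ->
  invmx (G y) = (1 - eps) *: invmx G0 + Ny ->
  lap_coord G f x - lap_coord G f y <=
  A / om ^+ 3 * (- (1 - eps) + 2^-1 * (mpair Nx G0 + mpair Ny G0)
     + 2^-1 * bil G0 z (drift_row G x - drift_row G y)) +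
  B * (4 * (1 - eps) * mpair (invmx G0) 1%:M + 2 * mpair Nx 1%:M + 2 * mpair Ny 1%:M +
     2 * (bil 1%:M (x - x0) (drift_row G x) + bil 1%:M (y - x0) (drift_row G y))).
Proof.
move=> eps1 pNx pNy invX invY.
rewrite (lap_coord_pair oU cG f2 Ux) (lap_coord_pair oU cG f2 Uy) invX invY.
have hD := doubling_derive (drift_row G x) (drift_row G y).
have hH v w : bil (hess_mx f x) v v - bil (hess_mx f y) w w <=
    A / om ^+ 3 * (2^-1 * bil G0 (v - w) (v - w)) + 2 * B * (eu v + eu w).
  have := doubling_hess v w; rewrite (hess_bil v oU f2 Ux) (hess_bil w oU f2 Uy).
  move=> /le_trans; apply.
  by rewrite le_eqVlt; apply/orP; left; apply/eqP; field; rewrite gt_eqF.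
have hR := doubling_hess_radial (erefl _).
rewrite (hess_bil _ oU f2 Ux) (hess_bil _ oU f2 Uy) mulNr in hR.
have E1 : bil G0 (om ^- 2 *: z) (om ^- 2 *: z) = 1.
  by rewrite bilZl bilZr -qroot4// -/om; field; rewrite gt_eqF.
have hT := trace_estimate pG E1 eps1 pNx pNy hH hR.
rewrite opprD addrACA; apply: (le_trans (lerD hT hD)).
by rewrite le_eqVlt; apply/orP; left; apply/eqP; field; rewrite gt_eqF.
Qed.

End MaximumPoint.
End Doubling.

(** Here [A'] is [A / om ^+ 3]. With [eps * (M + 2) = 2^-1] the factor of [A'] is at most
    [- 1 + eps * (M + 2) + 4^-1], that is [- 4^-1]. A quarter of [A'] outweighs the penalty terms
    together with [2 * K], while the difference of the Laplacians is at least [- 2 * K]. *)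
Lemma modulus_contradiction (R : realFieldType)
    (K A' B eps M T0 S1 D n1 n2 n3 n4 b d1 d2 Lx Ly : R) :
  0 <= eps -> eps <= 1 -> eps * (M + 2) = 2^-1 ->
  n1 <= eps * (M + 1) -> n2 <= eps * (M + 1) -> n3 <= S1 + T0 -> n4 <= S1 + T0 ->
  b <= 2^-1 -> d1 <= D -> d2 <= D -> 0 <= B -> 0 <= T0 -> 0 <= A' ->
  4 * (2 * K + B * (8 * T0 + 4 * S1 + 4 * D)) + 1 <= A' -> - Lx <= K -> Ly <= K ->
  Lx - Ly <= A' * (- (1 - eps) + 2^-1 * (n1 + n2) + 2^-1 * b) +
    B * (4 * (1 - eps) * T0 + 2 * n3 + 2 * n4 + 2 * (d1 + d2)) -> False.
Proof.
move=> e0 e1 em h1 h2 h3 h4 hb hd1 hd2 B0 T0_ge0 A'0 hA hx hy.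
have c1 : - (1 - eps) + 2^-1 * (n1 + n2) + 2^-1 * b <= - 4^-1 by lra.
have eT : 0 <= eps * T0 by rewrite mulr_ge0.
have c2 : 4 * (1 - eps) * T0 + 2 * n3 + 2 * n4 + 2 * (d1 + d2) <=
    8 * T0 + 4 * S1 + 4 * D.
  have -> : 4 * (1 - eps) * T0 = 4 * T0 - 4 * (eps * T0) by ring.
  by lra.
move: (ler_wpM2l A'0 c1) (ler_wpM2l B0 c2) hA.
move: (A' * (_ + _)) (B * (_ + 2 * (d1 + d2))) (B * _) => p q r; lra.
Qed.

(** * A modulus of continuity that depends only on the metric and the bound of the Laplacian *)

Section Modulus.
Context {R : realType} {m : nat}.
Implicit Types (x y z v w : 'rV[R]_m) (f : 'rV[R]_m -> R).

Lemma box_compact x0 (rho : R) : compact [set x : 'rV[R]_m | `|x - x0| <= rho].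
Proof.
apply: bounded_closed_compact.
  exists (`|x0| + `|rho|); split; first by rewrite num_real.
  move=> M hM x /= xr; apply/ltW; apply: le_lt_trans hM.
  rewrite -[x](subrK x0) addrC (le_trans (ler_normD _ _))// lerD2l.
  by rewrite (le_trans xr)// ler_norm.
have -> : [set x : 'rV[R]_m | `|x - x0| <= rho] =
  (fun x : 'rV[R]_m => `|x - x0|) @^-1` [set r | r <= rho] by [].
apply: preimage_closed; last exact: closed_le.
move=> x _; apply: (continuous_comp (f := fun x => x - x0)); last exact: norm_continuous.
by apply: (@continuousB _ _ _ (fun y => y) (cst x0)); [exact: cvg_id|exact: cst_continuous].
Qed.

Lemma continuous_row (T : topologicalType) (f : 'I_m -> T -> R) (x : T) :
  (forall a, {for x, continuous (f a)}) ->
  {for x, continuous (fun t => \row_a f a t : 'rV[R]_m)}.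
Proof.
move=> h; apply/cvgrPdist_le => e e0.
have : \forall y \near x, forall a, `|f a x - f a y| <= e.
  by apply: filter_forall => a; have /cvgrPdist_le := h a; exact.
apply: filterS => y hy; apply: norm_le_coord; first exact: ltW.
by move=> a; rewrite !mxE.
Qed.

Lemma local_bounds U (G : 'rV[R]_m -> 'M[R]_m) x0 (eta : R) : open U -> C1_metric U G ->
  U x0 -> 0 < eta -> exists2 rho : R, 0 < rho & forall x, `|x - x0| <= rho ->
    [/\ U x, forall a b, `|invmx (G x) a b - invmx (G x0) a b| <= eta &
     `|drift_row G x| <= `|drift_row G x0| + 1].
Proof.
move=> oU cG Ux eta0.
have : \forall x \near x0, [/\ U x,
    forall a b, `|invmx (G x) a b - invmx (G x0) a b| <= eta &
     `|drift_row G x| <= `|drift_row G x0| + 1].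
  have h1 : \forall x \near x0, U x by exact: open_nbhs_nbhs.
  have h2 : \forall x \near x0, forall a b, `|invmx (G x) a b - invmx (G x0) a b| <= eta.
    have h a b : \forall x \near x0, `|invmx (G x) a b - invmx (G x0) a b| <= eta.
      have /cvgrPdist_le/(_ _ eta0) := C1_continuous oU (C1_inv_metric a b oU cG) Ux.
      by apply: filterS => x; rewrite distrC.
    have h' : \forall x \near x0, forall p : 'I_m * 'I_m,
        `|invmx (G x) p.1 p.2 - invmx (G x0) p.1 p.2| <= eta.
      near=> x; near: x; apply: filter_forall => p; exact: h.
    by apply: filterS h' => x hx a b; exact: (hx (a, b)).
  have h3 : \forall x \near x0, `|drift_row G x| <= `|drift_row G x0| + 1.
    have cd : {for x0, continuous (drift_row G)}.
      by apply: continuous_row => a; exact: drift_continuous cG Ux.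
    have /cvgrPdist_le/(_ _ ltr01) := cd.
    apply: filterS => x; rewrite distrC => h.
    by rewrite -lerBlDl (le_trans (lerB_dist _ _)).
  by apply: filterS3 h1 h2 h3 => x.
move=> /nbhs_ballP[r /= r0 hr].
exists (r / 2); first by rewrite divr_gt0.
move=> x xr; apply: hr; rewrite -ball_normE /= distrC (le_lt_trans xr)//.
by rewrite ltr_pdivrMr// ltr_pMr// ltr1n.
Unshelve. all: by end_near. Qed.

Lemma bil_continuous_at Q p (f : 'rV[R]_m * 'rV[R]_m -> 'rV[R]_m) :
  {for p, continuous f} -> {for p, continuous (fun q => bil Q (f q) (f q))}.
Proof. by move=> cf; exact: continuous_bil. Qed.

(* If the penalized difference of [f] at two points had a positive maximum, it would be
   interior, and [doubling_estimate] would contradict the bound on [lap_coord G f]. *)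
Lemma interior_modulus U (G : 'rV[R]_m -> 'M[R]_m) x0 (K : R) : open U -> C1_metric U G ->
  U x0 -> 0 <= K -> exists rho A B : R,
  [/\ 0 < rho, 0 <= A, 0 <= B, (forall x, `|x - x0| <= rho -> U x) &
   forall f, C2 U f ->
     (forall x, `|x - x0| <= rho -> 0 <= f x <= 1 /\ `|lap_coord G f x| <= K) ->
     forall x y, `|x - x0| <= rho -> `|y - x0| <= rho ->
     f x - f y <= A * qroot (G x0) (x - y) +
       B * (bil 1%:M (x - x0) (x - x0) + bil 1%:M (y - x0) (y - x0))].
Proof.
move=> oU cG Ux0 K0.
pose G0 := G x0; have pG : pdef G0 by exact: cG.1.
pose a0 := invmx G0.
have [c c0 hc] := pdef_lower (pdef_inv pG).
pose eps : R := (2 * (m%:R + 2))^-1.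
have m2 : 0 < m%:R + 2 :> R by rewrite ltr_wpDl.
have eps0 : 0 < eps by rewrite invr_gt0 mulr_gt0.
have epsm : eps * (m%:R + 2) = 2^-1 by rewrite /eps; field; rewrite gt_eqF.
have eps1 : eps <= 1.
  rewrite invf_le1 ?mulr_gt0//; have : 0 <= m%:R :> R by []; lra.
pose S0 := \sum_a \sum_b `|G0 a b|.
have S00 : 0 <= S0 by apply: sumr_ge0 => a _; apply: sumr_ge0.
have G0S a b : `|G0 a b| <= S0.
  rewrite /S0 (bigD1 a)//= (bigD1 b)//= -addrA lerDl addr_ge0//.
    by apply: sumr_ge0.
  by apply: sumr_ge0 => i _; apply: sumr_ge0.
pose S1 : R := \sum_(a < m) \sum_(b < m) `|(1%:M : 'M[R]_m) a b|.
have S10 : 0 <= S1 by apply: sumr_ge0 => a _; apply: sumr_ge0.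
(* The second bound makes the oscillation of the inverse metric at most [eps *: a0] as a form, so
   that removing [(1 - eps) *: a0] leaves a nonnegative matrix. The third bounds the trace of the
   remainder against [G0] by [eps * (m%:R + 1)], and the bound [1] serves for its trace against the
   identity. *)
pose eta := Num.min 1 (Num.min (eps * c / (m%:R ^+ 2 + 1)) (eps / (S0 + 1))).
have m21 : 0 < m%:R ^+ 2 + 1 :> R by rewrite ltr_wpDl// exprn_ge0.
have S01 : 0 < S0 + 1 by rewrite ltr_wpDl.
have eta0 : 0 < eta by rewrite !lt_min ltr01 !divr_gt0// mulr_gt0.
have eta1 : eta <= 1 by rewrite ge_min lexx.
have eta2 : m%:R ^+ 2 * eta <= eps * c.
  have : eta <= eps * c / (m%:R ^+ 2 + 1) by rewrite !ge_min lexx orbT.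
  rewrite ler_pdivlMr// mulrC; apply: le_trans.
  by rewrite ler_wpM2r ?(ltW eta0)// lerDl.
have eta3 : eta * S0 <= eps.
  have : eta <= eps / (S0 + 1) by rewrite !ge_min lexx !orbT.
  rewrite ler_pdivlMr//; apply: le_trans.
  by rewrite ler_wpM2l ?(ltW eta0)// lerDl.
have [rho1 rho10 hrho] := local_bounds oU cG Ux0 eta0.
pose Dr := `|drift_row G x0| + 1.
have Dr0 : 0 < Dr by rewrite ltr_wpDl.
(* Through [rho <= (2 * L)^-1], the summand with [Dr] makes the drift term at most [2^-1], and the
   summand [4] makes [qroot G0 (x - y)] at most [1]. *)
pose L := m%:R ^+ 2 * S0 * (4 * Dr + 4) + 1.
have L1 : 1 <= L.
  by rewrite lerDr !mulr_ge0 ?exprn_ge0// addr_ge0 ?mulr_ge0 ?(ltW Dr0).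
have L0 : 0 < L by rewrite (lt_le_trans ltr01).
pose rho := Num.min rho1 (2 * L)^-1.
have rho0 : 0 < rho by rewrite lt_min rho10 invr_gt0 mulr_gt0.
have rhoL : 2 * L * rho <= 1.
  have : rho <= (2 * L)^-1 by rewrite ge_min lexx orbT.
  by rewrite -[_^-1]mul1r ler_pdivlMr ?mulr_gt0// mulrC.
have rhole1 : rho <= 1 by apply: le_trans rhoL; rewrite ler_peMl ?(ltW rho0)//; lra.
have rhole : rho <= rho1 by rewrite ge_min lexx.
(* On the edge of the box the penalty is then at least [1], the largest possible oscillation of [f],
   so a positive maximum is interior. [A] is chosen later and may depend on [B]. *)
pose B := rho ^- 2; have B0 : 0 <= B by rewrite invr_ge0 exprn_ge0// ltW.
pose T0 := mpair a0 1%:M.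
have T00 : 0 <= T0.
  have [W HW] := psd_factor (pdef_psd (pdef_inv pG)); rewrite /T0 /a0 HW.
  by rewrite mpair_factor; apply: sumr_ge0 => i _; exact: bil1_ge0.
have nz v : `|v - x0| <= rho -> psd (invmx (G v) - (1 - eps) *: a0) /\
    mpair (invmx (G v) - (1 - eps) *: a0) G0 <= eps * (m%:R + 1) /\
    mpair (invmx (G v) - (1 - eps) *: a0) 1%:M <= S1 + T0.
  move=> vr; have [Uv hv _] := hrho v (le_trans vr rhole).
  have E : invmx (G v) - (1 - eps) *: a0 = (invmx (G v) - a0) + eps *: a0.
    by rewrite scalerBl scale1r opprB addrA addrAC.
  have hd a b : `|(invmx (G v) - a0) a b| <= eta by rewrite !mxE; exact: hv.
  rewrite E; split; [split|split].
  - have [aT _] := pdef_inv pG; have [bT _] := pdef_inv (cG.1 v Uv).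
    by rewrite linearD linearB linearZ /= /a0 aT bT.
  - move=> w; rewrite bilDM bilZM.
    have h1 := bil_bound w w hd.
    have h2 := ler_wpM2l (ltW eps0) (hc w).
    have h3 : m%:R ^+ 2 * eta * (`|w| * `|w|) <= eps * c * `|w| ^+ 2.
      by rewrite expr2 ler_wpM2r// mulr_ge0.
    move: h1 => /ler_normlP[h1 _]; move: h1 h2 h3.
    move: (bil _ _ _) (bil _ _ _) (`|w| * `|w|) (`|w| ^+ 2); clear=> p q r s.
    by rewrite mulrA; lra.
  - rewrite mpairDl mpairZl.
    have -> : mpair a0 G0 = m%:R.
      by rewrite mpair_tr ?pG.1// mulVmx ?mxtrace1// pdef_unit.
    rewrite mulrDr addrC mulr1 lerD2l (le_trans _ eta3)// (le_trans (ler_norm _))//.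
    exact: mpair_bound.
  - rewrite mpairDl mpairZl lerD//.
      rewrite (le_trans (ler_norm _))// (le_trans (mpair_bound _ hd))//.
      by rewrite -[leRHS]mul1r ler_wpM2r.
    by rewrite -[leRHS]mul1r ler_wpM2r.
pose C := 8 * T0 + 4 * S1 + 4 * (m%:R * Dr).
have C0 : 0 <= C by rewrite !addr_ge0 ?mulr_ge0// ltW.
pose A := 4 * (2 * K + B * C) + 1.
have A0 : 0 <= A by rewrite addr_ge0 ?mulr_ge0// addr_ge0 ?mulr_ge0.
exists rho, A, B; split => //.
  by move=> x xr; have [] := hrho x (le_trans xr rhole).
move=> f f2 hf x' y' x'r y'r.
pose eu (v : 'rV[R]_m) : R := bil 1%:M v v.
pose Phi (p : 'rV[R]_m * 'rV[R]_m) := f p.1 - f p.2 - A * qroot G0 (p.1 - p.2)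
  - B * (eu (p.1 - x0) + eu (p.2 - x0)).
suff : Phi (x', y') <= 0 by rewrite /Phi /= -addrA -opprD subr_le0.
pose Bx := [set x : 'rV[R]_m | `|x - x0| <= rho].
have UB p : Bx p -> U p by move=> h; have [] := hrho p (le_trans h rhole).
have cPhi : {within Bx `*` Bx, continuous Phi}.
  apply: continuous_in_subspaceT => p; rewrite inE => -[p1 p2].
  have c1 : {for p, continuous (fun q : 'rV[R]_m * 'rV[R]_m => q.1)} by exact: cvg_fst.
  have c2 : {for p, continuous (fun q : 'rV[R]_m * 'rV[R]_m => q.2)} by exact: cvg_snd.
  have cc : {for p, continuous (fun q : 'rV[R]_m * 'rV[R]_m => x0)} by exact: cvg_cst.
  have cA (k : R) : {for p, continuous (fun q : 'rV[R]_m * 'rV[R]_m => k)} by exact: cvg_cst.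
  have f1 := continuous_comp c1 (C1_continuous oU f2.1 (UB _ p1)).
  have f3 := continuous_comp c2 (C1_continuous oU f2.1 (UB _ p2)).
  have q := continuous_comp (continuousB c1 c2) (@continuous_qroot R m G0 _).
  have e1 := bil_continuous_at (Q := 1%:M) (continuousB c1 cc).
  have e2 := bil_continuous_at (Q := 1%:M) (continuousB c2 cc).
  exact: (continuousB (continuousB (continuousB f1 f3) (continuousM (cA A) q))
    (continuousM (cA B) (continuousD e1 e2))).
have [|[x y] pB pmax] := @compact_EVT_max _ R Phi (Bx `*` Bx) _
    (compact_setX (@box_compact x0 rho) (@box_compact x0 rho)) cPhi.
  by exists (x', y').
apply: (le_trans (pmax (x', y') _)); first by rewrite inE.
move: pB; rewrite inE => -[/= xB yB].
rewrite leNgt; apply/negP => Phi0.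
have eu_ge0 v : 0 <= eu v by exact: bil1_ge0.
have edge v : `|v| = rho -> 1 <= B * eu v.
  move=> vr; rewrite /B mulrC ler_pdivlMr ?exprn_gt0// mul1r -vr; exact: bil1_ge.
have AQ := mulr_ge0 A0 (qroot_ge0 G0 (x - y)).
have [/andP[fx0 fx1] Lx] := hf x xB; have [/andP[fy0 fy1] Ly] := hf y yB.
have BX := mulr_ge0 B0 (eu_ge0 (x - x0)); have BY := mulr_ge0 B0 (eu_ge0 (y - x0)).
rewrite /Phi /= mulrDr in Phi0.
have xlt : `|x - x0| < rho.
  rewrite lt_neqAle xB andbT; apply/eqP => /edge.
  by move: Phi0 fx1 fy0 AQ BY; clear; lra.
have ylt : `|y - x0| < rho.
  rewrite lt_neqAle yB andbT; apply/eqP => /edge.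
  by move: Phi0 fx1 fy0 AQ BX; clear; lra.
have xy : x != y.
  apply/eqP => E; move: Phi0 BX BY; rewrite E subrr subrr qroot0.
  by move: (B * _); clear => b; lra.
have lmax : exists2 r : R, 0 < r & forall v w, `|v| < r -> `|w| < r ->
  f (x + v) - f (y + w) - A * qroot G0 (x + v - (y + w))
    - B * (eu (x + v - x0) + eu (y + w - x0)) <=
  f x - f y - A * qroot G0 (x - y) - B * (eu (x - x0) + eu (y - x0)).
  exists (Num.min (rho - `|x - x0|) (rho - `|y - x0|)).
    by rewrite lt_min !subr_gt0 xlt.
  move=> v w; rewrite !lt_min => /andP[v1 _] /andP[_ w1].
  apply: (pmax (x + v, y + w)); rewrite inE; split => /=.
    by rewrite /Bx/= addrAC (le_trans (ler_normD _ _))// -lerBrDl; exact: ltW.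
  by rewrite /Bx/= addrAC (le_trans (ler_normD _ _))// -lerBrDl; exact: ltW.
have [pNx [Nx1 Nx2]] := nz x xB.
have [pNy [Ny1 Ny2]] := nz y yB.
have sp (M N : 'M[R]_m) : M = N + (M - N) by rewrite addrC subrK.
have hle := doubling_estimate oU cG pG f2 (UB _ xB) (UB _ yB) xy A0 lmax eps1 pNx pNy (sp _ _) (sp _ _).
have [_ _ Dx] := hrho x (le_trans xB rhole); have [_ _ Dy] := hrho y (le_trans yB rhole).
have z2 : `|x - y| <= 2 * rho.
  have -> : x - y = (x - x0) - (y - x0) by rewrite opprB addrA subrK.
  by rewrite (le_trans (ler_normB _ _))// mulr2n mulrDl mul1r lerD.
have bz : bil G0 (x - y) (drift_row G x - drift_row G y) <= 2^-1.
  have Dxy : `|drift_row G x - drift_row G y| <= 2 * Dr.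
    by rewrite (le_trans (ler_normB _ _))// mulr2n mulrDl mul1r lerD.
  rewrite (le_trans (ler_norm _))// (le_trans (bil_bound _ _ G0S))//.
  apply: (@le_trans _ _ (m%:R ^+ 2 * S0 * (2 * rho * (2 * Dr)))).
    by rewrite ler_wpM2l ?mulr_ge0 ?exprn_ge0// ler_pM.
  have : m%:R ^+ 2 * S0 * (4 * Dr) <= L.
    rewrite /L -[leLHS]addr0 lerD// ler_wpM2l ?mulr_ge0 ?exprn_ge0//.
    by rewrite lerDl.
  move=> /(ler_wpM2l (ltW rho0)).
  by move: rhoL; move: (m%:R ^+ 2 * S0) => t; clear; lra.
have om1 : qroot G0 (x - y) <= 1.
  rewrite -(@ler_pXn2r _ 4) ?nnegrE ?qroot_ge0// expr1n qroot4//.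
  rewrite (le_trans (ler_norm _))// (le_trans (bil_bound _ _ G0S))//.
  apply: (@le_trans _ _ (m%:R ^+ 2 * S0 * (2 * rho * (2 * rho)))).
    by rewrite ler_wpM2l ?mulr_ge0 ?exprn_ge0// ler_pM.
  have hL : m%:R ^+ 2 * S0 * 4 <= L.
    rewrite /L -[leLHS]addr0 lerD// ler_wpM2l ?mulr_ge0 ?exprn_ge0//.
    by rewrite lerDr mulr_ge0// ltW.
  have hL2 := ler_wpM2l (ltW rho0) hL.
  apply: (@le_trans _ _ (rho * (m%:R ^+ 2 * S0 * 4))).
    have -> : m%:R ^+ 2 * S0 * (2 * rho * (2 * rho)) = rho * (rho * (m%:R ^+ 2 * S0 * 4)) by ring.
    by rewrite ler_piMl// mulr_ge0 ?(ltW rho0)// !mulr_ge0 ?exprn_ge0.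
  by apply: (le_trans hL2); move: rhoL L0 rho0; clear; nra.
have om0 : 0 < qroot G0 (x - y) by rewrite qroot_gt0// subr_eq0.
have dl p : `|p - x0| <= rho -> `|drift_row G p| <= Dr ->
    bil 1%:M (p - x0) (drift_row G p) <= m%:R * Dr.
  move=> pr pD; rewrite (le_trans (ler_norm _))// (le_trans (bil1_le _ _))//.
  by rewrite ler_wpM2l// -[leRHS]mul1r ler_pM// (le_trans pr).
have {}Dx := dl x xB Dx; have {}Dy := dl y yB Dy.
move: Lx Ly => /ler_normlP[Lx _] /ler_normlP[_ Ly].
have om3 : 1 <= (qroot G0 (x - y) ^+ 3)^-1.
  by rewrite invf_ge1 ?exprn_gt0// exprn_ile1// ltW.
have hA : A <= A / qroot G0 (x - y) ^+ 3 by rewrite ler_peMr.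
have A'0 := le_trans A0 hA.
rewrite -/a0 in Nx1 Ny1 Nx2 Ny2 *.
exact: (modulus_contradiction (ltW eps0) eps1 epsm Nx1 Ny1 Nx2 Ny2 bz Dx Dy B0 T00 A'0 hA Lx Ly hle).
Qed.
End Modulus.

(** * Barriers *)

Lemma mpair_le (R : realType) (m : nat) (P Q Q' : 'M[R]_m) : psd P ->
  (forall v, bil Q v v <= bil Q' v v) -> mpair P Q <= mpair P Q'.
Proof. by move=> /psd_factor[W ->] h; rewrite !mpair_factor; apply: ler_sum. Qed.

Section Barrier.
Context {R : realType} {m : nat}.
Implicit Types (x y z v w : 'rV[R]_m) (f h : 'rV[R]_m -> R).

Lemma lap_coord_le_at_min U (G : 'rV[R]_m -> 'M[R]_m) f h x : open U -> C1_metric U G ->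
  C2 U f -> C2 U h -> U x ->
  (exists2 r : R, 0 < r & forall v, `|v| < r -> f x - h x <= f (x + v) - h (x + v)) ->
  lap_coord G h x <= lap_coord G f x.
Proof.
move=> oU cG f2 h2 Ux [r r0 hmin].
have hp v : exists2 d : R, 0 < d & forall t : R, 0 < t < d ->
    h (x + t *: v) - h x - (f (x + t *: v) - f x) <= 0 /\
    h (x - t *: v) - h x - (f (x - t *: v) - f x) <= 0.
  have [d d0 hd] := small_steps v v r0; exists d => // t /hd[tv _ _].
  have := hmin _ tv; have := hmin (- (t *: v)); rewrite normrN => /(_ tv); lra.
rewrite (lap_coord_pair oU cG h2 Ux) (lap_coord_pair oU cG f2 Ux); apply: lerD.
  apply: mpair_le; first exact: pdef_psd (pdef_inv (cG.1 x Ux)).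
  have le2 (a b c d : R) : a = b -> c = d -> a <= c -> b <= d by move=> -> ->.
  move=> v; apply: (le2 _ _ _ _ (hess_bil v oU h2 Ux) (hess_bil v oU f2 Ux)).
  rewrite -subr_le0.
  apply: (hess_sub_le oU h2 f2 Ux Ux).
  have [d d0 hd] := hp v; exists d => // t /hd[h1 h3].
  by rewrite mul0r; move: h1 h3; lra.
rewrite -subr_le0; apply: derive_sub_le.
- exact: C1_derivable h2.1 Ux.
- exact: C1_derivable f2.1 Ux.
- have [d d0 hd] := hp (drift_row G x); exists 0, d; split=> // t /hd[h1 _].
  by rewrite !mul0r addr0.
Qed.

(** For [c = - k * expR (- s * r ^+ 2)] this is Hopf's barrier: nonpositive where [|x - y|] is at
    least [r], because the Euclidean length dominates the norm. *)
Definition gauss (k c s : R) y x : R := k * expR (- s * bil 1%:M (x - y) (x - y)) + c.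

Lemma derive_coord x (a b : 'I_m) :
  is_derive x (pbasis b) (fun x : 'rV[R]_m => x 0 a) (a == b)%:R.
Proof.
apply: DeriveDef; first exact/diff_derivable/differentiable_coord.
have := @derive_row R m m id x (pbasis b) a; rewrite derive_id mxE eqxx /= => <- //.
Qed.

Lemma derive_bil1 x y (b : 'I_m) :
  is_derive x (pbasis b) (fun x => bil 1%:M (x - y) (x - y)) (2 * (x 0 b - y 0 b)).
Proof.
have : is_derive x (pbasis b) (fun x => \sum_a (x 0 a - y 0 a) * (x 0 a - y 0 a))
   (\sum_a ((x 0 a - y 0 a) * (a == b)%:R + (x 0 a - y 0 a) * (a == b)%:R)).
  apply: is_derive_bigsum => a _.
  have d : is_derive x (pbasis b) (fun x : 'rV[R]_m => x 0 a - y 0 a) (a == b)%:R.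
    apply: (is_derive_eq (is_deriveB (derive_coord x a b) (is_derive_cst (y 0 a) _ _))).
    exact: subr0.
  exact: (is_deriveM d d).
have -> : (fun x => \sum_a (x 0 a - y 0 a) * (x 0 a - y 0 a)) =
    (fun x => bil 1%:M (x - y) (x - y)).
  by apply/funext => p; rewrite bil1E; apply: eq_bigr => a _; rewrite !mxE.
move=> d; apply: (is_derive_eq d).
rewrite (bigD1 b)//= eqxx big1 => [|a /negbTE ->]; last by rewrite mulr0 addr0.
by rewrite mulr1 addr0 mulr2n mulrDl mul1r.
Qed.

Lemma C1_coord U (a : 'I_m) (c : R) : open U -> C1 U (fun x : 'rV[R]_m => x 0 a - c).
Proof.
move=> oU; apply: C1D => //; last exact: C1_cst.
apply: (C1_of_derive oU (df := fun b => cst (a == b)%:R)) => b y Uy.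
  exact: derive_coord.
exact: cst_continuous.
Qed.

Lemma derive_gauss k c s y x (b : 'I_m) :
  is_derive x (pbasis b) (gauss k c s y)
    (gauss (- 2 * s * k) 0 s y x * (x 0 b - y 0 b)).
Proof.
have d := is_deriveZ (- s) (derive_bil1 x y b).
have e := is_derive_comp1 (is_derive_expR _) d.
apply: (is_derive_eq (is_deriveD (is_deriveZ k e) (is_derive_cst c _ _))).
by rewrite /gauss addr0 /GRing.scale/=; ring.
Qed.

Lemma C1_gauss U k c s y : open U -> C1 U (gauss k c s y).
Proof.
move=> oU; apply: (C1_of_derive oU) => [a x Ux|a x Ux]; first exact: derive_gauss.
apply: continuousM; last first.
  exact: (C1_continuous oU (C1_coord a (y 0 a) oU) Ux).
have cb : {for x, continuous (fun x => bil 1%:M (x - y) (x - y))}.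
  by apply: continuous_bil; apply: (@continuousB _ _ _ (fun y => y) (cst y));
    [exact: cvg_id|exact: cst_continuous|exact: cvg_id|exact: cst_continuous].
apply: continuousD; last exact: cst_continuous.
apply: continuousM; first exact: cst_continuous.
apply: (continuous_comp (f := fun x => - s * bil 1%:M (x - y) (x - y))).
  by apply: continuousM; [exact: cst_continuous|exact: cb].
exact: continuous_expR.
Qed.

Lemma C2_gauss U k c s y : open U -> C2 U (gauss k c s y).
Proof.
move=> oU; split=> [|a]; first exact: C1_gauss.
have : C1 U (fun x => gauss (- 2 * s * k) 0 s y x * (x 0 a - y 0 a)).
  by apply: C1M => //; [exact: C1_gauss|exact: C1_coord].
by apply: C1_ext => // x _; apply: is_derive_val; exact: derive_gauss.
Qed.

Lemma hess_gauss k c s y x :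
  hess_mx (gauss k c s y) x =
  (k * expR (- s * bil 1%:M (x - y) (x - y))) *:
    ((4 * s ^+ 2) *: ((x - y)^T *m (x - y)) - (2 * s) *: 1%:M).
Proof.
apply/matrixP => a b; rewrite mxE.
have -> : 'D_(pbasis b) (gauss k c s y) =
    (fun x => gauss (- 2 * s * k) 0 s y x * (x 0 b - y 0 b)).
  by apply/funext => p; apply: is_derive_val; exact: derive_gauss.
have d2 : is_derive x (pbasis a) (fun x : 'rV[R]_m => x 0 b - y 0 b) (b == a)%:R.
  apply: (is_derive_eq (is_deriveB (derive_coord x b a) (is_derive_cst (y 0 b) _ _))).
  exact: subr0.
rewrite (is_derive_val (is_deriveM (derive_gauss (- 2 * s * k) 0 s y x a) d2)).
rewrite !mxE big_ord1 !mxE /gauss !addr0 /GRing.scale/= eq_sym.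
move: (expR _) (x 0 a - y 0 a) (x 0 b - y 0 b) => e p q.
by case: (a == b) => /=; ring.
Qed.

Lemma lap_coord_gauss U (G : 'rV[R]_m -> 'M[R]_m) k c s y x : open U ->
  C1_metric U G -> U x ->
  lap_coord G (gauss k c s y) x = k * expR (- s * bil 1%:M (x - y) (x - y)) *
    (4 * s ^+ 2 * bil (invmx (G x)) (x - y) (x - y) -
     2 * s * (mpair (invmx (G x)) 1%:M + bil 1%:M (drift_row G x) (x - y))).
Proof.
move=> oU cG Ux; rewrite (lap_coord_pair oU cG (C2_gauss k c s y oU) Ux).
rewrite (C1_derive _ oU (C1_gauss k c s y oU) Ux) hess_gauss.
have mpairC (P Q : 'M[R]_m) : mpair P Q = mpair Q P.
  by apply: eq_bigr => a _; apply: eq_bigr => b _; rewrite mulrC.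
rewrite mpairC mpairZl mpairBl !mpairZl mpair_outer (mpairC 1%:M).
have -> : \sum_b drift_row G x 0 b * 'D_(pbasis b) (gauss k c s y) x =
    k * expR (- s * bil 1%:M (x - y) (x - y)) * (- 2 * s * bil 1%:M (drift_row G x) (x - y)).
  rewrite (bil1E (drift_row G x)) !mulr_sumr; apply: eq_bigr => b _.
  rewrite (is_derive_val (derive_gauss k c s y x b)) !mxE /gauss addr0; ring.
by ring.
Qed.

End Barrier.

(** * Lower bounds from a negative Laplacian, and their propagation *)

Section Propagation.
Context {R : realType} {m : nat}.
Implicit Types (x y z v w : 'rV[R]_m) (f h : 'rV[R]_m -> R).

Lemma local_ellipticity U (G : 'rV[R]_m -> 'M[R]_m) x0 : open U -> C1_metric U G ->
  U x0 -> exists rho lam Lam : R, [/\ 0 < rho, 0 < lam, 0 <= Lam &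
    forall x, `|x - x0| <= rho -> [/\ U x,
      forall w, lam * `|w| ^+ 2 <= bil (invmx (G x)) w w,
      mpair (invmx (G x)) 1%:M <= Lam & `|drift_row G x| <= Lam]].
Proof.
move=> oU cG Ux0; have pG := cG.1 _ Ux0.
have [c c0 hc] := pdef_lower (pdef_inv pG).
have m21 : 0 < m%:R ^+ 2 + 1 :> R by rewrite ltr_wpDl// exprn_ge0.
pose eta := c / 2 / (m%:R ^+ 2 + 1).
have eta0 : 0 < eta by rewrite !divr_gt0.
have eta2 : m%:R ^+ 2 * eta <= c / 2.
  have : eta <= c / 2 / (m%:R ^+ 2 + 1) by [].
  rewrite ler_pdivlMr// mulrC; apply: le_trans.
  by rewrite ler_wpM2r ?(ltW eta0)// lerDl.
have [rho rho0 hrho] := local_bounds oU cG Ux0 eta0.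
pose S1 : R := \sum_(a < m) \sum_(b < m) `|(1%:M : 'M[R]_m) a b|.
have S10 : 0 <= S1 by apply: sumr_ge0 => a _; apply: sumr_ge0.
pose Lam := eta * S1 + `|mpair (invmx (G x0)) 1%:M| + (`|drift_row G x0| + 1).
have e1 : 0 <= eta * S1 by rewrite mulr_ge0// ltW.
exists rho, (c / 2), Lam; split => //; first by rewrite divr_gt0.
  by rewrite !addr_ge0.
move=> x /hrho[Ux hx dx].
have hd a b : `|(invmx (G x) - invmx (G x0)) a b| <= eta by rewrite !mxE; exact: hx.
split=> // [w||].
- have -> : bil (invmx (G x)) w w =
    bil (invmx (G x) - invmx (G x0)) w w + bil (invmx (G x0)) w w.
    by rewrite -bilDM subrK.
  have h1 := bil_bound w w hd; have h2 := hc w.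
  have h3 : m%:R ^+ 2 * eta * (`|w| * `|w|) <= c / 2 * `|w| ^+ 2.
    by rewrite expr2 ler_wpM2r// mulr_ge0.
  move: h1 => /ler_normlP[h1 _]; move: h1 h2 h3.
  by move: (bil _ _ _) (bil _ _ _) (`|w| * `|w|) (`|w| ^+ 2); clear=> p q r s; lra.
- have -> : mpair (invmx (G x)) 1%:M =
      mpair (invmx (G x) - invmx (G x0)) 1%:M + mpair (invmx (G x0)) 1%:M.
    by rewrite -mpairDl subrK.
  rewrite -[leLHS]addr0 /Lam lerD// ?addr_ge0// lerD ?ler_norm//.
  by rewrite (le_trans (ler_norm _))//; exact: mpair_bound.
- by rewrite (le_trans dx)// lerDr addr_ge0.
Qed.

(** On the edge of the box [h <= 0 <= f]. A negative minimum of [f - h] would thus be interior, and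
    there the Laplacians compare in the opposite sense. The strict inequality is only asked where
    [f < h], so the barrier may fail to be a subsolution where [f] is already known to be large. *)
Lemma gauss_comparison U (G : 'rV[R]_m -> 'M[R]_m) f y (r k s : R) :
  open U -> C1_metric U G -> C2 U f -> 0 <= k -> 0 <= s ->
  let h := gauss k (- k * expR (- s * r ^+ 2)) s y in
  (forall x, `|x - y| <= r -> U x /\ 0 <= f x) ->
  (forall x, `|x - y| <= r -> f x < h x -> lap_coord G f x < lap_coord G h x) ->
  forall x, `|x - y| <= r -> h x <= f x.
Proof.
move=> oU cG f2 k0 s0 h hf hlap x xr.
have h2 : C2 U h by exact: C2_gauss.
pose B := [set x | `|x - y| <= r].
have cfh : {within B, continuous (fun x => f x - h x)}.
  apply: continuous_in_subspaceT => p; rewrite inE => /hf[Up _].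
  apply: continuousB; [exact: C1_continuous f2.1 Up|exact: C1_continuous h2.1 Up].
have [|p pB pmin] := @compact_EVT_min _ R (fun x => f x - h x) B _ (@box_compact R m y r) cfh.
  by exists x.
move: pB; rewrite inE => pB.
have := pmin x; rewrite inE => /(_ xr) => hpx.
have [hfp|hfp] := leP (h p) (f p).
  by rewrite -subr_ge0 (le_trans _ hpx)// subr_ge0.
have [Up fp0] := hf p pB.
have plt : `|p - y| < r.
  rewrite lt_neqAle pB andbT; apply/eqP => pr.
  have : h p <= 0.
    rewrite /h /gauss [- k * _]mulNr subr_le0 ler_wpM2l// ler_expR !mulNr lerN2.
    by rewrite ler_wpM2l// -pr bil1_ge.
  by move=> hp0; move: (lt_le_trans hfp hp0); rewrite ltNge fp0.
have := hlap p pB hfp; rewrite ltNge => /negP[].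
apply: (lap_coord_le_at_min oU cG f2 h2 Up).
exists (r - `|p - y|); first by rewrite subr_gt0.
move=> v vr; apply: pmin; rewrite inE /B/= addrAC.
by rewrite (le_trans (ler_normD _ _))// -lerBrDl ltW.
Qed.

Lemma gauss_ge (k s r r' : R) x y : 0 <= k -> 0 <= s -> `|x - y| <= r' ->
  k * (expR (- s * (m%:R * r' ^+ 2)) - expR (- s * r ^+ 2)) <=
  gauss k (- k * expR (- s * r ^+ 2)) s y x.
Proof.
move=> k0 s0 xr; rewrite /gauss mulrBr [- k * _]mulNr lerD2r ler_wpM2l// ler_expR.
rewrite !mulNr lerN2 ler_wpM2l// (le_trans (ler_norm _))// (le_trans (bil1_le _ _))//.
by rewrite ler_wpM2l// expr2 ler_pM.
Qed.

Lemma gauss_gap (s r r' : R) : 0 < s -> 0 < r -> m%:R * r' ^+ 2 <= r ^+ 2 / 4 ->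
  0 < expR (- s * (m%:R * r' ^+ 2)) - expR (- s * r ^+ 2).
Proof.
move=> s0 r0 h; rewrite subr_gt0 ltr_expR !mulNr ltrN2 ltr_pM2l// (le_lt_trans h)//.
by rewrite ltr_pdivrMr// ltr_pMr ?exprn_gt0// ltr1n.
Qed.

(** A Gaussian with [s = 1], of height [k] so small that its Laplacian stays above [- K]. The box
    radius is fixed before [K], and [eta] does not depend on [f], so the bound is uniform over a
    family. *)
Lemma barrier_source U (G : 'rV[R]_m -> 'M[R]_m) x0 (rho : R) : open U -> C1_metric U G ->
  U x0 -> 0 < rho ->
  exists2 r : R, 0 < r <= rho & (forall x, `|x - x0| <= r -> U x) /\
  forall K : R, 0 < K -> exists eta r' : R, [/\ 0 < eta, 0 < r' &
    forall f, C2 U f ->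
    (forall x, `|x - x0| <= r -> 0 <= f x /\ lap_coord G f x <= - K) ->
    forall x, `|x - x0| <= r' -> eta <= f x].
Proof.
move=> oU cG Ux0 rho0.
have [r1 [lam [Lam [r10 lam0 Lam0 hr1]]]] := local_ellipticity oU cG Ux0.
pose r := Num.min rho r1; have r0 : 0 < r by rewrite lt_min rho0.
have rr1 : r <= r1 by rewrite ge_min lexx orbT.
exists r; first by rewrite r0 ge_min lexx.
split=> [x xr|K K0]; first by have [] := hr1 x (le_trans xr rr1).
have m1 : 0 < m%:R + 1 :> R by rewrite ltr_wpDl.
pose r' := r / (2 * (m%:R + 1)).
have r'0 : 0 < r' by rewrite divr_gt0// mulr_gt0.
have r'r : r' <= r.
  by rewrite ler_pdivrMr ?mulr_gt0// ler_peMr ?(ltW r0)//; move: m1; have : 0 <= m%:R :> R by []; lra.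
have mr' : m%:R * r' ^+ 2 <= r ^+ 2 / 4.
  have -> : r ^+ 2 / 4 = (m%:R + 1) ^+ 2 * r' ^+ 2 by rewrite /r'; field; rewrite gt_eqF.
  rewrite ler_wpM2r ?exprn_ge0 ?(ltW r'0)//.
  by have : 0 <= m%:R :> R by []; move: (m%:R : R); clear=> q q0; nra.
pose Q := 2 * (Lam + m%:R * (Lam * r)).
have Q0 : 0 <= Q by rewrite mulr_ge0// addr_ge0// mulr_ge0// mulr_ge0// ltW.
pose k := K / (Q + 1) / 2.
have k0 : 0 < k by rewrite !divr_gt0// ltr_wpDl.
have kQ : k * Q < K.
  have -> : k * Q = K * (Q / (Q + 1) / 2) by rewrite /k; ring.
  rewrite gtr_pMr// ltr_pdivrMr// ltr_pdivrMr ?ltr_wpDl//; move: Q0; lra.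
exists (k * (expR (- 1 * (m%:R * r' ^+ 2)) - expR (- 1 * r ^+ 2))), r'; split => //.
  by rewrite mulr_gt0// gauss_gap.
move=> f f2 hf x xr'.
apply: (le_trans (gauss_ge r (ltW k0) ler01 xr')).
apply: (gauss_comparison oU cG f2 (ltW k0) ler01); last exact: le_trans r'r.
  by move=> p pr; have [Up _ _ _] := hr1 p (le_trans pr rr1); have [] := hf p pr.
move=> p pr _; have [Up ell tr dr] := hr1 p (le_trans pr rr1); have [_ lf] := hf p pr.
apply: (le_lt_trans lf); rewrite (lap_coord_gauss _ _ _ _ oU cG Up).
set e := expR _; have e0 : 0 < e by exact: expR_gt0.
have e1 : e <= 1.
  by rewrite -expR0 ler_expR mulN1r oppr_le0 bil1_ge0.
have b0 := le_trans (mulr_ge0 (ltW lam0) (sqr_ge0 _)) (ell (p - x0)).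
have bd : bil 1%:M (drift_row G p) (p - x0) <= m%:R * (Lam * r).
  by rewrite (le_trans (ler_norm _))// (le_trans (bil1_le _ _))// ler_wpM2l// ler_pM.
have : - Q <= 4 * 1 ^+ 2 * bil (invmx (G p)) (p - x0) (p - x0) -
    2 * 1 * (mpair (invmx (G p)) 1%:M + bil 1%:M (drift_row G p) (p - x0)).
  rewrite /Q; move: b0 bd tr; move: (bil _ _ _) (bil _ _ _) (mpair _ _) (m%:R * _); clear.
  by move=> *; lra.
have ke0 : 0 < k * e by rewrite mulr_gt0.
move=> /(ler_wpM2l (ltW ke0)); apply: lt_le_trans.
rewrite mulrN ltrN2 (le_lt_trans _ kQ)// ler_wpM2r//.
by rewrite ger_pMr.
Qed.

(** A Gaussian centred at [y] and steep enough to be a strict subsolution outside the box of radius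
    [del], inside which [f] is large by assumption. That [r'] is fixed before [y] and [del] lets
    [x0] be reached from any sufficiently close [y], however small the box about [y]. Everything
    scales linearly with [d]. *)
Lemma barrier_propagation U (G : 'rV[R]_m -> 'M[R]_m) x0 : open U -> C1_metric U G ->
  U x0 -> exists r r' : R, [/\ 0 < r, 0 < r', (forall x, `|x - x0| <= r -> U x) &
  forall y (del : R), `|y - x0| <= r' -> 0 < del -> exists eta th : R, [/\ 0 < eta, 0 < th &
    forall f (d : R), C2 U f -> 0 < d ->
    (forall x, `|x - x0| <= r -> 0 <= f x /\ lap_coord G f x <= th * d) ->
    (forall x, `|x - x0| <= r -> `|x - y| <= del -> d <= f x) ->
    forall x, `|x - x0| <= r' -> eta * d <= f x]].
Proof.
move=> oU cG Ux0.
have [r1 [lam [Lam [r10 lam0 Lam0 hr1]]]] := local_ellipticity oU cG Ux0.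
pose r := r1 / 2; have r0 : 0 < r by rewrite divr_gt0.
have m0 : 0 <= m%:R :> R by [].
have m1 : 0 < m%:R + 1 :> R by rewrite ltr_wpDl.
pose r' := r / (4 * (m%:R + 1)).
have r'0 : 0 < r' by rewrite divr_gt0// mulr_gt0.
have r'r : 2 * r' <= r.
  rewrite /r' mulrA ler_pdivrMr ?mulr_gt0// mulrC ler_pM2l//; move: m0; lra.
have mr' : m%:R * (2 * r') ^+ 2 <= r ^+ 2 / 4.
  have -> : r ^+ 2 / 4 = (m%:R + 1) ^+ 2 * (2 * r') ^+ 2 by rewrite /r'; field; rewrite gt_eqF.
  rewrite ler_wpM2r ?sqr_ge0//.
  by move: m0; move: (m%:R : R); clear=> q q0; nra.
exists r1, r'; split=> // [x /hr1[]//|y del yx del0].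
have near_y x : `|x - y| <= r -> `|x - x0| <= r1.
  move=> xy; have -> : x - x0 = (x - y) + (y - x0) by rewrite addrA subrK.
  rewrite (le_trans (ler_normD _ _))// [leRHS](splitr r1) lerD//.
  by rewrite (le_trans yx)//; move: r'r r'0; rewrite /r; lra.
pose P := lam * del ^+ 2; have P0 : 0 < P by rewrite mulr_gt0// exprn_gt0.
pose Q := Lam + m%:R * (Lam * r).
have Q0 : 0 <= Q by rewrite addr_ge0// mulr_ge0// mulr_ge0// ltW.
(* [P] bounds the leading quadratic term from below outside the [del]-box and [Q] the other terms
   from above; this [s] gives [s * P >= Q + 1], hence [sPQ]. *)
pose s := (Q + 1) / P + 1.
have Q1 : 0 <= Q + 1 by rewrite addr_ge0.
have s1 : 1 <= s by rewrite lerDr divr_ge0// ltW.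
have s0 : 0 < s by rewrite (lt_le_trans ltr01).
have sPQ : 1 <= 4 * s ^+ 2 * P - 2 * s * Q.
  have sP : Q + 1 <= s * P by rewrite /s mulrDl mul1r divfK ?gt_eqF// lerDl ltW.
  have -> : 4 * s ^+ 2 * P - 2 * s * Q = 2 * s * (2 * (s * P) - Q) by ring.
  have : 1 <= 2 * (s * P) - Q by move: sP Q0; move: (s * P) => q; clear; lra.
  by move: s1; move: (2 * (s * P) - Q); clear=> q; nra.
(* Half a lower bound of the Gaussian on the box of radius [r]. The barrier has Laplacian at least
   [2 * th * d] outside the [del]-box, which leaves a strict gap. *)
pose th := expR (- s * (m%:R * r ^+ 2)) / 2.
have th0 : 0 < th by rewrite divr_gt0// expR_gt0.
exists (expR (- s * (m%:R * (2 * r') ^+ 2)) - expR (- s * r ^+ 2)), th; split=> //.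
  exact: gauss_gap.
move=> f d f2 d0 hf hd x xr'.
have xy : `|x - y| <= 2 * r'.
  have -> : x - y = (x - x0) - (y - x0) by rewrite opprB addrA subrK.
  by rewrite (le_trans (ler_normB _ _))// mulr2n mulrDl mul1r lerD.
rewrite mulrC; apply: (le_trans (gauss_ge r (ltW d0) (ltW s0) xy)).
apply: (gauss_comparison oU cG f2 (ltW d0) (ltW s0)); last exact: le_trans r'r.
  by move=> p /near_y pr; have [Up _ _ _] := hr1 p pr; have [] := hf p pr.
move=> p pr fp; have pr1 := near_y p pr.
have [Up ell tr dr] := hr1 p pr1; have [_ lf] := hf p pr1.
have pdel : del < `|p - y|.
  rewrite ltNge; apply/negP => pdel; move: fp; rewrite ltNge => /negP[].
  apply: le_trans (hd p pr1 pdel); rewrite /gauss [- d * _]mulNr -mulrBr ger_pMr//.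
  rewrite lerBlDr -[leLHS]addr0 lerD ?expR_ge0// -[leRHS]expR0 ler_expR mulNr oppr_le0.
  by rewrite mulr_ge0 ?bil1_ge0// ltW.
apply: (le_lt_trans lf); rewrite (lap_coord_gauss _ _ _ _ oU cG Up).
have b0 : P <= bil (invmx (G p)) (p - y) (p - y).
  apply: le_trans (ell _); rewrite /P ler_wpM2l ?(ltW lam0)//.
  by rewrite ler_pXn2r ?nnegrE ?(ltW del0)// ltW.
have bd : bil 1%:M (drift_row G p) (p - y) <= m%:R * (Lam * r).
  by rewrite (le_trans (ler_norm _))// (le_trans (bil1_le _ _))// ler_wpM2l// ler_pM.
have L1 : 1 <= 4 * s ^+ 2 * bil (invmx (G p)) (p - y) (p - y) -
    2 * s * (mpair (invmx (G p)) 1%:M + bil 1%:M (drift_row G p) (p - y)).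
  apply: (le_trans sPQ); apply: lerB.
    by rewrite ler_wpM2l// mulr_ge0// sqr_ge0.
  by rewrite ler_wpM2l ?mulr_ge0 ?(ltW s0)// lerD.
set e := expR (- s * bil _ _ _).
have e0 : 2 * th <= e.
  rewrite /th mulrCA divff// mulr1 ler_expR !mulNr lerN2 ler_wpM2l ?(ltW s0)//.
  by rewrite (le_trans (ler_norm _))// (le_trans (bil1_le _ _))// ler_wpM2l// expr2 ler_pM.
have de0 : 0 <= d * e by rewrite mulr_ge0 ?(ltW d0)// expR_ge0.
have := ler_wpM2l de0 L1; apply: lt_le_trans.
by rewrite mulr1 mulrC ltr_pM2l// (lt_le_trans _ e0)// ltr_pMl// ltr1n.
Qed.

End Propagation.

(** * Time slices and time derivatives of functions on the cylinder *)

Section Cylinder.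
Context {R : realType} {m : nat} (tau0 : R).

Lemma continuous_slice (U : set 'rV[R]_m) (F : R -> 'rV[R]_m -> R) t : tau0 <= t ->
  {within [set z : R * 'rV[R]_m | tau0 <= z.1 /\ U z.2],
    continuous (fun z => F z.1 z.2)} -> {within U, continuous (F t)}.
Proof.
move=> t0 /subspace_continuousP cF; apply/subspace_continuousP => x Ux W hW.
have [[P1 P2] /= [h1 h2] hP] := cF (t, x) (conj t0 Ux) W hW.
apply: filterS h2 => y P2y Uy.
by apply: (hP (t, y)); split=> //=; exact: nbhs_singleton.
Qed.

Lemma Ck_cylinder_slice (U : set 'rV[R]_m) k F t : tau0 <= t ->
  Ck_cylinder tau0 U k F -> Ck_on U k (F t).
Proof.
move=> t0; elim: k F => [|k IH] F /= [cF hF]; split=> //; try exact: continuous_slice cF.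
case: hF => _ _ hF a; have [h1 h2] := hF a; split=> [x Ux|]; first exact: h1.
exact: (IH (fun t => 'D_(pbasis a) (F t))).
Qed.

Lemma time_derivable_is_derive (u : R -> R) t : tau0 < t -> time_derivable tau0 u t ->
  is_derive t 1 u (time_derive tau0 u t).
Proof.
move=> t0 ut.
have E : time_quotient u t = (fun h : R => h^-1 *: ((u \o shift t) (h *: 1) - u t)).
  by apply/funext => h; rewrite /time_quotient /= [_%:A]mulr1 [h + t]addrC.
have h : time_quotient u t @ (0 : R)^' --> time_derive tau0 u t.
  have hc : time_quotient u t @ time_filter tau0 t --> time_derive tau0 u t by exact: ut.
  have d0 : 0 < t - tau0 by rewrite subr_gt0.
  have n0 : \forall h \near (0 : R)^', tau0 <= t + h.
    have hn : \forall h \near (0 : R), `|h| < t - tau0 by exact: nbhs0_lt.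
    have sub (h : R) : `|h| < t - tau0 -> h != 0 -> tau0 <= t + h.
      move=> hlt _; rewrite -lerBlDl -lerN2 opprB (le_trans _ (ltW hlt))//.
      by rewrite (le_trans (ler_norm (- h)))// normrN.
    exact: (filterS sub hn).
  move=> W /hc hW.
  have hW' : (0 : R)^' (fun h => tau0 <= t + h -> W (time_quotient u t h)) by exact: hW.
  exact: (@filterS2 _ (0 : R)^' _ _ _ _ (fun h h1 h2 => h2 h1) n0 hW').
apply: DeriveDef; rewrite ?/derivable ?/derive -E.
  by apply/cvg_ex; exists (time_derive tau0 u t).
exact: cvg_lim h.
Qed.

End Cylinder.

Local Opaque derive lap_coord.

(** * Linearity of the coordinate Laplacian *)

Section LinearLaplacian.
Context {R : realType} {m : nat}.
Implicit Types (f h : 'rV[R]_m -> R).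

Lemma C2_cst (U : set 'rV[R]_m) (c : R) : open U -> C2 U (cst c).
Proof.
move=> oU; split=> [|a]; first exact: C1_cst.
by apply: C1_ext (C1_cst oU 0) => // y _; rewrite derive_cst.
Qed.

Lemma C2_sub (U W : set 'rV[R]_m) f : W `<=` U -> C2 U f -> C2 W f.
Proof.
move=> WU; have C1s h : C1 U h -> C1 W h.
  by move=> [h1 h2]; split=> a y /WU Uy; [exact: h1|exact: h2].
by move=> [f1 f2]; split=> [|a]; exact: C1s.
Qed.

Lemma C1_metric_sub (U W : set 'rV[R]_m) G : W `<=` U -> C1_metric U G -> C1_metric W G.
Proof.
move=> WU [G1 G2]; split=> [y /WU|a b]; first exact: G1.
by have [h1 h2] := G2 a b; split=> c y /WU Uy; [exact: h1|exact: h2].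
Qed.

Lemma C1_lin (U : set 'rV[R]_m) (k : R) f h : open U -> C1 U f -> C1 U h ->
  C1 U (fun y => k * f y + h y).
Proof. by move=> oU f1 h1; exact: (C1D oU (C1M oU (C1_cst oU k) f1) h1). Qed.

Lemma derive_lin (U : set 'rV[R]_m) (k : R) f h y (a : 'I_m) : C1 U f -> C1 U h -> U y ->
  'D_(pbasis a) (fun y => k * f y + h y) y =
  k * 'D_(pbasis a) f y + 'D_(pbasis a) h y.
Proof.
move=> f1 h1 Uy; apply: is_derive_val.
exact: (is_deriveD (is_deriveZ k (C1_is_derive a f1 Uy)) (C1_is_derive a h1 Uy)).
Qed.

Lemma C2_lin (U : set 'rV[R]_m) (k : R) f h : open U -> C2 U f -> C2 U h ->
  C2 U (fun y => k * f y + h y).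
Proof.
move=> oU [f1 f2] [h1 h2]; split=> [|a]; first exact: C1_lin.
by apply: C1_ext (C1_lin k oU (f2 a) (h2 a)) => // y Uy; exact: (@derive_lin U k f h y a f1 h1 Uy).
Qed.

Lemma lap_coord_lin (U : set 'rV[R]_m) G (k : R) f h x : open U -> C1_metric U G ->
  C2 U f -> C2 U h -> U x ->
  lap_coord G (fun y => k * f y + h y) x = k * lap_coord G f x + lap_coord G h x.
Proof.
move=> oU cG f2 h2 Ux.
apply: (etrans (lap_coordE oU cG (C2_lin k oU f2 h2) Ux)).
have E1 := lap_coordE oU cG f2 Ux; have E2 := lap_coordE oU cG h2 Ux.
apply: (etrans _ (esym (f_equal2 (fun p q => k * p + q) E1 E2))).
rewrite mulrDr addrACA; apply: (f_equal2 (fun p q : R => p + q)).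
  rewrite mulr_sumr -big_split; apply: eq_bigr => a _.
  rewrite mulr_sumr -big_split; apply: eq_bigr => b _ /=.
  have -> : 'D_(pbasis a) ('D_(pbasis b) (fun y => k * f y + h y)) x =
      'D_(pbasis a) (fun y => k * 'D_(pbasis b) f y + 'D_(pbasis b) h y) x.
    apply: near_eq_derive.
    exact: (near_open oU Ux (fun y Uy => @derive_lin U k f h y b f2.1 h2.1 Uy)).
  apply: (etrans (f_equal (fun t => _ * t) (@derive_lin U k _ _ x a (f2.2 b) (h2.2 b) Ux))).
  by rewrite mulrDr; apply: (f_equal (fun t => t + _)); exact: mulrCA.
rewrite mulr_sumr -big_split; apply: eq_bigr => b _ /=.
apply: (etrans (f_equal (fun t => _ * t) (@derive_lin U k f h x b f2.1 h2.1 Ux))).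
by rewrite mulrDr; apply: (f_equal (fun t => t + _)); exact: mulrCA.
Qed.

Lemma lap_coord_cst (U : set 'rV[R]_m) G (c : R) x : open U -> C1_metric U G -> U x ->
  lap_coord G (cst c) x = 0.
Proof.
move=> oU cG Ux; rewrite (lap_coordE oU cG (C2_cst c oU) Ux).
rewrite big1 => [|a _]; last first.
  rewrite big1// => b _; have -> : 'D_(pbasis b) (cst c : 'rV[R]_m -> R) = cst 0.
    by apply/funext => y; exact: derive_cst.
  by rewrite derive_cst mulr0.
by rewrite add0r big1// => b _; rewrite derive_cst mulr0.
Qed.

End LinearLaplacian.

(** * The Laplacian on the manifold *)

Section Manifold.
Context {R : realType} {m : nat} {S : topologicalType}.
Context (A : smooth_atlas R m S) (g : riemannian_metric A).
Implicit Types (i j : chart_idx A) (p q : S) (u : S -> R).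

Definition C2_manifold u := forall i, C2 (chart_img i) (u \o chart_inv i).

Lemma chart_img_openE i : open (chart_img i). Proof. exact: chart_img_open. Qed.

Arguments chart_img_openE i : clear implicits.

Lemma chart_imgP i p : chart_dom i p -> chart_img i (chart i p).
Proof. by move=> ip; exists p. Qed.

Lemma chart_inv_dom i y : chart_img i y -> chart_dom i (chart_inv i y).
Proof. by move=> [p ip <-]; rewrite chartK. Qed.

Lemma chart_invK i y : chart_img i y -> chart i (chart_inv i y) = y.
Proof. by move=> [p ip <-]; rewrite chartK. Qed.

Lemma chart_cts i p : chart_dom i p -> {for p, continuous (chart i)}.
Proof.
move=> ip; have := @chart_continuous _ _ _ A i.
rewrite continuous_open_subspace; last exact: chart_dom_open.
by move=> /(_ p); apply; rewrite inE.
Qed.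

Lemma chart_inv_cts i y : chart_img i y -> {for y, continuous (chart_inv i)}.
Proof.
move=> iy; have := @chart_inv_continuous _ _ _ A i.
rewrite continuous_open_subspace; last exact: chart_img_open.
by move=> /(_ y); apply; rewrite inE.
Qed.

Lemma near_chart i p (P : 'rV[R]_m -> Prop) : chart_dom i p ->
  (\forall y \near chart i p, P y) -> \forall q \near p, chart_dom i q /\ P (chart i q).
Proof.
move=> ip h; have h1 : \forall q \near p, chart_dom i q.
  by apply: open_nbhs_nbhs; split=> //; exact: chart_dom_open.
by apply: filterI h1 (chart_cts ip h).
Qed.

Lemma near_chart_inv i p (P : S -> Prop) : chart_dom i p ->
  (\forall q \near p, P q) ->
  \forall y \near chart i p, chart_img i y /\ P (chart_inv i y).
Proof.
move=> ip h; have iy := chart_imgP ip.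
have h1 : \forall y \near chart i p, chart_img i y.
  by apply: open_nbhs_nbhs; split=> //; exact: chart_img_openE.
apply: filterI h1 _; apply: (chart_inv_cts iy).
by rewrite chartK.
Qed.

Lemma C2_manifold_continuous u : C2_manifold u -> continuous u.
Proof.
move=> u2 p; pose i := chart_at A p; have ip : chart_dom i p by exact: chart_dom_at.
have c1 := C1_continuous (chart_img_openE i) (u2 i).1 (chart_imgP ip).
have c2 := continuous_comp (chart_cts ip) c1.
rewrite /continuous_at; have E : \forall q \near p, (u \o chart_inv i \o chart i) q = u q.
  have h1 : \forall q \near p, chart_dom i q.
    by apply: open_nbhs_nbhs; split=> //; exact: chart_dom_open.
  by apply: filterS h1 => q iq /=; rewrite chartK.
have := c2; rewrite /prop_for/continuous_at (nbhs_singleton E) => h.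
have E' : {near nbhs p, u =1 u \o chart_inv i \o chart i} by apply: filterS E => q <-.
exact: (cvg_trans (near_eq_cvg (filterS (fun q e => esym e) E')) h).
Qed.

Lemma metric_C1 i : C1_metric (chart_img i) (metric_mx g i).
Proof.
split=> [y iy|a b].
  by split; [exact: metric_sym|move=> w w0; exact: metric_pos].
exact: Ck_on_C1 (chart_img_openE i) (metric_smooth g i a b 1%N).
Qed.

(** Independence of the chart, from [lap_coord_change] applied to the transition map on the overlap.
    The preferred chart may change from point to point, whereas the local estimates need one chart
    on a whole neighbourhood. *)
Lemma laplacianE u i p : C2_manifold u -> chart_dom i p ->
  laplacian g u p = lap_coord (metric_mx g i) (u \o chart_inv i) (chart i p).
Proof.
move=> u2 ip; pose j := chart_at A p; have jp : chart_dom j p by exact: chart_dom_at.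
pose phi y := chart i (chart_inv j y).
have phip : phi (chart j p) = chart i p by rewrite /phi chartK.
transitivity (lap_coord (metric_mx g j) (u \o chart_inv j) (chart j p)); first by [].
rewrite -phip.
pose O := chart j @` (chart_dom j `&` chart_dom i).
have OE y : O y -> chart_img j y /\ chart_dom i (chart_inv j y).
  by move=> [q [jq iq] <-]; rewrite chartK//; split=> //; exact: chart_imgP.
have oO : open O.
  rewrite openE => y [q [jq iq] <-].
  have iq' : \forall q' \near q, chart_dom i q'.
    by apply: open_nbhs_nbhs; split=> //; exact: chart_dom_open.
  have := near_chart_inv jq iq'; apply: filterS => y' [jy' iy'].
  by exists (chart_inv j y'); [split=> //; exact: chart_inv_dom|exact: chart_invK].
have phi2 a : C2 O (fun y => phi y 0 a).
  exact: Ck_on_C2 oO (@chart_transition_smooth _ _ _ A j i a 2%N).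
have dphi y : O y -> differentiable phi y.
  by move=> Oy; apply: differentiable_row => c; exact: C1_differentiable oO (phi2 c).1 Oy.
apply: (lap_coord_change oO (chart_img_openE i) _ (metric_C1 i) _ phi2).
- apply: C1_metric_sub (metric_C1 j) => y /OE[]//.
- by move=> y /OE[_ iy]; exact: chart_imgP.
- move=> y Oy; have [jy iy] := OE y Oy.
  have := metric_change g (chart_inv_dom jy) iy; rewrite chart_invK//= => ->.
  have -> : 'J (fun y => chart i (chart_inv j y)) y =
      \matrix_(a < m, d < m) 'D_(pbasis a) (fun y => phi y 0 d) y.
    apply/matrixP => a d; rewrite !mxE -/phi -deriveE; last exact: dphi.
    by rewrite derive_row//; exact: dphi.
  by [].
- by move=> y /OE[jy iy] /=; rewrite /phi chartK.
- exact: u2.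
- by exists p.
Qed.

Lemma C2_manifold_cst (c : R) : C2_manifold (cst c).
Proof. by move=> i; exact: C2_cst (chart_img_openE i). Qed.

Lemma C2_manifold_lin (k : R) u1 u2 : C2_manifold u1 -> C2_manifold u2 ->
  C2_manifold (fun p => k * u1 p + u2 p).
Proof. by move=> h1 h2 i; exact: (C2_lin k (chart_img_openE i) (h1 i) (h2 i)). Qed.

Lemma laplacian_lin (k : R) u1 u2 p : C2_manifold u1 -> C2_manifold u2 ->
  laplacian g (fun p => k * u1 p + u2 p) p = k * laplacian g u1 p + laplacian g u2 p.
Proof.
move=> h1 h2; have ip := chart_dom_at A p; set i := chart_at A p in ip.
exact: (lap_coord_lin k (chart_img_openE i) (metric_C1 i) (h1 i) (h2 i) (chart_imgP ip)).
Qed.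

Lemma laplacian_cst (c : R) p : laplacian g (cst c) p = 0.
Proof.
have ip := chart_dom_at A p; set i := chart_at A p in ip.
exact: (lap_coord_cst c (chart_img_openE i) (metric_C1 i) (chart_imgP ip)).
Qed.

Lemma laplacian_le_at_min u1 u2 p : C2_manifold u1 -> C2_manifold u2 ->
  (\forall q \near p, u1 p - u2 p <= u1 q - u2 q) -> laplacian g u2 p <= laplacian g u1 p.
Proof.
move=> h1 h2 hmin; have ip := chart_dom_at A p; set i := chart_at A p in ip.
apply: (lap_coord_le_at_min (chart_img_openE i) (metric_C1 i) (h1 i) (h2 i) (chart_imgP ip)).
have /nbhs_ballP[r /= r0 hr] := near_chart_inv ip hmin.
exists r => // v vr; have [_] := hr (chart i p + v) ltac:(
  by rewrite -ball_normE/= opprD addrA subrr sub0r normrN).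
by rewrite /= chartK.
Qed.

End Manifold.
Arguments chart_img_openE {R m S A} i.

(** * Local estimates carried over to the manifold *)

Section ManifoldEstimates.
Context {R : realType} {m : nat} {S : topologicalType}.
Context (A : smooth_atlas R m S) (g : riemannian_metric A).
Implicit Types (i j : chart_idx A) (p q : S) (u : S -> R).

(** A chart image contains a ball about each of its points, and segments in this ball pull back to
    connected sets. *)
Lemma component_open p : open (connected_component setT p).
Proof.
rewrite openE => q pq; have iq := chart_dom_at A q; set i := chart_at A q in iq.
have /nbhs_ballP[r /= r0 hr] : \forall y \near chart i q, chart_img i y.
  apply: open_nbhs_nbhs; split; first exact: chart_img_openE.
  exact: chart_imgP.
have hq : \forall q' \near q, chart_dom i q' /\ ball (chart i q) r (chart i q').
  by apply: near_chart => //; exact: nbhsx_ballx.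
apply: filterS hq => q' [iq' bq'].
rewrite (same_connected_component pq).
pose c (t : R) := chart i q + t *: (chart i q' - chart i q).
have cU t : t \in `[0, 1]%R -> chart_img i (c t).
  rewrite in_itv/= => /andP[t0 t1]; apply: hr; move: bq'; rewrite -ball_normE /=.
  rewrite opprD addrA subrr sub0r normrN normrZ (ger0_norm t0) distrC.
  by apply: le_lt_trans; rewrite ler_piMl.
have cc : {within `[0, 1], continuous (chart_inv i \o c)}.
  apply: continuous_in_subspaceT => t; rewrite inE => /cU it.
  apply: continuous_comp; last exact: chart_inv_cts.
  by apply: cvgD; [exact: cvg_cst|apply: cvgZr_tmp; exact: cvg_id].
have conn : connected ((chart_inv i \o c) @` `[0, 1]).
  by apply: connected_continuous_connected cc; exact: segment_connected.
apply: (connected_component_max _ _ conn) => //.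
  by exists 0; [rewrite /= in_itv/= lexx ler01|rewrite /c /= scale0r addr0 chartK].
by exists 1; [rewrite /= in_itv/= lexx ler01|rewrite /c /= scale1r addrC subrK chartK].
Qed.

(** The bound [Psi] of [interior_modulus] does not depend on [u], is continuous and vanishes at
    [(x0, x0)]. *)
Lemma equicontinuous_family p (K eps : R) : 0 <= K -> 0 < eps ->
  exists2 O : set S, nbhs p O & forall u, C2_manifold A u -> (forall q, 0 <= u q <= 1) ->
    (forall q, `|laplacian g u q| <= K) -> forall q q', O q -> O q' -> u q - u q' <= eps.
Proof.
move=> K0 eps0; have ip := chart_dom_at A p; set i := chart_at A p in ip.
have [rho [C [B [rho0 C0 B0 hU hu]]]] :=
  interior_modulus (chart_img_openE i) (metric_C1 g i) (chart_imgP ip) K0.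
set x0 := chart i p in hU hu.
pose Psi (y : 'rV[R]_m * 'rV[R]_m) := C * qroot (metric_mx g i x0) (y.1 - y.2) +
  B * (bil 1%:M (y.1 - x0) (y.1 - x0) + bil 1%:M (y.2 - x0) (y.2 - x0)).
have cPsi : {for (x0, x0), continuous Psi}.
  set y0 := (x0, x0).
  have c1 : {for y0, continuous (fun q : 'rV[R]_m * 'rV[R]_m => q.1)} by exact: cvg_fst.
  have c2 : {for y0, continuous (fun q : 'rV[R]_m * 'rV[R]_m => q.2)} by exact: cvg_snd.
  have cc : {for y0, continuous (fun q : 'rV[R]_m * 'rV[R]_m => x0)} by exact: cvg_cst.
  have cA (k : R) : {for y0, continuous (fun q : 'rV[R]_m * 'rV[R]_m => k)} by exact: cvg_cst.
  have q := continuous_comp (continuousB c1 c2) (@continuous_qroot R m (metric_mx g i x0) _).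
  have e1 := bil_continuous_at (Q := 1%:M) (continuousB c1 cc).
  have e2 := bil_continuous_at (Q := 1%:M) (continuousB c2 cc).
  exact: (continuousD (continuousM (cA C) q) (continuousM (cA B) (continuousD e1 e2))).
have Psi0 : Psi (x0, x0) < eps.
  by rewrite /Psi /= subrr qroot0 /bil !mul0mx mxE addr0 !mulr0 addr0.
have [[P1 P2] /= [h1 h2] hP] := cvgr_lt _ cPsi _ Psi0.
have h3 : \forall y \near x0, `|y - x0| <= rho.
  have /nbhs_ballP : nbhs x0 (ball x0 rho) by exact: nbhsx_ballx.
  move=> [r /= r0 hr]; apply/nbhs_ballP; exists r => // y /hr.
  by rewrite -ball_normE/= distrC => /ltW.
have h := near_chart ip (filterI h3 (filterI h1 h2)).
exists [set q | chart_dom i q /\ (`|chart i q - x0| <= rho /\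
  (P1 (chart i q) /\ P2 (chart i q)))]; first exact: h.
move=> u u2 u01 uL q q' [iq [qr [q1 q2]]] [iq' [q'r [q'1 q'2]]].
have := hu (u \o chart_inv i) (u2 i) _ _ _ qr q'r; rewrite /= !chartK//.
move=> /(_ _)/le_trans; apply.
  move=> x /hU ix; split; first exact: u01.
  have := uL (chart_inv i x).
  by rewrite (laplacianE g u2 (chart_inv_dom ix)) chart_invK.
by apply/ltW/(hP (chart i q, chart i q')).
Qed.

Section Family.
Context {T : Type} {F : set_system T} {FF : Filter F} (Y : T -> S -> R).
Hypothesis Y2 : forall k, C2_manifold A (Y k).

(** Stands for positivity at [p] of a limit of the [Y k]: the bound and the neighbourhood are common
    to all [k] in a set of the filter. *)
Definition bounded_below_near p : Prop :=
  exists2 d : R, 0 < d & exists2 O : set S, nbhs p O &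
    \forall k \near F, forall q, O q -> d <= Y k q.

Lemma bounded_below_source p (O : set S) (K : R) : 0 < K -> nbhs p O ->
  (\forall k \near F, forall q, O q -> 0 <= Y k q /\ laplacian g (Y k) q <= - K) ->
  bounded_below_near p.
Proof.
move=> K0 Op hF; have ip := chart_dom_at A p; set i := chart_at A p in ip.
have /nbhs_ballP[r /= r0 hr] := near_chart_inv ip Op.
have r20 : 0 < r / 2 by rewrite divr_gt0.
have [s /andP[s0 sr] [sU hs]] :=
  barrier_source (chart_img_openE i) (metric_C1 g i) (chart_imgP ip) r20.
have [eta [r' [eta0 r'0 hf]]] := hs K K0.
have h3 : \forall y \near chart i p, `|y - chart i p| <= r'.
  by apply/nbhs_ballP; exists r' => // y; rewrite -ball_normE/= distrC => /ltW.
exists eta => //; exists [set q | chart_dom i q /\ `|chart i q - chart i p| <= r'].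
  exact: near_chart ip h3.
apply: filterS hF => k hk q [iq qr].
have := hf (Y k \o chart_inv i) (Y2 k i) _ (chart i q) qr; rewrite /= chartK//; apply.
move=> x xs; have ix := sU x xs.
have [_ /hk[Y0 YL]] : chart_img i x /\ O (chart_inv i x).
  apply: hr; rewrite -ball_normE/= distrC (le_lt_trans xs)// (le_lt_trans sr)//.
  by rewrite ltr_pdivrMr// ltr_pMr// ltr1n.
by move: YL; rewrite (laplacianE g (Y2 k) (chart_inv_dom ix)) chart_invK.
Qed.

(** The points bounded below form a relatively open and closed subset of [C]. Closedness uses that
    the radius [r'] of [barrier_propagation] belongs to the limit point [x] alone: a point [y] of
    the set within [r'] of [x] is enough, with its own [del] and [d]. The Laplacian only has to fall
    below [th * d], which is known after [y] is. *)
Lemma bounded_below_propagation (C : set S) p q : open C -> connected C ->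
  (\forall k \near F, forall x, C x -> 0 <= Y k x) ->
  (forall e : R, 0 < e -> \forall k \near F, forall x, C x -> laplacian g (Y k) x <= e) ->
  C p -> C q -> bounded_below_near p -> bounded_below_near q.
Proof.
move=> oC cC Y0 YL Cp Cq bp.
suff E : C `&` bounded_below_near = C by have [] : (C `&` bounded_below_near) q by rewrite E.
apply: cC; first by exists p.
- exists (C `&` bounded_below_near) => //; last by rewrite setIA setIid.
  rewrite openE => x [Cx]; case=> d d0; case=> V Vx hV.
  have h1 : \forall y \near x, C y by exact: open_nbhs_nbhs.
  have h2 : \forall y \near x, nbhs y V by exact: nbhs_interior.
  apply: filterS (filterI h1 h2) => y [Cy Vy]; split=> //.
  by exists d => //; exists V.
exists (closure (C `&` bounded_below_near)); first exact: closed_closure.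
rewrite eqEsubset; split=> x [Cx hx]; split=> //; first exact: subset_closure.
have ix := chart_dom_at A x; set i := chart_at A x in ix.
pose U := chart_img i `&` [set y | C (chart_inv i y)].
have oU : open U.
  rewrite openE => y [iy Cy].
  have h1 : \forall y' \near y, chart_img i y'.
    by apply: open_nbhs_nbhs; split=> //; exact: chart_img_openE.
  apply: filterI h1 _; apply: (chart_inv_cts iy); exact: open_nbhs_nbhs.
have Ux : U (chart i x) by split; [exact: chart_imgP|rewrite /= chartK].
have cG : C1_metric U (metric_mx g i) by apply: C1_metric_sub (metric_C1 g i) => y [].
have [r [r' [r0 r'0 rU hb]]] := barrier_propagation oU cG Ux.
have h3 : \forall y \near chart i x, `|y - chart i x| <= r'.
  by apply/nbhs_ballP; exists r' => // y; rewrite -ball_normE/= distrC => /ltW.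
have Ox := near_chart ix h3.
have [y [[Cy by_] [iy yr]]] := hx _ Ox; case: by_ => d d0; case=> O Oy hO.
have /nbhs_ballP[del /= del0 hdel] := near_chart_inv iy Oy.
have del20 : 0 < del / 2 by rewrite divr_gt0.
have [eta [th [eta0 th0 hf]]] := hb _ _ yr del20.
exists (eta * d); first by rewrite mulr_gt0.
exists [set q | chart_dom i q /\ `|chart i q - chart i x| <= r']; first exact: Ox.
have td : 0 < th * d by rewrite mulr_gt0.
apply: filterS3 Y0 (YL _ td) hO => k k1 k2 k3 z [iz zr].
have Yk2 : C2 U (Y k \o chart_inv i) by apply: C2_sub (Y2 k i) => w [].
have := hf _ d Yk2 d0 _ _ (chart i z) zr; rewrite /= chartK//; apply.
  move=> w /rU[iw Cw]; split; first exact: k1.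
  by have := k2 _ Cw; rewrite (laplacianE g (Y2 k) (chart_inv_dom iw)) chart_invK.
move=> w _ wd; apply: k3.
have [] // : chart_img i w /\ O (chart_inv i w).
apply: hdel; rewrite -ball_normE/= distrC (le_lt_trans wd)//.
by rewrite ltr_pdivrMr// ltr_pMr// ltr1n.
Qed.

End Family.
End ManifoldEstimates.

(** A cluster point along an ultrafilter is a limit, so no subsequence has to be extracted. *)
Lemma ultra_limit (T : Type) (U : set_system T) (S : topologicalType) (C : set S) (x : T -> S) :
  UltraFilter U -> compact C -> (\forall k \near U, C (x k)) ->
  exists2 p, C p & forall O, nbhs p O -> \forall k \near U, O (x k).
Proof.
move=> UU Cc UC; have [p [Cp clp]] := Cc _ (fmap_proper_filter x _) UC.
exists p => // O pO; have [//|UO] := in_ultra_setVsetC (x @^-1` O) UU.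
by have [y []] := clp (~` O) O UO pO.
Qed.

(** * Families whose Laplacians have vanishing positive part along an ultrafilter *)

Section UltraFamily.
Context {R : realType} {m : nat} {S : topologicalType} (S_compact : compact [set: S]).
Context (A : smooth_atlas R m S) (g : riemannian_metric A).
Context {T : Type} {U : set_system T} {UU : UltraFilter U} (W : T -> S -> R).
Context (W2 : forall k, C2_manifold A (W k)).
Context (W_lap : forall e : R, 0 < e -> \forall k \near U, forall q, laplacian g (W k) q <= e).

Lemma concentration_component (K : R) (x : T -> S) : 0 <= K ->
  (forall k q, 0 <= W k q <= 1) -> (forall k, W k (x k) = 1) ->
  (forall k q, `|laplacian g (W k) q| <= K) ->
  exists p, forall q, connected_component setT p q -> bounded_below_near (F := U) W q.
Proof.
move=> K0 W01 Wx LW.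
have UP : ProperFilter U by exact: ultra_proper.
have [p _ hp] : exists2 p, [set: S] p & forall O, nbhs p O -> \forall k \near U, O (x k).
  by apply: (ultra_limit UU S_compact); exact: filterT.
have h2 : 0 < 2^-1 :> R by rewrite invr_gt0.
have [V pV hV] := equicontinuous_family g p K0 h2.
have pb : bounded_below_near (F := U) W p.
  exists 2^-1; first by [].
  exists V => //; apply: filterS (hp V pV) => k Vx q Vq.
  by have := hV (W k) (W2 k) (W01 k) (LW k) _ _ Vx Vq; rewrite Wx; lra.
exists p => q pq; apply: (bounded_below_propagation W2 _ _ _ _ _ pq pb).
- exact: component_open A p.
- exact: component_connected.
- by apply: filterE => k y _; case/andP: (W01 k y).
- by move=> e e0; apply: filterS (W_lap e0) => k h y _.
- exact: connected_component_refl.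
Qed.

(* Otherwise [W k] minus its minimum over [C] would stay positive throughout [C]. *)
Lemma no_persistent_sink (C : set S) (q0 : S) (K : R) (O : set S) :
  open C -> closed C -> connected C -> C q0 -> 0 < K -> nbhs q0 O ->
  ~ \forall k \near U, forall q, O q -> laplacian g (W k) q <= - K.
Proof.
move=> Co Cc Cconn Cq0 K0 q0O hK.
have UP : ProperFilter U by exact: ultra_proper.
have Ccomp : compact C := subclosed_compact Cc S_compact (@subsetT _ C).
have hz k : exists z, C z /\ forall q, C q -> W k z <= W k q.
  have cW : {within C, continuous (W k)}.
    by apply: continuous_subspaceT => q; exact: C2_manifold_continuous (W2 k) q.
  have [z zC hz] := compact_EVT_min (ex_intro _ q0 Cq0) Ccomp cW.
  by exists z; split; [exact: set_mem|move=> q Cq; apply: hz; exact: mem_set].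
have [z hz'] := choice hz.
pose Z k q := 1 * W k q + cst (- W k (z k)) q.
have ZE k q : Z k q = W k q - W k (z k) by rewrite /Z mul1r.
have Z2 k : C2_manifold A (Z k) by exact: C2_manifold_lin (W2 k) (C2_manifold_cst _).
have LZ k q : laplacian g (Z k) q = laplacian g (W k) q.
  apply: etrans (laplacian_lin g 1 q (W2 k) (C2_manifold_cst _)) _.
  rewrite mul1r; apply: etrans (f_equal _ (laplacian_cst g _ q)) (addr0 _).
have Z0 k q : C q -> 0 <= Z k q by move=> Cq; rewrite ZE subr_ge0; apply: (hz' k).2.
have q0b : bounded_below_near (F := U) Z q0.
  apply: (@bounded_below_source _ _ _ A g _ U _ Z Z2 q0 (O `&` C) K K0).
    by apply: filterI q0O _; apply: open_nbhs_nbhs.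
  by apply: filterS hK => k h q [Oq Cq]; rewrite LZ; split; [exact: Z0|exact: h].
have [y Cy hy] : exists2 y, C y & forall O, nbhs y O -> \forall k \near U, O (z k).
  by apply: (ultra_limit UU Ccomp); apply: filterE => k; case: (hz' k).
have [d d0 [V yV hd]] : bounded_below_near (F := U) Z y.
  apply: (bounded_below_propagation (g := g) Z2 Co Cconn _ _ Cq0 Cy q0b).
  - by apply: filterE => k q; exact: Z0.
  - by move=> e e0; apply: filterS (W_lap e0) => k h q _; rewrite LZ.
have [k [h1 h2]] := filter_ex (filterI hd (hy _ yV)).
by have := h1 _ h2; rewrite ZE subrr leNgt d0.
Qed.

End UltraFamily.

(** * Joint continuity in time and space *)

Section JointContinuity.
Context {R : realType} {m : nat} {S : topologicalType} (tau0 : R).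
Context (S_compact : compact [set: S]).
Implicit Types (F G : R -> S -> R).

Definition jointly_continuous F : Prop :=
  {within [set z : R * S | tau0 <= z.1], continuous (fun z => F z.1 z.2)}.

Lemma joint_continuity_chart (A : smooth_atlas R m S) F :
  (forall i : chart_idx A,
    {within [set z : R * 'rV[R]_m | tau0 <= z.1 /\ chart_img i z.2],
      continuous (fun z => F z.1 (chart_inv i z.2))}) -> jointly_continuous F.
Proof.
move=> cF; apply/subspace_continuousP => -[t p] /= t0 W hW.
have ip := chart_dom_at A p; set i := chart_at A p in ip.
have hW' : nbhs (F t (chart_inv i (chart i p))) W by rewrite chartK.
have /subspace_continuousP cFi := cF i.
have [[P1 P2] /= [h1 h2] hP] := cFi (t, chart i p) (conj t0 (chart_imgP ip)) W hW'.
exists (P1, [set q | chart_dom i q /\ P2 (chart i q)]); first by split=> //=; exact: near_chart.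
move=> [s q] /= [P1s [iq P2q]] s0.
have h : W (F s (chart_inv i (chart i q))) :=
  hP (s, chart i q) (conj P1s P2q) (conj s0 (chart_imgP iq)).
by rewrite chartK in h.
Qed.

Lemma cylinder_continuous (A : smooth_atlas R m S) u : smooth_cylinder tau0 A u ->
  jointly_continuous u.
Proof. by move=> hu; apply: (@joint_continuity_chart A) => i; have [] := hu i 0%N. Qed.

Lemma cylinder_time_derive_continuous (A : smooth_atlas R m S) u :
  smooth_cylinder tau0 A u ->
  jointly_continuous (fun t p => time_derive tau0 (u ^~ p) t).
Proof.
by move=> hu; apply: (@joint_continuity_chart A) => i; have [_ [_ []]] := hu i 1%N.
Qed.

Lemma cylinder_C2 (A : smooth_atlas R m S) u t : smooth_cylinder tau0 A u -> tau0 <= t ->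
  C2_manifold A (u t).
Proof.
move=> hu t0 i; apply: (@Ck_on_C2 _ _ _ 0 _ (chart_img_openE i)).
exact: (Ck_cylinder_slice t0 (hu i 2%N)).
Qed.

Lemma cylinder_is_derive (A : smooth_atlas R m S) u t p : smooth_cylinder tau0 A u ->
  tau0 < t -> is_derive t 1 (u ^~ p) (time_derive tau0 (u ^~ p) t).
Proof.
move=> hu t0; apply: time_derivable_is_derive => //.
have ip := chart_dom_at A p; set i := chart_at A p in ip.
have [_ [h _ _]] := hu i 1%N.
by have := h t (chart i p) (ltW t0) (chart_imgP ip); rewrite chartK.
Qed.

Lemma jointly_continuous_time F p : jointly_continuous F ->
  {within [set t | tau0 <= t], continuous (F ^~ p)}.
Proof.
move=> /subspace_continuousP cF; apply/subspace_continuousP => t t0 W hW.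
have [[P1 P2] /= [h1 h2] hP] := cF (t, p) t0 W hW.
by apply: filterS h1 => s P1s s0; apply: (hP (s, p)) => //; split=> //=; exact: nbhs_singleton.
Qed.

Lemma jointly_continuous_space F t : tau0 <= t -> jointly_continuous F -> continuous (F t).
Proof.
move=> t0 /subspace_continuousP cF p W hW.
have [[P1 P2] /= [h1 h2] hP] := cF (t, p) t0 W hW.
by apply: filterS h2 => q P2q; apply: (hP (t, q)) => //; split=> //=; exact: nbhs_singleton.
Qed.

Lemma jointly_continuous_min F (C : set S) (T : R) : jointly_continuous F ->
  closed C -> C !=set0 -> tau0 <= T ->
  exists t p, [/\ tau0 <= t <= T, C p &
    forall s q, tau0 <= s <= T -> C q -> F t p <= F s q].
Proof.
move=> cF cC [p0 Cp0] T0.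
have kC : compact (`[tau0, T] `*` C).
  apply: compact_setX; first exact: segment_compact.
  exact: subclosed_compact cC S_compact _.
have cFK : {within `[tau0, T] `*` C, continuous (fun z => F z.1 z.2)}.
  apply: continuous_subspaceW cF => -[s q] [] /=.
  by rewrite in_itv/= => /andP[].
have [|[t p] tp tmin] := compact_EVT_min _ kC cFK.
  by exists (tau0, p0); split=> //=; rewrite in_itv/= lexx.
move: tp; rewrite inE => -[/= tT Cp]; exists t, p; split; [by move: tT; rewrite in_itv|exact: Cp|] => s q sT Cq.
by apply: (tmin (s, q)); rewrite inE; split=> //=; rewrite in_itv.
Qed.

Lemma jointly_continuousN F : jointly_continuous F -> jointly_continuous (fun t p => - F t p).
Proof. by move=> cF z; apply: cvgN; exact: cF. Qed.

Lemma jointly_continuous_bounded F (T : R) : jointly_continuous F ->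
  exists M : R, forall t p, tau0 <= t <= T -> `|F t p| <= M.
Proof.
move=> cF; have [T0|T0] := leP tau0 T; last first.
  exists 0 => t p /andP[t0 tT]; have := lt_le_trans T0 t0.
  by rewrite ltNge tT.
have [[p0 _]|S0] := pselect ([set: S] !=set0); last first.
  by exists 0 => t p; exfalso; apply: S0; exists p.
have S0 : [set: S] !=set0 by exists p0.
have [t1 [p1 [_ _ h1]]] := jointly_continuous_min cF closedT S0 T0.
have [t2 [p2 [_ _ h2]]] := jointly_continuous_min (jointly_continuousN cF) closedT S0 T0.
exists (`|F t1 p1| + `|F t2 p2|) => t p tT.
have {}h1 := h1 t p tT I; have {}h2 := h2 t p tT I.
rewrite ler_norml; apply/andP; split.
  rewrite (le_trans _ h1)// opprD -[leRHS]addr0 lerD ?oppr_le0//.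
  by rewrite lerNl -normrN ler_norm.
rewrite -lerN2; apply: le_trans h2; rewrite lerN2.
by rewrite (le_trans (ler_norm _))// lerDr.
Qed.

(** Compactness of the time interval times [S] in its near-covering form, with the time step [d] as
    parameter; this needs no metric on [S]. *)
Lemma jointly_continuous_unif F (T eps : R) : jointly_continuous F -> 0 < eps ->
  exists2 d : R, 0 < d & forall t s p, tau0 <= t <= T -> tau0 <= s -> `|s - t| <= d ->
    `|F s p - F t p| <= eps.
Proof.
move=> /subspace_continuousP cF e0.
have kC : compact (`[tau0, T] `*` [set: S]).
  by apply: compact_setX => //; exact: segment_compact.
pose P (d : R) (z : R * S) := tau0 <= z.1 -> forall s, tau0 <= s -> `|s - z.1| <= d ->
    `|F s z.2 - F z.1 z.2| <= eps.
have e20 : 0 < eps / 2 by rewrite divr_gt0.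
have [d [dP d0]] : exists d, (`[tau0, T] `*` [set: S]) `<=` P d /\ 0 < d.
  have /compact_near_coveringP cov := kC.
  have h := cov R (0 : R)^'+ P _ _.
  apply: (@filter_ex _ (0 : R)^'+); apply: filterI; last exact: nbhs_right_gt.
  apply: h => -[t p] [/=]; rewrite in_itv/= => /andP[t0 _] _.
  have hW : nbhs (F t p) [set r | `|F t p - r| <= eps / 2].
    by apply/nbhs_ballP; exists (eps / 2) => // r; rewrite -ball_normE/= => /ltW.
  have [[P1 P2] /= [h1 h2] hP] := cF (t, p) t0 _ hW.
  have /nbhs_ballP[r /= r0 hr] := h1.
  have r20 : 0 < r / 2 by rewrite divr_gt0.
  exists (ball t (r / 2) `*` P2, [set d | d < r / 2]).
    split=> /=; last exact: nbhs_right_lt.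
    by exists (ball t (r / 2), P2) => //; split=> //=; exact: nbhsx_ballx.
  move=> [[t' p'] d] [[/= bt' P2p'] dr] t'0 s s0 sd.
  have P1t' : P1 t'.
    apply: hr; move: bt'; rewrite -!ball_normE /= => /lt_trans; apply.
    by rewrite ltr_pdivrMr// ltr_pMr// ltr1n.
  have P1s : P1 s.
    apply: hr; move: bt'; rewrite -!ball_normE /= => bt'.
    have -> : t - s = (t - t') - (s - t') by rewrite opprB addrA subrK.
    by rewrite (le_lt_trans (ler_normB _ _))// [ltRHS]splitr ltrD// (le_lt_trans sd).
  have a1 := hP (s, p') (conj P1s P2p') s0; have a2 := hP (t', p') (conj P1t' P2p') t'0.
  have -> : F s p' - F t' p' = (F t p - F t' p') - (F t p - F s p') by ring.
  by rewrite (le_trans (ler_normB _ _))// [leRHS]splitr lerD.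
exists d => // t s p tT s0 st.
have tI : (`[tau0, T] `*` [set: S]) (t, p) by split=> //=; rewrite in_itv.
have t0 : tau0 <= t by case/andP: tT.
exact: (dP (t, p) tI t0 s s0 st).
Qed.

End JointContinuity.

(** * The evolution equation *)

(** Only earlier times are compared, since a minimum over a time interval may lie at its right
    end. *)
Lemma left_min_derive_le0 (R : realType) (phi : R -> R) (a x d : R) : a < x ->
  is_derive x 1 phi d -> (forall y, a <= y <= x -> phi x <= phi y) -> d <= 0.
Proof.
move=> ax [dphi <-] hmin; rewrite leNgt; apply/negP => d0.
have hq : nbhs (0 : R) (fun h => h != 0 ->
    0 < h^-1 *: ((phi \o shift x) (h *: 1) - phi x)).
  by have := cvgr_gt _ dphi _ d0; apply.
move/nbhs_ballP: hq => [r /= r0 hr].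
pose h := - Num.min (r / 2) (x - a).
have h0 : h < 0 by rewrite oppr_lt0 lt_min subr_gt0 ax divr_gt0.
have hax : a <= x + h by rewrite -lerBlDl /h -lerN2 opprK opprB ge_min lexx orbT.
have : 0 < h^-1 *: (phi (h *: 1 + x) - phi x).
  apply: hr; last by rewrite lt_eqF.
  rewrite -ball_normE/= sub0r normrN ltr0_norm// /h opprK (@le_lt_trans _ _ (r / 2)) ?ge_min ?lexx//.
  by rewrite ltr_pdivrMr// ltr_pMr// ltr1n.
rewrite [h%:A]mulr1 [h + x]addrC nmulr_rgt0 ?invr_lt0// subr_lt0 ltNge.
by rewrite hmin// hax gerDl ltW.
Qed.

(* [s] stands for [beta * v (sigma t)], [w] for [v t]; the hypotheses are the two equations,
   the monotonicity of [f] and the sign of the Laplacian of the difference at a minimum. *)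
Lemma comparison_step (R : realFieldType) (s w Ls Lw fs fw K M L B ds dw : R) :
  0 <= s -> s < w -> w <= M -> `|Lw| <= L -> 0 <= fw -> fw <= fs -> fw <= B ->
  0 <= L -> 0 <= B -> 0 <= M ->
  2 * M * L + 3 * B * M ^+ 2 + 1 <= K ->
  ds = s ^+ 2 * Ls + fs * s ^+ 3 - 2^-1 * s ->
  dw = w ^+ 2 * Lw + fw * w ^+ 3 - 2^-1 * w ->
  Lw <= Ls -> ~ ds - dw <= K * (s - w).
Proof.
move=> s0 sw wM LL f0 ff fB L0 B0 M0 KK -> -> LwLs.
have D0 : 0 < w - s by rewrite subr_gt0.
have w0 := le_trans s0 (ltW sw).
have h1 : s ^+ 2 * Lw <= s ^+ 2 * Ls by rewrite ler_wpM2l ?sqr_ge0.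
have h2 : fw * s ^+ 3 <= fs * s ^+ 3 by rewrite ler_wpM2r ?exprn_ge0.
pose c := (s + w) * Lw + fw * (s ^+ 2 + s * w + w ^+ 2).
have sM : s <= M := le_trans (ltW sw) wM.
have c1 : (s + w) * Lw <= 2 * M * L.
  apply: (@le_trans _ _ ((s + w) * L)).
    by rewrite ler_wpM2l ?addr_ge0// (le_trans (ler_norm _)).
  by rewrite ler_wpM2r// mulr2n mulrDl mul1r lerD.
have c2 : fw * (s ^+ 2 + s * w + w ^+ 2) <= 3 * B * M ^+ 2.
  have : s ^+ 2 + s * w + w ^+ 2 <= 3 * M ^+ 2.
    have a1 : s ^+ 2 <= M ^+ 2 by rewrite ler_pXn2r ?nnegrE.
    have a2 : w ^+ 2 <= M ^+ 2 by rewrite ler_pXn2r ?nnegrE.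
    have a3 : s * w <= M ^+ 2 by rewrite expr2 ler_pM.
    by lra.
  move=> h; apply: (@le_trans _ _ (B * (3 * M ^+ 2))); last by rewrite mulrA (mulrC B).
  by rewrite ler_pM// !addr_ge0 ?sqr_ge0// mulr_ge0.
have cK : c * (w - s) <= (K - 1) * (w - s).
  by rewrite ler_wpM2r ?(ltW D0)//; rewrite /c; lra.
have E : s ^+ 2 * Lw + fw * s ^+ 3 - 2^-1 * s - (w ^+ 2 * Lw + fw * w ^+ 3 - 2^-1 * w) =
   2^-1 * (w - s) - c * (w - s) by rewrite /c; ring.
have E2 : K * (s - w) = - ((K - 1) * (w - s)) - (w - s) by ring.
rewrite E2 => h.
have h3 : s ^+ 2 * Lw + fw * s ^+ 3 <= s ^+ 2 * Ls + fs * s ^+ 3 by rewrite lerD.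
move: h h3 E cK D0; move: (s ^+ 2 * Ls) (fs * s ^+ 3) (s ^+ 2 * Lw) (fw * s ^+ 3)
  (w ^+ 2 * Lw + fw * w ^+ 3) (c * (w - s)) ((K - 1) * (w - s)).
by clear=> *; lra.
Qed.

Section Evolution.
Context (R : realType) (m : nat) (S : topologicalType) (S_compact : compact [set: S]).
Context (Sigma : smooth_atlas R m S) (gamma : riemannian_metric Sigma) (tau0 : R).
Context (f : R -> S -> R) (f_smooth : smooth_cylinder tau0 Sigma f) (B : R).
Context (f_bounded : forall tau p, tau0 <= tau -> `|f tau p| <= B).
Context (f_ge0 : forall tau p, tau0 <= tau -> 0 <= f tau p).
Context (df_ge0 : forall tau p, tau0 <= tau -> 0 <= time_derive tau0 (f ^~ p) tau).
Context (v : R -> S -> R) (v_smooth : smooth_cylinder tau0 Sigma v).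
Context (v_solution : forall tau p, tau0 <= tau ->
    time_derive tau0 (v ^~ p) tau =
      v tau p ^+ 2 * laplacian gamma (v tau) p + f tau p * v tau p ^+ 3
      - 2^-1 * v tau p).
Context (mu : R) (mu_gt0 : 0 < mu) (v_ge_mu : forall tau p, tau0 <= tau -> mu <= v tau p).

Let vt t p := time_derive tau0 (v ^~ p) t.

Lemma v_gt0 t p : tau0 <= t -> 0 < v t p.
Proof. by move=> t0; exact: lt_le_trans (v_ge_mu p t0). Qed.

Lemma laplacian_v t p : tau0 <= t ->
  laplacian gamma (v t) p = vt t p / v t p ^+ 2 - f t p * v t p + 2^-1 / v t p.
Proof.
move=> t0; rewrite /vt v_solution//; have v0 := v_gt0 p t0.
by field; rewrite gt_eqF.
Qed.

Lemma f_nondecreasing s t p : tau0 <= s -> s <= t -> f s p <= f t p.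
Proof.
move=> s0; rewrite le_eqVlt => /predU1P[->//|st].
have d x : x \in `]s, t[%R -> is_derive x 1 (f ^~ p) (time_derive tau0 (f ^~ p) x).
  rewrite in_itv/= => /andP[sx _].
  exact: cylinder_is_derive p f_smooth (le_lt_trans s0 sx).
have [|c] := @MVT R (f ^~ p) _ s t st d.
- apply: continuous_subspaceW; last exact: (jointly_continuous_time (cylinder_continuous f_smooth)).
  by move=> x /=; rewrite in_itv/= => /andP[sx _]; exact: le_trans sx.
- rewrite in_itv/= => /andP[sc _] E.
  by rewrite -subr_ge0 E mulr_ge0 ?subr_ge0 ?(ltW st)// df_ge0// (le_trans s0)// ltW.
Qed.

(** The equation bounds the Laplacian through [v], its time derivative and [f], with [v >= mu]
    controlling the division by [v ^+ 2]. *)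
Lemma v_data_bounded (T : R) : exists M L : R, [/\ 0 <= M, 0 <= L &
  forall t p, tau0 <= t <= T -> v t p <= M /\ `|laplacian gamma (v t) p| <= L].
Proof.
have [M hM] := jointly_continuous_bounded S_compact T (cylinder_continuous v_smooth).
have [M' hM'] := jointly_continuous_bounded S_compact T
  (cylinder_time_derive_continuous v_smooth).
exists `|M|, (`|M'| / mu ^+ 2 + `|B| * `|M| + 2^-1 / mu); split => //.
  by rewrite !addr_ge0 ?mulr_ge0 ?invr_ge0 ?exprn_ge0 ?(ltW mu_gt0).
move=> t p tT; have [t0 _] := andP tT; have v0 := v_gt0 p t0.
have vM : `|v t p| <= `|M| by rewrite (le_trans (hM t p tT))// ler_norm.
split; first by rewrite (le_trans (ler_norm _)).
have vi : (v t p)^-1 <= mu^-1 by rewrite lef_pV2 ?posrE// v_ge_mu.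
rewrite laplacian_v// (le_trans (ler_normD _ _))// lerD//.
  rewrite (le_trans (ler_normB _ _))// lerD//.
    rewrite normrM ler_pM//; first by rewrite (le_trans (hM' t p tT))// ler_norm.
    rewrite ger0_norm ?invr_ge0 ?exprn_ge0 ?(ltW v0)// -!exprVn.
    by rewrite ler_pXn2r ?nnegrE ?invr_ge0 ?(ltW v0) ?(ltW mu_gt0).
  rewrite normrM ler_pM//.
  by rewrite (le_trans (f_bounded p t0))// ler_norm.
by rewrite ger0_norm ?mulr_ge0 ?invr_ge0 ?(ltW v0)// ler_wpM2l.
Qed.

(* [beta t * v (sigma t) p] is a supersolution of the equation because [f] is nondecreasing
   in time; the relations between [beta] and [sigma] are those of the scaling
   [u(s) -> lam^(1/2) u(lam s)], in the variable [s = 1 - exp (tau0 - t)]. *)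
Lemma reparametrized_comparison (T : R) (sigma beta : R -> R) : tau0 <= T ->
  (forall t, tau0 <= t <= T -> is_derive t 1 sigma (beta t ^+ 2)) ->
  (forall t, tau0 <= t <= T -> is_derive t 1 beta (2^-1 * beta t * (beta t ^+ 2 - 1))) ->
  (forall t, tau0 <= t <= T -> 0 < beta t /\ t <= sigma t) ->
  sigma tau0 = tau0 -> 1 <= beta tau0 ->
  forall t p, tau0 <= t <= T -> v t p <= beta t * v (sigma t) p.
Proof.
move=> T0 dsig dbet hbs sig0 bet0 t p tT.
have [M [L [M0 L0 hML]]] := v_data_bounded T.
(* Where [D] is negative, [2 * M * L] accounts for the difference of the coefficients [v ^+ 2] and
   the next term for that of the cubes; the [1] makes the inequality strict. The weight
   [expR (- K * t)] turns this growth rate into a contradiction at a minimum. *)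
pose K := 2 * M * L + 3 * `|B| * M ^+ 2 + 1.
pose D t p := beta t * v (sigma t) p - v t p.
pose Phi t p := expR (- K * t) * D t p.
rewrite -subr_ge0 -/(D t p).
have cPhi : {within `[tau0, T] `*` [set: S], continuous (fun z => Phi z.1 z.2)}.
  have cv := cylinder_continuous v_smooth.
  have c1 := continuous_subspaceW _ cv.
  apply/subspace_continuousP => -[s q] [/=]; rewrite in_itv/= => sT _.
  have [s0 _] := andP sT; have [bs0 ssig] := hbs s sT.
  set Fl := within _ _.
  have FlF : Filter Fl by exact: within_filter.
  have fst_cvg : z.1 @[z --> Fl] --> s.
    move=> P hP; exists (P, setT); first by split=> //; exact: filterT.
    by move=> [a b] [Pa _] _; exact: Pa.
  have snd_cvg : z.2 @[z --> Fl] --> q.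
    move=> P hP; exists (setT, P); first by split=> //; exact: filterT.
    by move=> [a b] [_ Pb] _; exact: Pb.
  have time_cvg (b : R -> R) : {for s, continuous b} -> b z.1 @[z --> Fl] --> b s.
    by move=> cb; apply: (cvg_comp (fun z : R * S => z.1) b fst_cvg).
  have v_cvg (b : R -> R) : {for s, continuous b} -> (forall t, tau0 <= t <= T -> tau0 <= b t) ->
      v (b z.1) z.2 @[z --> Fl] --> v (b s) q.
    move=> cb b0.
    have h := (subspace_continuousP _ _).1 cv (b s, q) (b0 s sT).
    apply: (cvg_comp (fun z : R * S => (b z.1, z.2)) (fun z => v z.1 z.2) _ h).
    move=> P [[P1 P2] [/= hP1 hP2] hP].
    have h1 := time_cvg b cb _ hP1; have h2 := snd_cvg _ hP2.
    have h12 : nbhs (s, q) (fun z : R * S => (`[tau0, T] `*` [set: S]) z -> P1 (b z.1) /\ P2 z.2).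
      exact: (@filterI _ Fl _ _ _ h1 h2).
    apply: filterS h12 => -[t' q'] g12 t'T; have [g1 g2] := g12 t'T.
    apply: (hP (b t', q')); first by split; [exact: g1|exact: g2].
    by apply: b0; case: t'T => /=; rewrite in_itv.
  have der_cont (b : R -> R) d : is_derive s 1 b d -> {for s, continuous b}.
    by move=> [db _]; apply: differentiable_continuous; exact/derivable1_diffP.
  have e1 : expR (- K * z.1) @[z --> Fl] --> expR (- K * s).
    apply: (time_cvg (fun t => expR (- K * t))).
    by apply: continuous_comp; [exact: mulrl_continuous|exact: continuous_expR].
  have e2 : beta z.1 @[z --> Fl] --> beta s by exact: time_cvg (der_cont _ _ (dbet s sT)).
  have e3 : v (sigma z.1) z.2 @[z --> Fl] --> v (sigma s) q.
    apply: v_cvg (der_cont _ _ (dsig s sT)) _ => t' t'T.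
    by have [_ ] := hbs t' t'T; apply: le_trans; case/andP: t'T.
  have e4 : v z.1 z.2 @[z --> Fl] --> v s q.
    by apply: (v_cvg id) => // t' /andP[].
  exact: cvgM e1 (cvgB (cvgM e2 e3) e4).
have [|[t1 p1] tp1 tmin] := compact_EVT_min _ (compact_setX (@segment_compact _ tau0 T) S_compact) cPhi.
  by exists (t, p); split=> //=; rewrite in_itv.
move: tp1; rewrite inE => -[/=]; rewrite in_itv/= => t1T _.
have [t10 t1T'] := andP t1T.
have {}tmin s q : tau0 <= s <= T -> Phi t1 p1 <= Phi s q.
  by move=> sT; apply: (tmin (s, q)); rewrite inE; split=> //=; rewrite in_itv.
suff D0 : 0 <= D t1 p1.
  have := tmin t p tT; rewrite /Phi => h.
  have : 0 <= expR (- K * t) * D t p by rewrite (le_trans _ h)// mulr_ge0// expR_ge0.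
  by rewrite pmulr_rge0// expR_gt0.
rewrite leNgt; apply/negP => D0.
have t1gt : tau0 < t1.
  rewrite lt_neqAle t10 andbT; apply/eqP => E; move: D0; rewrite -E /D sig0 ltNge => /negP[].
  by rewrite subr_ge0 ler_peMl// ltW// v_gt0.
have [b1 s1] := hbs t1 t1T.
have sg0 : tau0 <= sigma t1 := le_trans t10 s1.
have sggt : tau0 < sigma t1 := lt_le_trans t1gt s1.
have dv := cylinder_is_derive p1 v_smooth t1gt.
have dvs : is_derive t1 1 (fun t => v (sigma t) p1) (vt (sigma t1) p1 * beta t1 ^+ 2).
  have h1 := cylinder_is_derive p1 v_smooth sggt; have h2 := dsig t1 t1T.
  exact: (@is_derive1_comp _ (fun t => v t p1) sigma t1 _ _ h1 h2).
pose dD := beta t1 * (vt (sigma t1) p1 * beta t1 ^+ 2) +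
  v (sigma t1) p1 * (2^-1 * beta t1 * (beta t1 ^+ 2 - 1)) - vt t1 p1.
have dDD : is_derive t1 1 (fun t => D t p1) dD.
  exact: is_deriveB (is_deriveM (dbet t1 t1T) dvs) dv.
have dexp : is_derive t1 1 (fun t => expR (- K * t)) (expR (- K * t1) * - K).
  have h := @is_deriveZ R R R id (- K) t1 1 1 (is_derive_id _ _).
  rewrite [_%:A]mulr1 in h.
  exact: (@is_derive1_comp _ expR (fun t => - K * t) t1 _ _ (is_derive_expR _) h).
have dPhi := is_deriveM dexp dDD.
have {dPhi} le0 : expR (- K * t1) * (dD - K * D t1 p1) <= 0.
  have -> : expR (- K * t1) * (dD - K * D t1 p1) =
      expR (- K * t1) * dD + D t1 p1 * (expR (- K * t1) * - K) by ring.
  apply: (@left_min_derive_le0 _ (Phi ^~ p1) _ _ _ t1gt dPhi) => t2 /andP[t20 t2t].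
  by apply: tmin; rewrite t20/=; exact: le_trans t2t _.
rewrite pmulr_rle0 ?expR_gt0// subr_le0 in le0.
have Lmin : laplacian gamma (v t1) p1 <= beta t1 * laplacian gamma (v (sigma t1)) p1.
  have C2s := cylinder_C2 v_smooth sg0.
  have C20 := C2_manifold_lin (beta t1) C2s (C2_manifold_cst 0).
  have <- : laplacian gamma (fun q => beta t1 * v (sigma t1) q + cst 0 q) p1 =
      beta t1 * laplacian gamma (v (sigma t1)) p1.
    apply: etrans (laplacian_lin gamma (beta t1) p1 C2s (C2_manifold_cst 0)) _.
    by apply: etrans (f_equal _ (laplacian_cst gamma 0 p1)) (addr0 _).
  apply: laplacian_le_at_min C20 (cylinder_C2 v_smooth t10) _; apply: filterS filterT => q _.
  have := tmin t1 q t1T; rewrite /Phi ler_pM2l ?expR_gt0//.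
  by rewrite /D /cst !addr0.
have [vM LM] := hML t1 p1 t1T.
have s0 : 0 <= beta t1 * v (sigma t1) p1 by rewrite mulr_ge0 ?ltW// v_gt0.
apply: (@comparison_step R (beta t1 * v (sigma t1) p1) (v t1 p1)
  (beta t1 * laplacian gamma (v (sigma t1)) p1) (laplacian gamma (v t1) p1)
  (f (sigma t1) p1) (f t1 p1) K M L `|B| (dD + vt t1 p1) (vt t1 p1)) => //.
- by rewrite -subr_lt0.
- exact: f_ge0.
- exact: f_nondecreasing.
- by rewrite (le_trans (ler_norm _))// (le_trans (f_bounded p1 t10))// ler_norm.
- rewrite /dD /vt v_solution//; move: (v (sigma t1) p1) (beta t1) (laplacian _ _ _) => *.
  by field.
- by rewrite /vt v_solution.
- by rewrite addrK.
Qed.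

(** With $s = 1 - e^{\tau_0-\tau}$ and $u = e^{(\tau-\tau_0)/2} v$ the linear term disappears: $u_s
    = u^2 \Delta u + f u^3$. Multiplying $s$ by the constant [lam] that takes the time [t] to [t']
    and returning to $\tau$ gives [sig], and [bet] is the square root of its derivative. The delay
    [tau0 + 1 <= t] keeps [s t] away from [0], which bounds [lam]; [t' <= t + 1] bounds the
    exponential factor. *)
Lemma reparametrization (t t' : R) : tau0 + 1 <= t -> t <= t' -> t' <= t + 1 ->
  exists sigma beta : R -> R,
  [/\ forall s, tau0 <= s <= t -> is_derive s 1 sigma (beta s ^+ 2) /\
        is_derive s 1 beta (2^-1 * beta s * (beta s ^+ 2 - 1)),
      forall s, tau0 <= s <= t -> 0 < beta s /\ s <= sigma s,
      sigma tau0 = tau0 /\ 1 <= beta tau0, sigma t = t' &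
      beta t <= Num.sqrt (1 - expR (- 1))^-1 * expR 2^-1].
Proof.
move=> t1 tt' tt1.
pose s x := 1 - expR (tau0 - x).
have s_lt1 x : s x < 1 by rewrite ltrBlDr ltrDl expR_gt0.
have s_inc x y : x <= y -> s x <= s y by move=> xy; rewrite lerB// ler_expR lerB.
have sE : 1 - expR (- 1) <= s t by rewrite lerB// ler_expR; lra.
have E0 : 0 < 1 - expR (- 1) :> R by rewrite subr_gt0 expR_lt1 oppr_lt0.
have st0 : 0 < s t := lt_le_trans E0 sE.
pose lam := s t' / s t.
have lam1 : 1 <= lam by rewrite ler_pdivlMr// mul1r s_inc.
have lam0 : 0 < lam := lt_le_trans ltr01 lam1.
pose G x := 1 - lam * s x.
have G0 x : x <= t -> 0 < G x.
  move=> xt; rewrite subr_gt0 (le_lt_trans _ (s_lt1 t'))//.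
  by rewrite (le_trans (ler_wpM2l (ltW lam0) (s_inc _ _ xt)))// divfK ?gt_eqF.
have G_le x : tau0 <= x -> G x <= expR (tau0 - x).
  move=> x0; have e1 : expR (tau0 - x) <= 1 by rewrite -expR0 ler_expR subr_le0.
  by rewrite /G /s; nra.
pose sig x := tau0 - ln (G x).
pose bet x := Num.sqrt lam * expR (2^-1 * (sig x - x)).
have bet2 x : bet x ^+ 2 = lam * expR (sig x - x).
  rewrite exprMn sqr_sqrtr ?(ltW lam0)// -expRM_natl; congr (_ * expR _).
  by rewrite mulrA divff ?mul1r// pnatr_eq0.
have dsig x : x <= t -> is_derive x 1 sig (bet x ^+ 2).
  move=> xt; have gx := G0 x xt.
  have de : is_derive x 1 (fun x => tau0 - x) (- 1).
    by rewrite -[- 1]sub0r; exact: (is_deriveB (is_derive_cst _ _ _) (is_derive_id _ _)).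
  have dex := @is_derive1_comp _ expR (fun x => tau0 - x) x _ _ (is_derive_expR _) de.
  have dG : is_derive x 1 G (- (lam * expR (tau0 - x))).
    apply: is_derive_eq (is_deriveB (is_derive_cst _ _ _)
      (is_deriveZ lam (is_deriveB (is_derive_cst _ _ _) dex))) _.
    by rewrite /GRing.scale/=; ring.
  have dl := @is_derive1_comp _ (@ln R) G x _ _ (is_derive1_ln gx) dG.
  apply: is_derive_eq (is_deriveB (is_derive_cst _ _ _) dl) _.
  have -> : bet x ^+ 2 = lam * (expR (tau0 - x) * (G x)^-1).
    by rewrite bet2 -[X in _ = _ * (_ * X^-1)]lnK ?posrE// -expRN -expRD /sig addrAC.
  by ring.
have dbet x : x <= t -> is_derive x 1 bet (2^-1 * bet x * (bet x ^+ 2 - 1)).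
  move=> xt; have de := is_deriveZ 2^-1 (is_deriveB (dsig x xt) (is_derive_id x 1)).
  have dex := @is_derive1_comp _ expR (fun x => 2^-1 * (sig x - x)) x _ _ (is_derive_expR _) de.
  apply: is_derive_eq (is_deriveZ (Num.sqrt lam) dex) _.
  by rewrite /GRing.scale/= /bet; ring.
exists sig, bet; split.
- by move=> x /andP[_ xt]; split; [exact: dsig|exact: dbet].
- move=> x /andP[x0 xt]; split; first by rewrite mulr_gt0 ?expR_gt0// sqrtr_gt0.
  rewrite /sig lerBrDl -lerBrDr.
  by rewrite -ler_expR lnK ?posrE ?G0// G_le.
- have G00 : G tau0 = 1 by rewrite /G /s subrr expR0 subrr mulr0 subr0.
  have S0 : sig tau0 = tau0 by rewrite /sig G00 ln1 subr0.
  by split => //; rewrite /bet S0 subrr mulr0 expR0 mulr1 -[leLHS](@sqrtr1 R) ler_wsqrtr.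
- by rewrite /sig /G /lam divfK ?gt_eqF// /s opprB addrCA subrr addr0 expRK opprB addrC subrK.
- have St : sig t = t' by rewrite /sig /G /lam divfK ?gt_eqF// /s opprB addrCA subrr addr0 expRK opprB addrC subrK.
  rewrite /bet St ler_pM ?sqrtr_ge0 ?expR_ge0//.
    apply: ler_wsqrtr.
    rewrite /lam -[leRHS]mul1r ler_pM ?invr_ge0 ?(ltW st0) ?(ltW (s_lt1 _))//.
      by rewrite (le_trans (ltW st0))// s_inc.
    by rewrite lef_pV2 ?posrE.
  by rewrite ler_expR; lra.
Qed.

(** The constant is uniform thanks to the unit delay after [tau0]; it does not involve the size of
    [v]. *)
Lemma time_harnack : exists2 c : R, 0 < c & forall t t' p,
  tau0 + 1 <= t -> t <= t' -> t' <= t + 1 -> c * v t p <= v t' p.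
Proof.
pose C : R := Num.sqrt (1 - expR (- 1))^-1 * expR 2^-1.
have C0 : 0 < C by rewrite mulr_gt0 ?expR_gt0// sqrtr_gt0 invr_gt0 subr_gt0 expR_lt1 oppr_lt0.
exists C^-1; first by rewrite invr_gt0.
move=> t t' p t1 tt' tt1; have t0 : tau0 <= t by apply: le_trans t1; rewrite lerDl.
have [sigma [beta [d hbs [s0 b0] st bt]]] := reparametrization t1 tt' tt1.
have h : v t p <= beta t * v (sigma t) p.
  apply: (reparametrized_comparison t0 _ _ hbs s0 b0); first by move=> s /d[].
    by move=> s /d[].
  by rewrite t0 lexx.
rewrite mulrC ler_pdivrMr// (le_trans h)// st mulrC ler_wpM2l//.
by rewrite ltW// v_gt0// (le_trans t0).
Qed.

(** At a space-time maximum over [C] later than [tau0] the time derivative would be nonnegative,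
    although the Laplacian is nonpositive there and the linear term negative. Hence the initial
    maximum is a bound. *)
Lemma bounded_where_f_vanishes (C : set S) : open C -> closed C -> C !=set0 ->
  (forall t p, tau0 <= t -> C p -> f t p = 0) ->
  exists M : R, forall t p, tau0 <= t -> C p -> v t p <= M.
Proof.
move=> Co Cc C0 fC.
have [M hM] := jointly_continuous_bounded S_compact tau0 (cylinder_continuous v_smooth).
exists M => T p T0 Cp.
have [t1 [p1 [t1T Cp1 hmin]]] := jointly_continuous_min S_compact
  (jointly_continuousN (cylinder_continuous v_smooth)) Cc C0 T0.
have TT : tau0 <= T <= T by rewrite T0 lexx.
have hp : v T p <= v t1 p1 by rewrite -lerN2 hmin.
have [t10 t1T'] := andP t1T.
have [t1E|t1E] := eqVneq t1 tau0.
  by rewrite (le_trans hp)// t1E (le_trans (ler_norm _))// hM// !lexx.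
have t1gt : tau0 < t1 by rewrite lt_neqAle eq_sym t1E.
have dN : is_derive t1 1 (fun t => - v t p1) (- vt t1 p1).
  exact: is_deriveN (cylinder_is_derive p1 v_smooth t1gt).
have vt0 : - vt t1 p1 <= 0.
  apply: (left_min_derive_le0 t1gt dN) => s /andP[s0 st1].
  by apply: hmin => //; rewrite s0 (le_trans st1).
have L0 : laplacian gamma (v t1) p1 <= 0.
  rewrite -(laplacian_cst gamma 0 p1).
  apply: laplacian_le_at_min (C2_manifold_cst 0) (cylinder_C2 v_smooth t10) _.
  apply: filterS (open_nbhs_nbhs (conj Co Cp1)) => q Cq.
  by rewrite !sub0r hmin.
have v0 := v_gt0 p1 t10.
move: vt0; rewrite oppr_le0 /vt v_solution// (fC _ _ t10 Cp1) mul0r addr0 leNgt => /negP[].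
have : v t1 p1 ^+ 2 * laplacian gamma (v t1) p1 <= 0 by rewrite mulr_ge0_le0// sqr_ge0.
by move=> h; rewrite subr_lt0 (le_lt_trans h)// mulr_gt0// invr_gt0.
Qed.

(** * Averages of the solution over unit time intervals *)

Let rho t p := vt t p / v t p ^+ 2.

Lemma jointly_continuous_rho : jointly_continuous tau0 rho.
Proof.
apply/subspace_continuousP => -[s p] /= s0.
have h1 := (subspace_continuousP _ _).1 (cylinder_continuous v_smooth) (s, p) s0.
have h2 := (subspace_continuousP _ _).1 (cylinder_time_derive_continuous v_smooth) (s, p) s0.
apply: cvgM h2 _; apply: cvgV; first by rewrite expf_neq0// gt_eqF// v_gt0.
exact: (cvgM h1 h1).
Qed.

Lemma inverse_increment (t h : R) p : tau0 < t -> 0 < h ->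
  exists2 c, t < c < t + h & (v t p)^-1 - (v (t + h) p)^-1 = rho c p * h.
Proof.
move=> t0 h0; have th : t < t + h by rewrite ltrDl.
have d x : tau0 < x -> is_derive x 1 (fun s => (v s p)^-1) (- rho x p).
  move=> x0; have dv := cylinder_is_derive p v_smooth x0.
  have vx : v x p != 0 by rewrite gt_eqF// v_gt0// ltW.
  by apply: is_derive_eq (is_deriveV vx dv) _; rewrite /rho /GRing.scale/= mulNr mulrC.
have [||c cI E] := @MVT R (fun s => (v s p)^-1) (fun s => - rho s p) _ _ th.
- by move=> x; rewrite in_itv/= => /andP[tx _]; apply: d; exact: lt_trans tx.
- apply: derivable_within_continuous => x; rewrite in_itv/= => /andP[tx _].
  by have [] := d x (lt_le_trans t0 tx).
exists c; first by move: cI; rewrite in_itv.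
by rewrite -opprB E addrAC subrr add0r mulNr opprK.
Qed.

Let times (J : nat) t (j : nat) : R := t + j%:R / J%:R.

(** As a finite sum it is regular in space, and its Laplacian is computed by linearity. *)
Let average (J : nat) t p := \sum_(j < J) J%:R^-1 * v (times J t j) p.

Lemma average_C2_laplacian J t : tau0 <= t ->
  C2_manifold Sigma (average J t) /\ forall p, laplacian gamma (average J t) p =
    \sum_(j < J) J%:R^-1 * laplacian gamma (v (times J t j)) p.
Proof.
move=> t0; rewrite /average.
have tj0 j : tau0 <= times J t j by rewrite (le_trans t0)// lerDl divr_ge0.
move: (times J t) tj0 (J%:R^-1) => s s0 h; elim: J => [|J [IC IL]].
  have -> : (fun p => \sum_(j < 0) h * v (s j) p) = cst 0.
    by apply: funext => p; rewrite big_ord0.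
  split; first exact: C2_manifold_cst.
  by move=> p; rewrite big_ord0; exact: laplacian_cst.
have -> : (fun p => \sum_(j < J.+1) h * v (s j) p) =
    (fun p => h * v (s J) p + \sum_(j < J) h * v (s j) p).
  by apply: funext => p; rewrite big_ord_recr addrC.
have Cv := cylinder_C2 v_smooth (s0 J).
split; first exact: C2_manifold_lin.
move=> p; apply: etrans (laplacian_lin gamma h p Cv IC) _.
by rewrite [RHS]big_ord_recr [RHS]addrC; congr (_ + _); exact: IL.
Qed.

(* [average J t] is the Riemann sum of [v] over [t, t + 1]; its mesh is chosen so fine that
   the sum of [v_t / v^2] is close to the integral of [- (1/v)_t]. *)
Lemma time_average t : tau0 < t -> exists2 J : nat, (0 < J)%N & forall p,
  `|laplacian gamma (average J t) p +
    \sum_(j < J) J%:R^-1 * (f (times J t j) p * v (times J t j) p)| <= 1 + 2 / mu.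
Proof.
move=> t0.
have [d d0 hd] := jointly_continuous_unif S_compact (t + 1) jointly_continuous_rho ltr01.
pose J := (Num.truncn d^-1).+1; exists J => // p; pose h : R := J%:R^-1.
have J0 : 0 < J%:R :> R by rewrite ltr0n.
have h0 : 0 < h by rewrite invr_gt0.
have hd' : h <= d by rewrite -[d]invrK lef_pV2 ?posrE ?invr_gt0// ltW// truncnS_gt.
have [_ ->] := average_C2_laplacian J (ltW t0).
have tj0 j : tau0 < times J t j by rewrite (lt_le_trans t0)// lerDl divr_ge0.
have tjS j : times J t j.+1 = times J t j + h by rewrite /times -natr1 mulrDl mul1r addrA.
pose a j := (v (times J t j) p)^-1.
have a_bound j : 0 <= a j <= mu^-1.
  by rewrite invr_ge0 (ltW (v_gt0 p (ltW (tj0 j))))/= lef_pV2 ?posrE ?v_gt0 ?v_ge_mu// ltW.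
have step (j : 'I_J) : `|h * rho (times J t j) p + (a j.+1 - a j)| <= h.
  have [c /andP[tc ct] E] := inverse_increment p (tj0 j) h0.
  rewrite -opprB /a tjS E [rho c p * h]mulrC -mulrBr normrM (ger0_norm (ltW h0)).
  rewrite -[leRHS]mulr1 ler_wpM2l ?(ltW h0)//; apply: hd.
  - rewrite (ltW (lt_trans (tj0 j) tc))/= (le_trans (ltW ct))// -tjS lerD2l.
    by rewrite ler_pdivrMr// mul1r ler_nat.
  - exact: ltW (tj0 j).
  - by rewrite distrC ger0_norm ?subr_ge0 ?(ltW tc)// (le_trans _ hd')// lerBlDl ltW.
have -> : \sum_(j < J) h * laplacian gamma (v (times J t j)) p +
    \sum_(j < J) h * (f (times J t j) p * v (times J t j) p) =
  \sum_(j < J) (h * rho (times J t j) p + (a j.+1 - a j)) +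
    (\sum_(j < J) h * (2^-1 * a j) - \sum_(j < J) (a j.+1 - a j)).
  rewrite -sumrB -!big_split/=; apply: eq_bigr => j _.
  by rewrite laplacian_v ?(ltW (tj0 j))// /rho /a; ring.
have sum_h : \sum_(j < J) h = 1.
  by rewrite sumr_const card_ord -[h *+ J]mulr_natl mulfV// gt_eqF.
(* The [1] is the error of the Riemann sum, one [mu^-1] bounds the linear term of the equation and
   the other the telescoping increments of the inverse of [v]. *)
have -> : 1 + 2 / mu = 1 + (mu^-1 + mu^-1) by rewrite mulr2n mulrDl mul1r.
rewrite (le_trans (ler_normD _ _))// lerD//.
  by rewrite (le_trans (ler_norm_sum _ _ _))// -[leRHS]sum_h ler_sum.
rewrite (le_trans (ler_normB _ _))// lerD//.
  rewrite ger0_norm; last first.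
    by rewrite sumr_ge0// => j _; rewrite !mulr_ge0 ?(ltW h0)//; case/andP: (a_bound j).
  rewrite -[leRHS]mul1r -[X in _ <= X * _]sum_h mulr_suml ler_sum// => j _.
  rewrite ler_wpM2l ?(ltW h0)//; have /andP[] := a_bound j.
  by move: (a j) mu^-1 => x y; lra.
rewrite -(big_mkord xpredT (fun j => a j.+1 - a j)) telescope_sumr//.
have := a_bound J; have := a_bound 0%N; move: (a J) (a 0%N) mu^-1.
by move=> x y z /andP[? ?] /andP[? ?]; apply/ler_normlP; split; lra.
Qed.

Lemma mean_ge (J : nat) (a : R) (x : nat -> R) : (0 < J)%N ->
  (forall j, (j < J)%N -> a <= x j) -> a <= \sum_(j < J) J%:R^-1 * x j.
Proof.
move=> J0 h; have -> : a = \sum_(j < J) J%:R^-1 * a.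
  by rewrite sumr_const card_ord -mulrnAl -[X in _ = X * _]mulr_natl mulfV ?mul1r// pnatr_eq0 -lt0n.
by apply: ler_sum => j _; rewrite ler_wpM2l ?invr_ge0// h.
Qed.

Lemma bounded_solution : exists M : R, forall t p, tau0 <= t -> v t p <= M.
Proof.
apply: contrapT => unbounded.
have cv := cylinder_continuous v_smooth.
(* [v] is bounded on compact time intervals, so its large values occur late. The [1] is the delay of
   [time_harnack]; the times must tend to infinity so that [f] eventually exceeds its value at any
   given time. *)
have big k : exists tp : R * S, tau0 + 1 + k%:R <= tp.1 /\ k.+1%:R <= v tp.1 tp.2.
  have [M hM] := jointly_continuous_bounded S_compact (tau0 + 1 + k%:R) cv.
  apply: contrapT => small; apply: unbounded.
  exists (Num.max M k.+1%:R) => t p t0; rewrite le_max.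
  have [tk|tk] := leP t (tau0 + 1 + k%:R).
    by rewrite (le_trans (ler_norm _))// hM// t0.
  apply/orP; right; rewrite leNgt; apply/negP => kv.
  by apply: small; exists (t, p) => /=; rewrite !ltW.
have [tp htp] := choice big; pose t k := (tp k).1.
have t1 k : tau0 + 1 <= t k.
  by have [h _] := htp k; apply: le_trans h; rewrite lerDl.
have t0 k : tau0 < t k by apply: lt_le_trans (t1 k); rewrite ltrDl.
have [Jn hJn] := choice (fun k => (let: ex_intro2 J J0 hJ := time_average (t0 k) in
  ex_intro (fun J => (0 < J)%N /\ _) J (conj J0 hJ))).
pose tj k := times (Jn k) (t k).
pose V k := average (Jn k) (t k).
pose G k p := \sum_(j < Jn k) (Jn k)%:R^-1 * (f (tj k j) p * v (tj k j) p).
pose C1 := 1 + 2 / mu.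
have C10 : 0 < C1 by rewrite addr_gt0// divr_gt0.
have V2 k : C2_manifold Sigma (V k) by have [] := average_C2_laplacian (Jn k) (ltW (t0 k)).
have tJ k j : (j < Jn k)%N -> t k <= tj k j <= t k + 1.
  move=> jJ; rewrite lerDl divr_ge0//= lerD2l ler_pdivrMr ?mul1r ?ler_nat ?ltr0n ?(ltnW jJ)//.
  by case: (hJn k).
have tJ0 k j : (j < Jn k)%N -> tau0 <= tj k j.
  by move=> jJ; have /andP[h _] := tJ k j jJ; rewrite (le_trans _ h)// ltW.
have LV k p : `|laplacian gamma (V k) p + G k p| <= C1 by case: (hJn k).
have V0 k p : 0 <= V k p.
  apply: (mean_ge (x := fun j => v (tj k j) p)); first by case: (hJn k).
  by move=> j jJ; rewrite ltW// v_gt0// tJ0.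
have G0 k p : 0 <= G k p.
  apply: (mean_ge (x := fun j => f (tj k j) p * v (tj k j) p)); first by case: (hJn k).
  by move=> j jJ; rewrite mulr_ge0 ?f_ge0 ?(ltW (v_gt0 _ _)) ?tJ0.
have GB k p : G k p <= `|B| * V k p.
  rewrite /V /average mulr_sumr; apply: ler_sum => j _.
  rewrite [leRHS]mulrCA ler_wpM2l ?invr_ge0// ler_wpM2r ?(ltW (v_gt0 _ _)) ?tJ0//.
  by rewrite (le_trans (ler_norm _))// (le_trans (f_bounded _ _)) ?tJ0// ler_norm.
(* A large value of [v] at time [t k] persists over the next unit of time, hence in the average. *)
have [c c0 hc] := time_harnack.
have Vc k p : c * v (t k) p <= V k p.
  apply: (mean_ge (x := fun j => v (tj k j) p)); first by case: (hJn k).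
  by move=> j jJ; have /andP[? ?] := tJ k j jJ; apply: hc.
have hm k : exists y, forall p, V k p <= V k y.
  have cV : {within [set: S], continuous (V k)}.
    by apply: continuous_subspaceT => y; exact: C2_manifold_continuous (V2 k) y.
  have [q _ hq] := compact_EVT_max (ex_intro _ (tp k).2 I) S_compact cV.
  by exists q => p; apply: hq; exact: mem_set.
have [x hx] := choice hm; pose N k := V k (x k).
have cN k : c * k.+1%:R <= N k.
  rewrite (le_trans _ (hx k (tp k).2))// (le_trans _ (Vc _ _))// ler_wpM2l ?(ltW c0)//.
  by case: (htp k).
have cN1 k : c <= N k by rewrite (le_trans _ (cN k))// ler_peMr ?(ltW c0)// ler1n.
have N0 k : 0 < N k := lt_le_trans c0 (cN1 k).
(* This ultrafilter contains every tail of the natural numbers, so whatever holds for large [k]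
   holds along it. *)
have [U [UU hU]] := ultraFilterLemma (eventually_filter : ProperFilter \oo).
have UP : ProperFilter U by exact: ultra_proper.
have large (a : R) (y : nat -> R) (e : R) : 0 < e -> (forall k, e * k%:R <= y k) ->
    \forall k \near U, a <= y k.
  move=> e0 hy; apply: hU; exists (Num.truncn (a / e)).+1 => // k /= ak.
  rewrite (le_trans _ (hy k))// mulrC -ler_pdivrMr// (le_trans (ltW (truncnS_gt _)))//.
  by rewrite ler_nat.
have Nlarge a : \forall k \near U, a <= N k.
  apply: (large _ _ c) => // k; rewrite (le_trans _ (cN k))// ler_wpM2l ?(ltW c0)//.
  by rewrite ler_nat.
pose W k p := (N k)^-1 * V k p + cst 0 p.
have WE k p : W k p = V k p / N k by rewrite /W addr0 mulrC.
have W2 k : C2_manifold Sigma (W k) by exact: C2_manifold_lin (V2 k) (C2_manifold_cst _).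
have LWE k p : laplacian gamma (W k) p = laplacian gamma (V k) p / N k.
  apply: etrans (laplacian_lin gamma _ p (V2 k) (C2_manifold_cst _)) _.
  by apply: etrans (f_equal _ (laplacian_cst gamma _ p)) _; rewrite addr0 mulrC.
have W01 k p : 0 <= W k p <= 1.
  by rewrite WE divr_ge0 ?(ltW (N0 k))//= ler_pdivrMr// mul1r hx.
have W1 k : W k (x k) = 1 by rewrite WE -/(N k) divff ?gt_eqF.
have LVu k p : laplacian gamma (V k) p <= C1 - G k p.
  by rewrite lerBrDr (le_trans (ler_norm _)).
have Wlap e : 0 < e -> \forall k \near U, forall q, laplacian gamma (W k) q <= e.
  move=> e0; apply: filterS (Nlarge (C1 / e)) => k Nk q.
  rewrite LWE ler_pdivrMr// (le_trans (LVu k q))// (@le_trans _ _ C1) ?gerBl//.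
  by rewrite mulrC -ler_pdivrMr.
have Wlap_bounded k q : `|laplacian gamma (W k) q| <= C1 / c + `|B|.
  rewrite LWE normrM (gtr0_norm (_ : 0 < (N k)^-1)) ?invr_gt0// ler_pdivrMr// mulrDl.
  have -> : laplacian gamma (V k) q = laplacian gamma (V k) q + G k q - G k q by rewrite addrK.
  rewrite (le_trans (ler_normB _ _))// lerD//.
    by rewrite (le_trans (LV k q))// -mulrA ler_pMr// mulrC ler_pdivlMr// mul1r.
  by rewrite ger0_norm// (le_trans (GB k q))// ler_wpM2l.
have K0 : 0 <= C1 / c + `|B| by rewrite addr_ge0// divr_ge0// ltW.
have [p hp] := concentration_component S_compact W2 Wlap K0 W01 W1 Wlap_bounded.
set C := connected_component setT p in hp.
have Cp : C p by exact: connected_component_refl.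
have Co : open C := component_open Sigma p.
have Cc : closed C by apply: component_closed; exact: closedT.
have [fC|] := EM (forall t q, tau0 <= t -> C q -> f t q = 0).
  have [M hM] := bounded_where_f_vanishes Co Cc (ex_intro _ p Cp) fC.
  have [d d0 [V' pV hd]] := hp p Cp.
  (* For this size of [N k], the lower bound [d] for [W k p] forces [V k p] above the bound [M]
     inherited from [v]. *)
  have [k [Nk dk]] := filter_ex (filterI (Nlarge ((`|M| + 1) / d)) hd).
  have := dk p (nbhs_singleton pV); rewrite WE ler_pdivlMr// => dV.
  have : V k p <= `|M|.
    rewrite -lerN2 (_ : - V k p = \sum_(j < Jn k) (Jn k)%:R^-1 * - v (tj k j) p); last first.
      by rewrite -sumrN; apply: eq_bigr => j _; rewrite mulrN.
    apply: (mean_ge (x := fun j => - v (tj k j) p)); first by case: (hJn k).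
    by move=> j jJ; rewrite lerN2 (le_trans (hM _ _ (tJ0 _ _ jJ) Cp))// ler_norm.
  move: Nk; rewrite ler_pdivrMr// mulrC => Nk Vk.
  by have := le_trans (le_trans Nk dV) Vk; rewrite gerDl leNgt ltr01.
move=> /existsNP[s /existsNP[q /not_implyP[s0 /not_implyP[Cq /eqP fsq]]]].
have fs0 : 0 < f s q by rewrite lt_neqAle eq_sym fsq f_ge0.
pose eta := f s q / 2.
have eta0 : 0 < eta by rewrite divr_gt0.
have etaq : \forall y \near q, eta <= f s y.
  have cf := jointly_continuous_space s0 (cylinder_continuous f_smooth).
  have lt : eta < f s q by rewrite ltr_pdivrMr// ltr_pMr// ltr1n.
  by have := cvgr_ge _ (cf q) _ lt; apply.
have [d d0 [V' qV hd]] := hp q Cq.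
(* Near [q] and for late times [G k] is at least [eta * d * N k]. Once [N k] exceeds
   [2 * C1 / (eta * d)], half of this absorbs [C1], and the other half remains after division by
   [N k]. *)
have Kp : 0 < eta * d / 2 by rewrite divr_gt0 ?mulr_gt0.
apply: (no_persistent_sink S_compact W2 Wlap Co Cc (component_connected (A := setT) (x := p)) Cq Kp
  (filterI etaq qV)).
(* [large] asks for a lower bound proportional to [k], so times are measured from [tau0], which may
   be negative. *)
have tlarge : \forall k \near U, s - tau0 <= t k - tau0.
  apply: (large _ _ 1) => // k; have [h _] := htp k.
  by rewrite mul1r lerBrDl (le_trans _ h)// lerD2r lerDl.
apply: filterS3 hd tlarge (Nlarge (2 * C1 / (eta * d))) => k hd' ts Nk y [etay V'y].
have GV : eta * V k y <= G k y.
  rewrite /V /average mulr_sumr; apply: ler_sum => j _.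
  rewrite [leLHS]mulrCA ler_wpM2l ?invr_ge0// ler_wpM2r ?(ltW (v_gt0 _ _)) ?tJ0//.
  rewrite (le_trans etay)// f_nondecreasing//.
  have /andP[h _] := tJ k j (ltn_ord j); apply: le_trans h.
  by move: ts; rewrite lerD2r.
rewrite LWE ler_pdivrMr// (le_trans (LVu k y))//.
have dV : d * N k <= V k y by rewrite -ler_pdivlMr// -WE hd'.
move: Nk; rewrite ler_pdivrMr ?mulr_gt0// => Nk.
have : eta * (d * N k) <= G k y by rewrite (le_trans _ GV)// ler_wpM2l// ltW.
by move: (G k y) (N k) Nk => g n *; lra.
Qed.

End Evolution.

Theorem theorem1 (R : realType) (n : nat) (hn : (3 <= n)%N)
  (S : topologicalType) (S_compact : compact [set: S])
  (S_hausdorff : hausdorff_space S)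
  (Sigma : smooth_atlas R n.-1 S) (gamma : riemannian_metric Sigma)
  (tau0 : R) (f : R -> S -> R)
  (f_smooth : smooth_cylinder tau0 Sigma f)
  (f_bounded : exists B : R, forall tau p, tau0 <= tau -> `|f tau p| <= B)
  (f_ge0 : forall tau p, tau0 <= tau -> 0 <= f tau p)
  (df_ge0 : forall tau p, tau0 <= tau -> 0 <= time_derive tau0 (f ^~ p) tau)
  (v : R -> S -> R)
  (v_smooth : smooth_cylinder tau0 Sigma v)
  (v_solution : forall tau p, tau0 <= tau ->
    time_derive tau0 (v ^~ p) tau =
      v tau p ^+ 2 * laplacian gamma (v tau) p + f tau p * v tau p ^+ 3
      - 2^-1 * v tau p)
  (mu : R) (mu_gt0 : 0 < mu)
  (v_ge_mu : forall tau p, tau0 <= tau -> mu <= v tau p) :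
  exists M : R, forall tau p, tau0 <= tau -> v tau p <= M.
Proof.
have [B f_bound] := f_bounded.
exact: (@bounded_solution R n.-1 S S_compact Sigma gamma tau0 f f_smooth B f_bound f_ge0 df_ge0
  v v_smooth v_solution mu mu_gt0 v_ge_mu).
Qed.
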